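(* Let $n\ge 1$. For $1\le j\le n$ let $(K_j,a_j,b_j,\theta_j,\gamma_j)\in\mathbb{R}_+^*\times\mathbb{R}\times\mathbb{R}\times\mathbb{R}\times\mathbb{C}$ and let $(\lambda_j,\mu_j,\alpha_j)\in\mathbb{R}\times\mathbb{R}\times\mathbb{C}^*$ be given by $$\lambda_j=\frac{K_j^2}{32\pi}\big(7+2\sqrt3\,\mathrm{Im}(\gamma_je^{-i\theta_j})\big),\quad \mu_j=\frac{K_j^2}{32\pi}\big(-7+2\sqrt3\,\mathrm{Im}(\gamma_je^{-i\theta_j})\big),\quad \alpha_j=\frac{\sqrt3}{32\pi}K_j^2e^{-i\theta_j}.$$ Assume that $\alpha_j\ne\alpha_\ell$ for $j\ne\ell$, and set $\alpha_\sharp=\min_{j\neq\ell}|\alpha_j-\alpha_\ell|$. Let $$U_j=K_je^{ia_j}\Big(\tfrac12\varphi_0^{\gamma_j}+\tfrac{\sqrt3}{2}ie^{i\theta_j}\varphi_1^{\gamma_j}\Big),\qquad V_j=K_je^{ib_j}\Big(\tfrac12\varphi_0^{\gamma_j}-\tfrac{\sqrt3}{2}ie^{i\theta_j}\varphi_1^{\gamma_j}\Big).$$ Then, for all $\kappa>0$, there exists a solution $(u,v)\in\mathcal{C}^\infty(\mathbb{R},\mathcal{X}^\kappa_{\mathcal E}\times\mathcal{X}^\kappa_{\mathcal E})$ of the coupled LLL system $$i\partial_tu=\Pi(|v|^2u),\qquad i\partial_tv=-\Pi(|u|^2v),\qquad (t,z)\in\mathbb{R}\times\mathbb{C},$$ of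 the form $$u(t,z)=\sum_{j=1}^ne^{-i\lambda_jt}U_j(z+\alpha_jt)e^{\frac12(\overline z\alpha_j-z\overline{\alpha_j})t}+r_1(t,z),$$ $$v(t,z)=\sum_{j=1}^ne^{-i\mu_jt}V_j(z+\alpha_jt)e^{\frac12(\overline z\alpha_j-z\overline{\alpha_j})t}+r_2(t,z),$$ where the error terms satisfy: for all $c<\frac14$ and all $m\in\mathbb{N}$ there exists $C_{m,\kappa}>0$ such that for all $t\ge0$ $$\big\|e^{\kappa|z|}(\partial_t^mr_1)(t)\big\|_{L^2(\mathbb{C})}+\big\|e^{\kappa|z|}(\partial_t^mr_2)(t)\big\|_{L^2(\mathbb{C})}\le C_{m,\kappa}\,e^{-c\,\alpha_\sharp^2t^2}.$$
   Context: $\mathcal{E}=\{u(z)=e^{-|z|^2/2}f(z):\ f\text{ entire holomorphic}\}\cap L^2(\mathbb{C})$ is the Bargmann-Fock space, and $\Pi$ is the orthogonal projection onto $\mathcal{E}$, given by $[\Pi u](z)=\frac1\pi e^{-|z|^2/2}\int_{\mathbb{C}}e^{\overline wz-|w|^2/2}u(w)\,dL(w)$, with $L$ Lebesgue measure on $\mathbb{C}$. For $\kappa\ge0$, $\mathcal{X}^\kappa_{\mathcal E}=\{u\in\mathscr{S}'(\mathbb{C}):\ e^{\kappa|z|}u\in L^2(\mathbb{C})\}\cap\mathcal{E}$, with norm $\|e^{\kappa|z|}u\|_{L^2(\mathbb{C})}$. For $\gamma\in\mathbb{C}$ and $n\in\mathbb{N}$, $\varphi_n^\gamma(z)=\frac{1}{\sqrt{\pi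 n!}}(z-\overline\gamma)^ne^{-\frac{|z|^2}{2}-\frac{|\gamma|^2}{2}+\gamma z}$. When $n=1$ the minimum defining $\alpha_\sharp$ is over the empty set and is read as $+\infty$ (for $t>0$ the exponential is then $0$). *)

(* Defs.v *)
From HB Require Import structures.
From mathcomp Require Import all_boot all_order all_algebra.
From mathcomp Require Import complex.
From mathcomp Require Import all_classical all_reals all_analysis.

Set Implicit Arguments.
Unset Strict Implicit.
Unset Printing Implicit Defensive.

Import Order.TTheory GRing.Theory Num.Theory.
Import numFieldNormedType.Exports.

Local Open Scope classical_set_scope.
Local Open Scope ring_scope.
Local Open Scope complex_scope.

(* The [R]-valued projections of [R[i]]; the ones of [ssrnum] take values
   in [R[i]]. *)
Notation Re := complex.Re.
Notation Im := complex.Im.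

(* [`|z|] is an element of [R[i]]; this is the same modulus in [R]. *)
Definition cmod (R : realType) (z : R[i]) : R := Re `|z|.

(* ['i] would be parsed as the imaginary unit attached to the abstract
   [numClosedFieldType] structure of [R[i]]. *)
Definition iC (R : realType) : R[i] := 0 +i* 1.

Definition cexp (R : realType) (z : R[i]) : R[i] :=
  (expR (Re z) * cos (Im z)) +i* (expR (Re z) * sin (Im z)).

(* Functions on the plane are integrated in the coordinates [z = x + i y]
   against the product [dx dy]. *)
Definition toC (R : realType) (p : R * R) : R[i] := p.1 +i* p.2.

Definition lebC (R : realType) :
    {measure set (measurableTypeR R * measurableTypeR R) -> \bar R} :=
  (@lebesgue_measure R \x @lebesgue_measure R)%E.

Definition cintegral (R : realType) (F : R[i] -> R[i]) : R[i] :=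
  (\int[lebC R]_p Re (F (toC p))) +i* (\int[lebC R]_p Im (F (toC p))).

Definition L2norm (R : realType) (u : R[i] -> R[i]) : \bar R :=
  Lnorm (lebC R) 2%:E (fun p => (cmod (u (toC p)))%:E).

Definition isL2 (R : realType) (u : R[i] -> R[i]) : Prop :=
  [/\ measurable_fun setT (fun p : measurableTypeR R * measurableTypeR R =>
        Re (u (toC p))),
      measurable_fun setT (fun p : measurableTypeR R * measurableTypeR R =>
        Im (u (toC p)))
    & (L2norm u < +oo)%E].

(* With [R[i]] as a normed space over itself, [derivable f z 1] is complex
   differentiability at [z]. *)
Definition entire (R : realType) (f : R[i] -> R[i]) : Prop :=
  forall z : R[i], derivable (f : R[i]^o -> R[i]^o) z 1.

(* An element of the space is represented by its continuous representative. *)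
Definition bargmann_fock (R : realType) (u : R[i] -> R[i]) : Prop :=
  (exists2 f : R[i] -> R[i], entire f &
     forall z, u z = (expR (- (cmod z ^+ 2 / 2)))%:C * f z)
  /\ isL2 u.

Definition Pi_proj (R : realType) (u : R[i] -> R[i]) (z : R[i]) : R[i] :=
  (pi^-1 * expR (- (cmod z ^+ 2 / 2)))%:C *
  cintegral (fun w => cexp (conjc w * z - (cmod w ^+ 2 / 2)%:C) * u w).

Definition expweight (R : realType) (kappa : R) (u : R[i] -> R[i]) :
    R[i] -> R[i] :=
  fun z => (expR (kappa * cmod z))%:C * u z.

(* Elements of [bargmann_fock] are square integrable, hence tempered
   distributions. *)
Definition inX (R : realType) (kappa : R) (u : R[i] -> R[i]) : Prop :=
  bargmann_fock u /\ isL2 (expweight kappa u).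

Definition Xnorm (R : realType) (kappa : R) (u : R[i] -> R[i]) : \bar R :=
  L2norm (expweight kappa u).

(* The [m]-th partial derivative in [t] of [w(t, z)], taken separately on the
   real and imaginary parts. *)
Definition dtn (R : realType) (m : nat) (w : R -> R[i] -> R[i])
    (t : R) (z : R[i]) : R[i] :=
  derive1n m (fun s : R => Re (w s z)) t +i*
  derive1n m (fun s : R => Im (w s z)) t.

(* [w] is of class C^oo from [R] to the normed space [X^kappa]: for all [m] the
   curve [dtn m w] is [X^kappa]-valued and its difference quotients converge
   in the norm of [X^kappa] to [dtn m.+1 w]. *)
Definition smooth_in_X (R : realType) (kappa : R) (w : R -> R[i] -> R[i]) :
    Prop :=
  forall (m : nat) (t : R),
    inX kappa (dtn m w t) /\
    (fun h : R => Xnorm kappa (fun z =>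
       (h^-1)%:C * (dtn m w (t + h) z - dtn m w t z) - dtn m.+1 w t z))
      @ (0 : R)^' --> 0%E.

Definition coupled_LLL (R : realType) (u v : R -> R[i] -> R[i]) : Prop :=
  forall (t : R) (z : R[i]),
    iC R * dtn 1 u t z = Pi_proj (fun w => (cmod (v t w) ^+ 2)%:C * u t w) z /\
    iC R * dtn 1 v t z = - Pi_proj (fun w => (cmod (u t w) ^+ 2)%:C * v t w) z.

Definition phi (R : realType) (n : nat) (gamma z : R[i]) : R[i] :=
  ((Num.sqrt (pi * n`!%:R))^-1)%:C * (z - conjc gamma) ^+ n *
  cexp (gamma * z - (cmod z ^+ 2 / 2)%:C - (cmod gamma ^+ 2 / 2)%:C).

(* [U_j] and [V_j] are [profile] with sign [s = 1] and [s = -1]. *)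
Definition profile (R : realType) (s K a theta : R) (gamma z : R[i]) : R[i] :=
  K%:C * cexp (iC R * a%:C) *
  ((2^-1)%:C * phi 0 gamma z +
   (s * (Num.sqrt 3 / 2))%:C * iC R * cexp (iC R * theta%:C) * phi 1 gamma z).

Definition travelling_wave (R : realType) (lambda : R) (alpha : R[i])
    (U : R[i] -> R[i]) (t : R) (z : R[i]) : R[i] :=
  cexp (- (iC R * (lambda * t)%:C)) * U (z + alpha * t%:C) *
  cexp ((2^-1)%:C * (conjc z * alpha - z * conjc alpha) * t%:C).

(* [+oo] when there is no pair of distinct indices. *)
Definition alpha_sharp (R : realType) (n : nat) (alpha : 'I_n -> R[i]) :
    \bar R :=
  \big[mine/+oo%E]_(p : 'I_n * 'I_n | p.1 != p.2)
    (cmod (alpha p.1 - alpha p.2))%:E.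

(* Main.v *)
Require Import Defs.
From HB Require Import structures.
From mathcomp Require Import all_boot all_order all_algebra.
From mathcomp Require Import complex ring lra.
From mathcomp Require Import all_classical all_reals all_analysis.
From mathcomp Require Import measurable_realfun.

Set Implicit Arguments.
Unset Strict Implicit.
Unset Printing Implicit Defensive.
Import Order.TTheory GRing.Theory Num.Theory.
Import numFieldNormedType.Exports.
Local Open Scope classical_set_scope.
Local Open Scope ring_scope.
Local Open Scope complex_scope.

(* The remainder [r] is sought as the solution of the Duhamel equation integrated
   backward from [t = +oo].  Each wave solves the system by itself, so the source
   of this equation only contains products of waves of two different speeds; the
   product of two such Gaussians is [O(exp (- |alpha_j - alpha_l|^2 t^2 / 4))].  The
   cubic nonlinearity is first truncated to make it globally Lipschitz, and a
   Picard iteration in a space weighted by a fast decaying function of time yields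
   a global solution with this decay.  Mass conservation, and the pointwise bound
   by the mass in the Fock space, then show that a high enough truncation is never
   active.  Smoothness and the decay of the time derivatives follow by
   differentiating the equation. *)

(** * Complex arithmetic *)

(** All estimates are pointwise, of the form [|F z| <= C exp (- k |z|)] with [k > kappa]: the
    projection preserves them, its kernel being a Gaussian in [w - z], and the gap [k - kappa]
    yields the weighted norm at the end. The weight is centred at the origin while the waves move
    away from it, which costs factors [exp (B |t|)]; Gaussian decay in time absorbs them, at the
    price of a rate [c < 1/4] instead of [1/4]. The same decay leaves room for a time weight falling
    at any prescribed exponential rate [L]. Integrating backward gains [1 / L], so the Picard map
    contracts on the whole line at once, without small data and without gluing local solutions. The
    truncation rescales each argument by a positive factor, so the nonlinearity remains a real
    multiple of the unknown and the mass of each component is still conserved. A single wave is an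
    exact solution because its equation reduces to one identity between quadratic polynomials in
    [z + alpha t - conj gamma]; this identity dictates the numerical constants in [lambda], [mu] and
    [alpha]. *)

Section ComplexNumbers.
Context (R : realType).
Implicit Types (x y : R) (z w : R[i]).

Lemma complex_ext z w : complex.Re z = complex.Re w -> complex.Im z = complex.Im w -> z = w.
Proof. by case: z w => [a b] [c d] /= -> ->. Qed.

Lemma cReD z w : complex.Re (z + w) = complex.Re z + complex.Re w.
Proof. by case: z; case: w. Qed.
Lemma cImD z w : complex.Im (z + w) = complex.Im z + complex.Im w.
Proof. by case: z; case: w. Qed.
Lemma cReN z : complex.Re (- z) = - complex.Re z. Proof. by case: z. Qed.
Lemma cImN z : complex.Im (- z) = - complex.Im z. Proof. by case: z. Qed.
Lemma cReM z w : complex.Re (z * w) =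
  complex.Re z * complex.Re w - complex.Im z * complex.Im w.
Proof. by case: z; case: w. Qed.
Lemma cImM z w : complex.Im (z * w) =
  complex.Re z * complex.Im w + complex.Im z * complex.Re w.
Proof. by case: z; case: w. Qed.
Lemma cReJ z : complex.Re (conjc z) = complex.Re z. Proof. by case: z. Qed.
Lemma cImJ z : complex.Im (conjc z) = - complex.Im z. Proof. by case: z. Qed.
Lemma Re_real x : complex.Re x%:C = x. Proof. by []. Qed.
Lemma Im_real x : complex.Im x%:C = 0. Proof. by []. Qed.
Lemma cRe0 : complex.Re (0 : R[i]) = 0. Proof. by []. Qed.
Lemma cIm0 : complex.Im (0 : R[i]) = 0. Proof. by []. Qed.
Lemma cRe1 : complex.Re (1 : R[i]) = 1. Proof. by []. Qed.
Lemma cIm1 : complex.Im (1 : R[i]) = 0. Proof. by []. Qed.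
Lemma ReIC : complex.Re (iC R) = 0. Proof. by []. Qed.
Lemma ImIC : complex.Im (iC R) = 1. Proof. by []. Qed.
Lemma Re_expR (x y : R) : complex.Re (x +i* y) = x. Proof. by []. Qed.
Lemma Im_expR (x y : R) : complex.Im (x +i* y) = y. Proof. by []. Qed.

Definition ReImE := (Re_expR, Im_expR, cReD, cImD, cReN, cImN, cReM, cImM, cReJ, cImJ, Re_real, Im_real,
  cRe0, cIm0, cRe1, cIm1, ReIC, ImIC).

Lemma iC_sqr : iC R * iC R = -1.
Proof. by apply: complex_ext; rewrite !ReImE; lra. Qed.

Lemma cmodE z : cmod z = Num.sqrt (complex.Re z ^+ 2 + complex.Im z ^+ 2).
Proof. by rewrite /cmod normc_def. Qed.

Lemma cmod_sqr z : cmod z ^+ 2 = complex.Re z ^+ 2 + complex.Im z ^+ 2.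
Proof. by rewrite cmodE sqr_sqrtr// addr_ge0// sqr_ge0. Qed.

Lemma norm_cmod z : `|z| = (cmod z)%:C.
Proof. by rewrite cmodE normc_def. Qed.

Lemma cmod_sqrC z : (cmod z ^+ 2)%:C = z * conjc z.
Proof.
by apply: complex_ext; rewrite cmod_sqr !ReImE; ring.
Qed.

Lemma cmod_ge0 z : 0 <= cmod z.
Proof. by rewrite cmodE sqrtr_ge0. Qed.

Lemma cmodM z w : cmod (z * w) = cmod z * cmod w.
Proof. by apply: (@complexI R); rewrite -norm_cmod normrM !norm_cmod rmorphM. Qed.

Lemma cmodD z w : cmod (z + w) <= cmod z + cmod w.
Proof. by rewrite -lecR rmorphD /= -!norm_cmod ler_normD. Qed.

Lemma cmodN z : cmod (- z) = cmod z.
Proof. by apply: (@complexI R); rewrite -!norm_cmod normrN. Qed.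

Lemma cmodB z w : cmod (z - w) <= cmod z + cmod w.
Proof. by rewrite -(cmodN w) cmodD. Qed.

Lemma cmodBC z w : cmod (z - w) = cmod (w - z).
Proof. by rewrite -cmodN opprB. Qed.

Lemma cmod_real x : cmod x%:C = `|x|.
Proof. by rewrite cmodE /= expr0n addr0 sqrtr_sqr. Qed.

Lemma cmod0 : cmod (0 : R[i]) = 0.
Proof. by rewrite (cmod_real 0) normr0. Qed.

Lemma cmod1 : cmod (1 : R[i]) = 1.
Proof. by rewrite (cmod_real 1) normr1. Qed.

Lemma cmod_conj z : cmod (conjc z) = cmod z.
Proof. by rewrite !cmodE !ReImE sqrrN. Qed.

Lemma cmod_iC : cmod (iC R) = 1.
Proof. by rewrite cmodE /= expr0n add0r expr1n sqrtr1. Qed.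

Lemma cmodX z n : cmod (z ^+ n) = cmod z ^+ n.
Proof. by elim: n => [|n IH]; rewrite ?expr0 ?cmod1// !exprS cmodM IH. Qed.

Lemma cmod_eq0 z : cmod z = 0 -> z = 0.
Proof. by move=> h; apply/eqP; rewrite -normr_eq0 norm_cmod h. Qed.

Lemma le_Re_cmod z : `|complex.Re z| <= cmod z.
Proof.
rewrite cmodE -sqrtr_sqr ler_wsqrtr// lerDl; exact: sqr_ge0.
Qed.

Lemma le_Im_cmod z : `|complex.Im z| <= cmod z.
Proof.
rewrite cmodE -sqrtr_sqr ler_wsqrtr// lerDr; exact: sqr_ge0.
Qed.

Lemma cmod_le z : cmod z <= `|complex.Re z| + `|complex.Im z|.
Proof.
rewrite cmodE -[leRHS]ger0_norm ?addr_ge0//.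
rewrite -sqrtr_sqr ler_wsqrtr// sqrrD !real_normK ?num_real// lerD2r.
by rewrite lerDl mulrn_wge0// mulr_ge0.
Qed.

Lemma cmod_sum (I : Type) (s : seq I) (P : pred I) (F : I -> R[i]) :
  cmod (\sum_(i <- s | P i) F i) <= \sum_(i <- s | P i) cmod (F i).
Proof.
elim/big_ind2 : _ => [|x1 y1 x2 y2 h1 h2|//]; first by rewrite cmod0.
exact: le_trans (cmodD _ _) (lerD h1 h2).
Qed.

Lemma cexpD z w : cexp (z + w) = cexp z * cexp w.
Proof.
by apply: complex_ext; rewrite /cexp !ReImE expRD ?cosD ?sinD; ring.
Qed.

Lemma cexp0 : cexp (0 : R[i]) = 1.
Proof. by apply: complex_ext; rewrite /cexp !ReImE expR0 ?cos0 ?sin0; ring. Qed.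

Lemma cexp_neq0 z : cexp z != 0.
Proof.
apply/eqP => h; have := cexpD z (- z); rewrite h mul0r subrr cexp0 => /eqP.
by rewrite oner_eq0.
Qed.

Lemma cexpN z : cexp (- z) = (cexp z)^-1.
Proof.
apply: (mulfI (cexp_neq0 z)); rewrite -cexpD subrr cexp0 mulfV//.
exact: cexp_neq0.
Qed.

Lemma cexp_real x : cexp x%:C = (expR x)%:C.
Proof. by apply: complex_ext; rewrite /cexp !ReImE ?cos0 ?sin0; ring. Qed.

Lemma cexp_conj z : cexp (conjc z) = conjc (cexp z).
Proof. by apply: complex_ext; rewrite /cexp !ReImE ?cosN ?sinN; ring. Qed.

Lemma cmod_cexp z : cmod (cexp z) = expR (complex.Re z).
Proof.
rewrite cmodE /cexp !ReImE !exprMn -mulrDr cos2Dsin2 mulr1 sqrtr_sqr.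
by rewrite ger0_norm// expR_ge0.
Qed.

Lemma toC_ReIm z : toC (complex.Re z, complex.Im z) = z.
Proof. by apply: complex_ext. Qed.

End ComplexNumbers.

(** * Parametric and complex-valued integrals *)

Section ProductSigmaFinite.
Local Open Scope ereal_scope.
Context d1 d2 (T1 : measurableType d1) (T2 : measurableType d2) (R : realType).
Variable m1 : {sigma_finite_measure set T1 -> \bar R}.
Variable m2 : {sigma_finite_measure set T2 -> \bar R}.

(** Rectangles of two exhausting sequences exhaust the product. Fubini over two copies of the plane
    uses the planar measure with this structure, packaged in [product_sfm]. *)
Lemma product_sigma_finite : sigma_finite setT (m1 \x m2).
Proof.
have /sigma_finiteP[F [TF ndF oF]] := @sigma_finiteT _ _ _ m1.
have /sigma_finiteP[G [TG ndG oG]] := @sigma_finiteT _ _ _ m2.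
exists (fun n => F n `*` G n).
  rewrite -setXTT TF TG; apply/seteqP; split => [[x y]/= [[n _ Fn] [k _ Gk]]|].
    exists (maxn n k) => //; split => /=.
      by move: x Fn; apply/subsetPset/ndF; rewrite leq_maxl.
    by move: y Gk; apply/subsetPset/ndG; rewrite leq_maxr.
  by move=> [x y] [n _ [/= Fn Gn]]; split; exists n.
move=> n; have [mF Foo] := oF n; have [mG Goo] := oG n.
split; first exact: measurableX.
by rewrite product_measure1E// lte_mul_pinfty// ge0_fin_numE.
Qed.

Definition product_sf : set (T1 * T2) -> \bar R := m1 \x m2.

HB.instance Definition _ := Measure.on product_sf.

HB.instance Definition _ :=
  @Measure_isSigmaFinite.Build _ _ _ product_sf product_sigma_finite.

Definition product_sfm : {sigma_finite_measure set (T1 * T2)%type -> \bar R} := product_sf.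

End ProductSigmaFinite.

Section RealParametricIntegrals.
Context d1 d2 (T1 : measurableType d1) (T2 : measurableType d2) (R : realType).
Variable m1 : {sigma_finite_measure set T1 -> \bar R}.
Variable m2 : {sigma_finite_measure set T2 -> \bar R}.

(** Tonelli for the positive and negative parts; points where these diverge are harmless because
    [fine] is measurable. *)
Lemma measurable_Rintegral (f : T1 * T2 -> R) : measurable_fun setT f ->
  measurable_fun setT (fun x => \int[m2]_y f (x, y)).
Proof.
move=> mf; rewrite /Rintegral; apply: (@measurableT_comp _ _ _ _ _ _ (@fine R));
  first exact: fine_measurable.
have mf' : measurable_fun setT (EFin \o f) by exact/measurable_EFinP.
rewrite (_ : (fun x => _) = (fun x => (\int[m2]_y ((EFin \o f)^\+ (x, y)))
    - (\int[m2]_y ((EFin \o f)^\- (x, y))))%E).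
  apply: emeasurable_funB.
    by apply: measurable_fun_fubini_tonelli_F => //; exact: measurable_funepos.
  by apply: measurable_fun_fubini_tonelli_F => //; exact: measurable_funeneg.
by apply/funext => x; rewrite [LHS]integralE; congr (_ - _)%E; apply: eq_integral => y _; rewrite !(funeposE, funenegE).
Qed.

Variables (f : T1 * T2 -> R) (g1 : T1 -> R) (g2 : T2 -> R).
Hypothesis mf : measurable_fun setT f.
Hypothesis ig1 : m1.-integrable setT (EFin \o g1).
Hypothesis ig2 : m2.-integrable setT (EFin \o g2).
Hypothesis fg : forall x y, `|f (x, y)| <= g1 x * g2 y.

Lemma product_integrable : (m1 \x m2)%E.-integrable setT (EFin \o f).
Proof.
apply/integrable12ltyP; first exact/measurable_EFinP.
have [mg1 og1] := integrableP _ _ _ ig1.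
have [mg2 og2] := integrableP _ _ _ ig2.
apply: (@le_lt_trans _ _
  (\int[m1]_x (`|(EFin \o g1) x| * \int[m2]_y `|(EFin \o g2) y|))%E).
  apply: ge0_le_integral => //.
  - by move=> x _; apply: integral_ge0.
  - apply: (measurable_fun_fubini_tonelli_F (abse \o (EFin \o f))); last by move=> x; rewrite /= lee_fin.
    by apply: measurableT_comp => //; exact/measurable_EFinP.
  - by apply: emeasurable_funM => //; apply: measurableT_comp.
  move=> x _; rewrite -ge0_integralZl//.
  - apply: ge0_le_integral => //.
    + apply: measurableT_comp => //; apply/measurable_EFinP.
      exact: measurableT_comp mf (measurable_pair1 _).
    + by apply: measurable_funeM; exact: measurableT_comp.
    + move=> y _; rewrite /= -EFinM lee_fin -normrM.
      exact: le_trans (fg x y) (ler_norm _).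
  - exact: measurableT_comp.
rewrite ge0_integralZr//.
- by rewrite lte_mul_pinfty// ?integral_ge0// ge0_fin_numE// integral_ge0.
- exact: measurableT_comp.
- exact: integral_ge0.
Qed.

(** The separated majorant makes every section integrable, so the extended-real identity passes
    through [fine]. *)
Lemma Rintegral_Fubini :
  \int[m1]_x \int[m2]_y f (x, y) = \int[m2]_y \int[m1]_x f (x, y).
Proof.
have i2 x : m2.-integrable setT (EFin \o (fun y => f (x, y))).
  apply: (@le_integrable _ _ _ _ _ _ _ (EFin \o (fun y => g1 x * g2 y))) => //.
  - apply/measurable_EFinP; exact: measurableT_comp mf (measurable_pair1 _).
  - by move=> y _; rewrite /= lee_fin (le_trans (fg x y))// ler_norm.
  - by rewrite (_ : _ \o _ = (fun y => (g1 x)%:E * (g2 y)%:E)%E)//; apply: integrableZl.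
have i1 y : m1.-integrable setT (EFin \o (fun x => f (x, y))).
  apply: (@le_integrable _ _ _ _ _ _ _ (EFin \o (fun x => g2 y * g1 x))) => //.
  - apply/measurable_EFinP; exact: measurableT_comp mf (measurable_pair2 _).
  - by move=> x _; rewrite /= lee_fin mulrC (le_trans (fg x y))// ler_norm.
  - by rewrite (_ : _ \o _ = (fun x => (g2 y)%:E * (g1 x)%:E)%E)//; apply: integrableZl.
have := Fubini product_integrable; rewrite /= => FE.
rewrite /Rintegral; congr fine.
transitivity (\int[m1]_x \int[m2]_y (f (x, y))%:E)%E.
  by apply: eq_integral => x _; rewrite fineK//; exact: integrable_fin_num (i2 x).
by rewrite FE; apply: eq_integral => y _; rewrite fineK//; exact: integrable_fin_num (i1 y).
Qed.

End RealParametricIntegrals.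

Section ComplexMeasurable.
Context d (T : measurableType d) (R : realType).
Implicit Types (f g : T -> R[i]).

Definition cmeas f := measurable_fun setT (fun x => complex.Re (f x)) /\
  measurable_fun setT (fun x => complex.Im (f x)).

Lemma cmeas_cst (c : R[i]) : cmeas (fun=> c).
Proof. by split; apply: measurable_cst. Qed.

Lemma cmeasD f g : cmeas f -> cmeas g -> cmeas (fun x => f x + g x).
Proof.
move=> [rf mf] [rg mg]; split.
  by under eq_fun do rewrite cReD; exact: measurable_funD.
by under eq_fun do rewrite cImD; exact: measurable_funD.
Qed.

Lemma cmeasN f : cmeas f -> cmeas (fun x => - f x).
Proof.
move=> [rf mf]; split.
  by under eq_fun do rewrite cReN; exact: measurableT_comp.
by under eq_fun do rewrite cImN; exact: measurableT_comp.
Qed.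

Lemma cmeasB f g : cmeas f -> cmeas g -> cmeas (fun x => f x - g x).
Proof. by move=> mf mg; apply: cmeasD => //; exact: cmeasN. Qed.

Lemma cmeasM f g : cmeas f -> cmeas g -> cmeas (fun x => f x * g x).
Proof.
move=> [rf mf] [rg mg]; split.
  by under eq_fun do rewrite cReM; apply: measurable_funB; apply: measurable_funM.
by under eq_fun do rewrite cImM; apply: measurable_funD; apply: measurable_funM.
Qed.

Lemma cmeasJ f : cmeas f -> cmeas (fun x => conjc (f x)).
Proof.
move=> [rf mf]; split; first by under eq_fun do rewrite cReJ.
by under eq_fun do rewrite cImJ; exact: measurableT_comp.
Qed.

Lemma cmeas_real (f : T -> R) : measurable_fun setT f -> cmeas (fun x => (f x)%:C).
Proof. by move=> mf; split => //; exact: measurable_cst. Qed.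

Lemma cmeas_sum (I : Type) (s : seq I) (f : I -> T -> R[i]) :
  (forall i, cmeas (f i)) -> cmeas (fun x => \sum_(i <- s) f i x).
Proof.
move=> mf; elim: s => [|a s IH].
  by under eq_fun do rewrite big_nil; exact: cmeas_cst.
by under eq_fun do rewrite big_cons; exact: cmeasD.
Qed.

Lemma measurable_cmod f : cmeas f -> measurable_fun setT (fun x => cmod (f x)).
Proof.
move=> [rf mf]; under eq_fun do rewrite cmodE.
apply: (measurableT_comp (continuous_measurable_fun (@sqrt_continuous R))).
by apply: measurable_funD; apply: measurable_funX.
Qed.

Lemma cmeas_cexp f : cmeas f -> cmeas (fun x => cexp (f x)).
Proof.
move=> [rf mf]; split; rewrite /cexp /=; apply: measurable_funM.
- by apply: measurableT_comp.
- by apply: measurableT_comp mf; apply: continuous_measurable_fun; exact: continuous_cos.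
- by apply: measurableT_comp.
- by apply: measurableT_comp mf; apply: continuous_measurable_fun; exact: continuous_sin.
Qed.

Lemma cmeas_lim (f_ : nat -> T -> R[i]) f : (forall n, cmeas (f_ n)) ->
  (forall x, (fun n => cmod (f_ n x - f x)) @ \oo --> 0) -> cmeas f.
Proof.
move=> mf fl; split.
  apply: (@measurable_fun_cvg _ _ _ _ (fun n x => complex.Re (f_ n x))) => [n|x _].
    by have [] := mf n.
  apply/cvgrPdist_le => e e0; have /cvgrPdist_le /(_ _ e0) := fl x.
  apply: filterS => n; rewrite sub0r normrN ger0_norm ?cmod_ge0//; apply: le_trans.
  by rewrite distrC; apply: le_trans (le_Re_cmod _); rewrite !ReImE.
apply: (@measurable_fun_cvg _ _ _ _ (fun n x => complex.Im (f_ n x))) => [n|x _].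
  by have [] := mf n.
apply/cvgrPdist_le => e e0; have /cvgrPdist_le /(_ _ e0) := fl x.
apply: filterS => n; rewrite sub0r normrN ger0_norm ?cmod_ge0//; apply: le_trans.
by rewrite distrC; apply: le_trans (le_Im_cmod _); rewrite !ReImE.
Qed.

End ComplexMeasurable.

Lemma cmeas_comp (R : realType) d (T : measurableType d) d' (T' : measurableType d')
  (h : T' -> T) (f : T -> R[i]) :
  measurable_fun setT h -> cmeas f -> cmeas (fun x => f (h x)).
Proof. by move=> mh [rf mf]; split; [exact: measurableT_comp rf mh|exact: measurableT_comp mf mh]. Qed.

Section ComplexIntegral.
Context d (T : measurableType d) (R : realType) (mu : {measure set T -> \bar R}).
Implicit Types (f g : T -> R[i]) (h k : T -> R).

Definition cint f : R[i] := (\int[mu]_x complex.Re (f x)) +i* (\int[mu]_x complex.Im (f x)).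

Definition rint h := mu.-integrable setT (EFin \o h).

Definition cinteg f := rint (fun x => complex.Re (f x)) /\ rint (fun x => complex.Im (f x)).

Lemma rint_measurable h : rint h -> measurable_fun setT h.
Proof. by move=> /integrableP[/measurable_EFinP]. Qed.

Lemma rint_le h k : measurable_fun setT h -> (forall x, `|h x| <= k x) -> rint k -> rint h.
Proof.
move=> mh hk; apply: le_integrable => //; first exact/measurable_EFinP.
by move=> x _; rewrite /= lee_fin (le_trans (hk x))// ler_norm.
Qed.

Lemma rintD h k : rint h -> rint k -> rint (fun x => h x + k x).
Proof. by move=> ih ik; have := integrableD measurableT ih ik. Qed.

Lemma rintZ (c : R) h : rint h -> rint (fun x => c * h x).
Proof. by move=> ih; have := integrableZl measurableT c ih. Qed.

Lemma cinteg_meas f : cinteg f -> cmeas f.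
Proof. by move=> [/rint_measurable ? /rint_measurable]. Qed.

Lemma cinteg_le f h : cmeas f -> (forall x, cmod (f x) <= h x) -> rint h -> cinteg f.
Proof.
move=> [rf mf] fh ih; split; apply: rint_le ih => // x; apply: le_trans (fh x).
  exact: le_Re_cmod.
exact: le_Im_cmod.
Qed.

Lemma cintegD f g : cinteg f -> cinteg g -> cinteg (fun x => f x + g x).
Proof.
move=> [rf mf] [rg mg]; split.
  by under eq_fun do rewrite cReD; exact: rintD.
by under eq_fun do rewrite cImD; exact: rintD.
Qed.

Lemma cintegZ (c : R[i]) f : cinteg f -> cinteg (fun x => c * f x).
Proof.
move=> [rf mf]; split.
  under eq_fun do rewrite cReM -mulNr.
  by apply: rintD; apply: rintZ.
by under eq_fun do rewrite cImM; apply: rintD; apply: rintZ.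
Qed.

Lemma cintegB f g : cinteg f -> cinteg g -> cinteg (fun x => f x - g x).
Proof.
move=> fi gi; have := cintegD fi (cintegZ (-1) gi).
by under eq_fun do rewrite mulN1r.
Qed.

Lemma eq_cint f g : (forall x, f x = g x) -> cint f = cint g.
Proof. by move=> fg; congr cint; apply/funext. Qed.

Lemma cintD f g : cinteg f -> cinteg g ->
  cint (fun x => f x + g x) = cint f + cint g.
Proof.
move=> [rf mf] [rg mg]; apply: complex_ext; rewrite /cint !ReImE.
  by under eq_Rintegral do rewrite cReD; rewrite RintegralD.
by under eq_Rintegral do rewrite cImD; rewrite RintegralD.
Qed.

Lemma cintZ (c : R[i]) f : cinteg f -> cint (fun x => c * f x) = c * cint f.
Proof.
move=> [rf mf]; apply: complex_ext; rewrite /cint !ReImE.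
  under eq_Rintegral do rewrite cReM.
  by rewrite RintegralB ?RintegralZl//; exact: rintZ.
under eq_Rintegral do rewrite cImM.
by rewrite RintegralD ?RintegralZl//; exact: rintZ.
Qed.

Lemma cintB f g : cinteg f -> cinteg g ->
  cint (fun x => f x - g x) = cint f - cint g.
Proof.
move=> fi gi; have := cintD fi (cintegZ (-1) gi).
by rewrite cintZ// mulN1r => <-; apply: eq_cint => x; rewrite mulN1r.
Qed.

Lemma cint0 : cint (fun=> 0) = 0.
Proof. by apply: complex_ext; rewrite /cint !ReImE /Rintegral integral0. Qed.

Lemma Rintegral_le h k : rint h -> rint k -> (forall x, h x <= k x) ->
  \int[mu]_x h x <= \int[mu]_x k x.
Proof. by move=> ih ik hk; apply: le_Rintegral. Qed.

(** Real and imaginary parts are bounded separately; this is the origin of the factors [2] in later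
    constants. *)
Lemma cmod_cint f h : cmeas f -> (forall x, cmod (f x) <= h x) -> rint h ->
  cmod (cint f) <= 2 * \int[mu]_x h x.
Proof.
move=> mf fh ih; have [rf imf] := cinteg_le mf fh ih.
rewrite mulr_natl mulr2n; apply: le_trans (cmod_le _) _; rewrite /cint !ReImE.
apply: lerD; apply: le_trans (le_normr_Rintegral _ _) _ => //.
  apply: le_Rintegral => //; last first.
    by move=> x _; apply: le_trans (fh x); exact: le_Re_cmod.
  by have := integrable_norm rf.
apply: le_Rintegral => //; last first.
  by move=> x _; apply: le_trans (fh x); exact: le_Im_cmod.
by have := integrable_norm imf.
Qed.

End ComplexIntegral.

Section ComplexFubini.
Context d1 d2 (T1 : measurableType d1) (T2 : measurableType d2) (R : realType).
Variable m1 : {sigma_finite_measure set T1 -> \bar R}.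
Variable m2 : {sigma_finite_measure set T2 -> \bar R}.

Lemma cmeas_cint (f : T1 * T2 -> R[i]) : cmeas f ->
  cmeas (fun x => cint m2 (fun y => f (x, y))).
Proof. by move=> [rf mf]; split; [exact: (measurable_Rintegral m2 rf)|exact: (measurable_Rintegral m2 mf)]. Qed.

Lemma cint_Fubini (f : T1 * T2 -> R[i]) (g1 : T1 -> R) (g2 : T2 -> R) :
  cmeas f -> rint m1 g1 -> rint m2 g2 ->
  (forall x y, cmod (f (x, y)) <= g1 x * g2 y) ->
  cint m1 (fun x => cint m2 (fun y => f (x, y))) =
  cint m2 (fun y => cint m1 (fun x => f (x, y))).
Proof.
move=> [rf mf] ig1 ig2 fg; apply: complex_ext; rewrite /cint !ReImE.
  apply: (Rintegral_Fubini rf ig1 ig2) => x y.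
  exact: le_trans (le_Re_cmod _) (fg x y).
apply: (Rintegral_Fubini mf ig1 ig2) => x y.
exact: le_trans (le_Im_cmod _) (fg x y).
Qed.

End ComplexFubini.

(** * Differentiable complex curves *)

Section ComplexCurves.
Context (R : realType).
Implicit Types (f g : R -> R[i]) (t h : R).

(** Real and imaginary parts are differentiated separately, as in [dtn]. *)
Definition cder f g := forall t,
  is_derive t 1 (fun s => complex.Re (f s)) (complex.Re (g t)) /\
  is_derive t 1 (fun s => complex.Im (f s)) (complex.Im (g t)).

Lemma cder_cst (c : R[i]) : cder (fun=> c) (fun=> 0).
Proof. by move=> t; split; exact: is_derive_cst. Qed.

Lemma cder_id : cder (fun t => t%:C) (fun=> 1).
Proof. by move=> t; split; [exact: is_derive_id|exact: is_derive_cst]. Qed.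

Lemma cder_eq f g g' : cder f g -> (forall t, g t = g' t) -> cder f g'.
Proof. by move=> fg gg t; rewrite -gg. Qed.

Lemma cderD f f' g g' : cder f f' -> cder g g' ->
  cder (fun t => f t + g t) (fun t => f' t + g' t).
Proof.
move=> df dg t; have [rf mf] := df t; have [rg mg] := dg t; split.
  under eq_fun do rewrite cReD.
  by rewrite cReD; exact: is_deriveD.
under eq_fun do rewrite cImD.
by rewrite cImD; exact: is_deriveD.
Qed.

Let is_deriveM_real (a b : R -> R) (a' b' t : R) : is_derive t 1 a a' ->
  is_derive t 1 b b' -> is_derive t 1 (fun s => a s * b s) (a' * b t + a t * b').
Proof.
move=> ha hb; rewrite (_ : (fun s => _) = (a * b))//.
by apply: is_derive_eq; rewrite /GRing.scale /=; ring.
Qed.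

Lemma cderM f f' g g' : cder f f' -> cder g g' ->
  cder (fun t => f t * g t) (fun t => f' t * g t + f t * g' t).
Proof.
move=> df dg t; have [rf mf] := df t; have [rg mg] := dg t; split.
  under eq_fun do rewrite cReM.
  have h := is_deriveB (is_deriveM_real rf rg) (is_deriveM_real mf mg).
  by apply: (is_derive_eq h); rewrite !ReImE; ring.
under eq_fun do rewrite cImM.
have h := is_deriveD (is_deriveM_real rf mg) (is_deriveM_real mf rg).
by apply: (is_derive_eq h); rewrite !ReImE; ring.
Qed.

Lemma cderZ (c : R[i]) f f' : cder f f' -> cder (fun t => c * f t) (fun t => c * f' t).
Proof.
move=> df; apply: cder_eq; first exact: cderM (cder_cst c) df.
by move=> t /=; rewrite mul0r add0r.
Qed.

Lemma cder_cexp f f' : cder f f' ->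
  cder (fun t => cexp (f t)) (fun t => f' t * cexp (f t)).
Proof.
move=> df t; have [rf mf] := df t.
have he : is_derive t 1 (fun s => expR (complex.Re (f s)))
    (complex.Re (f' t) * expR (complex.Re (f t))).
  apply: (is_derive_eq (is_derive1_comp (is_derive_expR _) rf)).
  by rewrite mulrC.
have hc : is_derive t 1 (fun s => cos (complex.Im (f s)))
    (- complex.Im (f' t) * sin (complex.Im (f t))).
  apply: (is_derive_eq (is_derive1_comp (is_derive_cos _) mf)).
  by rewrite /=; ring.
have hs : is_derive t 1 (fun s => sin (complex.Im (f s)))
    (complex.Im (f' t) * cos (complex.Im (f t))).
  apply: (is_derive_eq (is_derive1_comp (is_derive_sin _) mf)).
  by rewrite /=; ring.
split; rewrite /cexp /=.
  by apply: (is_derive_eq (is_deriveM_real he hc)); rewrite !ReImE; ring.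
by apply: (is_derive_eq (is_deriveM_real he hs)); rewrite !ReImE; ring.
Qed.

(** Two applications of the mean value theorem, for either sign of [h]; the sharp factor [1/2] is
    given up. *)
Lemma taylor2_real (f f1 f2 : R -> R) (t h C : R) :
  (forall s : R, is_derive s 1 f (f1 s)) -> (forall s : R, is_derive s 1 f1 (f2 s)) ->
  (forall s : R, `|s - t| <= `|h| -> `|f2 s| <= C) ->
  `|f (t + h) - f t - h * f1 t| <= C * h ^+ 2.
Proof.
move=> df df1 bf2.
have mvt (g g' : R -> R) (k : R) : (forall s : R, is_derive s 1 g (g' s)) ->
    exists2 s, `|s - t| <= `|k| & g (t + k) - g t = g' s * k.
  move=> dg.
  have cg a b : {within `[a, b], continuous g}.
    apply: continuous_subspaceT => s.
    by apply: differentiable_continuous; apply/derivable1_diffP; exact: @ex_derive _ _ _ _ _ _ _ (dg s).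
  have [k0|k0|->] := ltgtP k 0.
  - have tk : t + k < t by rewrite gtrDl.
    have [s] := MVT tk (fun x _ => dg x) (cg _ _).
    rewrite in_itv /= => /andP[s1 s2] e; exists s; last by rewrite -opprB e; ring.
    by rewrite ltr0_norm ?subr_lt0// ltr0_norm// lerN2 lerBrDl ltW.
  - have tk : t < t + k by rewrite ltrDl.
    have [s] := MVT tk (fun x _ => dg x) (cg _ _).
    rewrite in_itv /= => /andP[s1 s2] e; exists s; last by rewrite e; ring.
    by rewrite gtr0_norm ?subr_gt0// gtr0_norm// lerBlDl ltW.
  - by exists t; rewrite ?subrr ?normr0// addr0 subrr mulr0.
have [s sh ->] := mvt _ _ h df.
have [r rs] := mvt _ _ (s - t) df1; rewrite (_ : t + (s - t) = s); last by ring.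
move=> e.
rewrite (_ : _ - _ = f2 r * (s - t) * h); last by rewrite -e; ring.
rewrite !normrM -[h ^+ 2]real_normK ?num_real// expr2 mulrA ler_wpM2r//.
by rewrite ler_pM// bf2// (le_trans rs).
Qed.

Lemma taylor2 f f1 f2 t h C : cder f f1 -> cder f1 f2 ->
  (forall s, `|s - t| <= `|h| -> cmod (f2 s) <= C) ->
  cmod (f (t + h) - f t - h%:C * f1 t) <= 2 * C * h ^+ 2.
Proof.
move=> df df1 bf2; apply: le_trans (cmod_le _) _.
rewrite -mulrA mulr_natl mulr2n.
have -> : complex.Re (f (t + h) - f t - h%:C * f1 t) =
  complex.Re (f (t + h)) - complex.Re (f t) - h * complex.Re (f1 t).
  by rewrite !ReImE; ring.
have -> : complex.Im (f (t + h) - f t - h%:C * f1 t) =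
  complex.Im (f (t + h)) - complex.Im (f t) - h * complex.Im (f1 t).
  by rewrite !ReImE; ring.
apply: lerD.
  apply: (@taylor2_real (fun s => complex.Re (f s)) (fun s => complex.Re (f1 s))
    (fun s => complex.Re (f2 s))) => s; [by have [] := df s|by have [] := df1 s|].
  by move=> sh; exact: le_trans (le_Re_cmod _) (bf2 s sh).
apply: (@taylor2_real (fun s => complex.Im (f s)) (fun s => complex.Im (f1 s))
  (fun s => complex.Im (f2 s))) => s; [by have [] := df s|by have [] := df1 s|].
by move=> sh; exact: le_trans (le_Im_cmod _) (bf2 s sh).
Qed.

(** Taylor expansion along the segment from [0] to [z], parametrised by a real time. *)
Lemma cexp_taylor2 (z : R[i]) :
  cmod (cexp z - 1 - z) <= 2 * (cmod z ^+ 2 * expR (cmod z)).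
Proof.
have d1 : cder (fun t => cexp (t%:C * z)) (fun t => z * cexp (t%:C * z)).
  apply: cder_eq; first exact/cder_cexp/(cderM cder_id (cder_cst z)).
  by move=> t /=; rewrite mulr0 addr0 mul1r.
have := @taylor2 _ _ _ 0 1 (cmod z ^+ 2 * expR (cmod z)) d1 (cderZ z d1).
rewrite add0r !mul1r mul0r cexp0 mulr1 expr1n mulr1; apply => s.
rewrite subr0 normr1 => s1; rewrite mulrA cmodM -expr2 cmodX ler_wpM2l ?exprn_ge0 ?cmod_ge0//.
rewrite cmod_cexp ler_expR (le_trans (ler_norm _))// (le_trans (le_Re_cmod _))//.
by rewrite cmodM cmod_real ler_piMl ?cmod_ge0.
Qed.

End ComplexCurves.

(** * Gaussian and exponential integrals *)

Section GaussianIntegrals.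
Context (R : realType).
Notation leb := (@lebesgue_measure R).
Implicit Types (a k L x y t : R).

Lemma continuous_expR_comp (f : R -> R) : continuous f -> continuous (fun x => expR (f x)).
Proof. by move=> cf x; apply: continuous_comp; [exact: cf|exact: continuous_expR]. Qed.

(** Up to the factor [sqrt (pi / a)] the integrand is the normal density of mean [m] and variance
    [1 / (2 a)]. *)
Lemma gauss1 a m : 0 < a ->
  rint leb (fun x => expR (- (a * (x - m) ^+ 2))) /\
  \int[leb]_x expR (- (a * (x - m) ^+ 2)) = Num.sqrt (pi / a).
Proof.
move=> a0; pose s := Num.sqrt ((2 * a)^-1).
have s0 : s != 0 by rewrite sqrtr_eq0 -ltNge invr_gt0 mulr_gt0.
have s2 : s ^+ 2 = (2 * a)^-1 by rewrite sqr_sqrtr// invr_ge0 mulr_ge0// ltW.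
have fE x : expR (- (a * (x - m) ^+ 2)) = Num.sqrt (pi / a) * normal_pdf m s x.
  rewrite normal_pdfE// /normal_peak /normal_fun s2.
  have -> : (2 * a)^-1 * pi *+ 2 = pi / a by rewrite -mulr_natl; field; lra.
  rewrite [RHS]mulrA divff ?mul1r; last first.
    by rewrite sqrtr_eq0 -ltNge divr_gt0// pi_gt0.
  by congr expR; rewrite -mulr_natl; field; lra.
have ip := @integrable_normal_pdf R m s.
split; first by under eq_fun do rewrite fE; exact: rintZ.
under eq_Rintegral do rewrite fE.
rewrite RintegralZl//.
by rewrite /Rintegral integral_normal_pdf mulr1.
Qed.

(** An indicator in function form: an integral over [[t, +oo[] becomes one over the line, with a
    factor jointly measurable in [(t, s)]. *)
Definition after t (s : R) : R := if t <= s then 1 else 0.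

Lemma measurable_after2 : measurable_fun setT (fun x : measurableTypeR R * measurableTypeR R => after x.1 x.2).
Proof.
apply: measurable_fun_ifT; [|exact: measurable_cst|exact: measurable_cst].
exact: measurable_fun_ler.
Qed.

Lemma after_ge0 t s : 0 <= after t s. Proof. by rewrite /after; case: ifP. Qed.

Lemma exp_tail L t : 0 < L ->
  rint leb (fun s => after t s * expR (- (L * (s - t)))) /\
  \int[leb]_s (after t s * expR (- (L * (s - t)))) = L^-1.
Proof.
move=> L0.
have e : (\int[leb]_(s in `[t, +oo[) (expR (- (L * (s - t))))%:E = (L^-1)%:E)%E.
  pose F := fun s : R => - (L^-1 * expR (- (L * (s - t)))).
  have dF (x : R) : is_derive x 1 F (expR (- (L * (x - t)))).
    have h : is_derive x 1 (fun s : R => - (L * (s - t))) (- L).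
      by apply: is_derive_eq; rewrite /GRing.scale/=; ring.
    have h2 := @is_derive1_comp _ (@expR R) _ x _ _ (is_derive_expR _) h.
    have h3 := is_deriveN (is_deriveZ L^-1 h2).
    apply: (is_derive_eq h3); rewrite /GRing.scale/=; field; lra.
  have dF' (x : R) : derivable F x 1 by exact: (@ex_derive _ _ _ _ _ _ _ (dF x)).
  rewrite (@ge0_continuous_FTC2y _ _ F _ 0).
  - by rewrite /F subrr mulr0 oppr0 expR0 mulr1 sub0e /= opprK.
  - by move=> x _; exact: expR_ge0.
  - apply: continuous_subspaceT; apply: continuous_expR_comp => x.
    apply: (@continuousN _ _ _ (fun x => L * (x - t))); apply: cvgM; first exact: cvg_cst.
    by apply: cvgB; [exact: cvg_id|exact: cvg_cst].
  - rewrite -[X in _ --> X]oppr0 -(mulr0 L^-1); apply: cvgN; apply: cvgM; first exact: cvg_cst.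
    have : (fun x : R => L * (x - t)) @ +oo --> +oo.
      apply/cvgryPge => A; near=> x.
      rewrite -ler_pdivrMl// lerBrDr; near: x; apply: nbhs_pinfty_ge; exact: num_real.
    by move=> h; apply: (cvg_comp _ _ h (@cvgr_expR R)).
  - by move=> x _; exact: dF'.
  - apply: cvg_at_right_filter; apply: differentiable_continuous.
    exact/derivable1_diffP/dF'.
  - by move=> x _; rewrite derive1E; exact: derive_val.
have fE : (fun s : R => ((after t s * expR (- (L * (s - t))))%:E)) =
   ((fun s => (expR (- (L * (s - t))))%:E) \_ `[t, +oo[).
  apply/funext => s; rewrite patchE /after; case: ifPn; rewrite mem_setE in_itv /= andbT.
    by move=> ->; rewrite mul1r.
  by move=> /negbTE ->; rewrite mul0r.
split; last by rewrite /Rintegral fE -integral_mkcond e.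
apply/integrableP; split.
  apply/measurable_EFinP; apply: measurable_funM.
    have -> : after t = \1_`[t, +oo[; last exact: measurable_indic.
    by apply/funext => s; rewrite indicE mem_setE in_itv /= andbT /after; case: ifP.
  apply: continuous_measurable_fun; apply: continuous_expR_comp => x.
  apply: (@continuousN _ _ _ (fun x => L * (x - t))); apply: cvgM; first exact: cvg_cst.
  by apply: cvgB; [exact: cvg_id|exact: cvg_cst].
under eq_integral => s _.
  rewrite gee0_abs; last by rewrite lee_fin mulr_ge0// ?expR_ge0// /after; case: ifP.
  over.
by rewrite /= fE -integral_mkcond e ltry.
Unshelve. all: by end_near. Qed.

End GaussianIntegrals.

Section PlaneIntegrals.
Context (R : realType).
Notation leb := (@lebesgue_measure R).
Notation leb2 := (lebC R).
Notation P := (measurableTypeR R * measurableTypeR R)%type.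
Implicit Types (a k L x y t : R).

Lemma rint_abs_exp k : 0 < k -> rint leb (fun x => expR (- (k * `|x|))).
Proof.
move=> k0.
have cf : continuous (fun x : R => expR (- (k * `|x|))).
  apply: continuous_expR_comp => x; apply: cvgN; apply: cvgM; first exact: cvg_cst.
  exact: norm_continuous.
apply/integrableP; split.
  by apply/measurable_EFinP; exact: continuous_measurable_fun.
under eq_integral do rewrite /= ger0_norm ?expR_ge0//.
rewrite ge0_symfun_integralT//; last by move=> x /=; rewrite normrN.
rewrite lte_mul_pinfty//.
have [it _] := exp_tail 0 k0; have [_] := integrableP _ _ _ it.
apply: le_lt_trans; rewrite [leLHS]integral_mkcond le_eqVlt; apply/orP; left; apply/eqP.
apply: eq_integral => x _; rewrite patchE /= subr0 /after.
have -> : (x \in [set x0 : R | 0 <= x0]) = (0 <= x) by apply/idP/idP; rewrite inE.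
case: ifPn => x0; last by rewrite mul0r normr0.
by rewrite mul1r [in RHS]ger0_norm ?expR_ge0// ger0_norm.
Qed.

Lemma measurable_toC : cmeas (fun p : P => toC p).
Proof. by split; [exact: measurable_fst|exact: measurable_snd]. Qed.

Lemma leb2_integrable (f : P -> R) g1 g2 : measurable_fun setT f ->
  rint leb g1 -> rint leb g2 -> (forall x y, `|f (x, y)| <= g1 x * g2 y) ->
  rint leb2 f.
Proof. by move=> mf i1 i2 fg; exact: (product_integrable mf i1 i2 fg). Qed.

Lemma Rintegral_leb2 (f : P -> R) g1 g2 : measurable_fun setT f ->
  rint leb g1 -> rint leb g2 -> (forall x y, `|f (x, y)| <= g1 x * g2 y) ->
  \int[leb2]_p f p = \int[leb]_x \int[leb]_y f (x, y).
Proof.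
move=> mf ig1 ig2 fg.
have ip := product_integrable mf ig1 ig2 fg.
rewrite /Rintegral; congr fine.
have i2 x : rint leb (fun y => f (x, y)).
  apply: (@rint_le _ _ _ leb (fun y => f (x, y)) (fun y => g1 x * g2 y) _ (fg x)); last exact: rintZ.
  exact: measurableT_comp mf (measurable_pair1 _).
rewrite -[LHS](integral12_prod_meas1 ip); apply: eq_integral => x _.
by rewrite fineK//; exact: integrable_fin_num (i2 x).
Qed.

Lemma cint_leb2_prod (f1 f2 : R -> R[i]) g1 g2 :
  cmeas (f1 : measurableTypeR R -> _) -> cmeas (f2 : measurableTypeR R -> _) ->
  rint leb g1 -> rint leb g2 ->
  (forall x, cmod (f1 x) <= g1 x) -> (forall x, cmod (f2 x) <= g2 x) ->
  cint leb2 (fun p => f1 p.1 * f2 p.2) = cint leb f1 * cint leb f2.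
Proof.
move=> mf1 mf2 ig1 ig2 fg1 fg2.
have if1 := cinteg_le mf1 fg1 ig1; have if2 := cinteg_le mf2 fg2 ig2.
have mf : cmeas (fun p : P => f1 p.1 * f2 p.2).
  apply: cmeasM; [exact: (cmeas_comp measurable_fst mf1)|exact: (cmeas_comp measurable_snd mf2)].
have fg x y : cmod (f1 x * f2 y) <= g1 x * g2 y.
  by rewrite cmodM ler_pM ?cmod_ge0.
transitivity (cint leb (fun x => cint leb (fun y => f1 x * f2 y))).
  have [rf imf] := mf.
  apply: complex_ext; rewrite /cint !ReImE.
    apply: (Rintegral_leb2 rf ig1 ig2) => x y.
    exact: le_trans (le_Re_cmod _) (fg x y).
  apply: (Rintegral_leb2 imf ig1 ig2) => x y.
  exact: le_trans (le_Im_cmod _) (fg x y).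
transitivity (cint leb (fun x => cint leb f2 * f1 x)).
  by apply: eq_cint => x; rewrite cintZ// mulrC.
by rewrite cintZ// mulrC.
Qed.

Lemma gauss2 a w : 0 < a ->
  rint leb2 (fun p => expR (- (a * cmod (toC p - w) ^+ 2))) /\
  \int[leb2]_p expR (- (a * cmod (toC p - w) ^+ 2)) = pi / a.
Proof.
move=> a0; have [i1 e1] := gauss1 (complex.Re w) a0; have [i2 e2] := gauss1 (complex.Im w) a0.
have m2 : measurable_fun setT (fun p : P => expR (- (a * cmod (toC p - w) ^+ 2))).
  apply: measurableT_comp => //; apply: measurableT_comp => //.
  apply: measurable_funM => //; apply: measurable_funX; apply: measurable_cmod.
  by apply: cmeasB; [exact: measurable_toC|exact: cmeas_cst].
have fE x y : expR (- (a * cmod (toC (x, y) - w) ^+ 2)) =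
    expR (- (a * (x - complex.Re w) ^+ 2)) * expR (- (a * (y - complex.Im w) ^+ 2)).
  by rewrite -expRD cmod_sqr !ReImE /=; congr expR; ring.
have fg x y : `|expR (- (a * cmod (toC (x, y) - w) ^+ 2))| <=
    expR (- (a * (x - complex.Re w) ^+ 2)) * expR (- (a * (y - complex.Im w) ^+ 2)).
  by rewrite fE ger0_norm// mulr_ge0 ?expR_ge0.
split; first exact: (leb2_integrable m2 i1 i2).
rewrite (Rintegral_leb2 m2 i1 i2 fg).
transitivity (\int[leb]_x (Num.sqrt (pi / a) * expR (- (a * (x - complex.Re w) ^+ 2)))).
  apply: eq_Rintegral => x _.
  under eq_Rintegral do rewrite fE.
  by rewrite RintegralZl// e2 mulrC.
by rewrite RintegralZl// e1 -expr2 sqr_sqrtr// divr_ge0// ?pi_ge0// ltW.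
Qed.

(** Half of [|x| + |y|] lies below [|x + i y|], which separates the variables. *)
Lemma rint_exp_cmod k : 0 < k -> rint leb2 (fun p => expR (- (k * cmod (toC p)))).
Proof.
move=> k0; have k2 : 0 < k / 2 by rewrite divr_gt0.
apply: (leb2_integrable _ (rint_abs_exp k2) (rint_abs_exp k2)).
  apply: measurableT_comp => //; apply: measurableT_comp => //.
  by apply: measurable_funM => //; apply: measurable_cmod; exact: measurable_toC.
move=> x y; rewrite ger0_norm ?expR_ge0// -expRD ler_expR.
have := le_Re_cmod (toC (x, y)); have := le_Im_cmod (toC (x, y)) => /= h1 h2.
have := ler_pM2l k0; nra.
Qed.

End PlaneIntegrals.

(** * Fourier-Laplace transform of the Gaussian *)

Section CurveDerivatives.
Context (R : realType).

(** A quadratic remainder is easier to carry through integrals than a limit; dividing by [h] puts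
    the difference quotient within [C |h|] of [g]. *)
Lemma quad_is_derive (f : R -> R) (t g C : R) :
  (forall h, `|h| <= 1 -> `|f (t + h) - f t - h * g| <= C * h ^+ 2) ->
  is_derive t 1 f g.
Proof.
move=> H.
have C0 : 0 <= C.
  have := H 1; rewrite normr1 lexx expr1n mulr1 => /(_ isT).
  exact: le_trans (normr_ge0 _).
have lim : (fun h : R => h^-1 *: (f (h *: 1 + t) - f t)) @ 0^' --> g.
  apply/cvgrPdist_le => e e0; near=> h.
  have h0 : h != 0 by near: h; exact: nbhs_dnbhs_neq.
  have h1 : `|h| <= Num.min 1 (e / (C + 1)).
    near: h; apply: dnbhs0_le; rewrite lt_min ltr01 divr_gt0// ltr_wpDl//.
  have /andP[ha hb] : (`|h| <= 1) && (`|h| <= e / (C + 1)) by rewrite -le_min.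
  rewrite (_ : g - _ = - (h^-1 * (f (t + h) - f t - h * g))); last first.
    by rewrite /GRing.scale /= mulr1 [h + t]addrC; field.
  rewrite normrN normrM normfV ler_pdivrMl ?normr_gt0//.
  apply: le_trans (H h ha) _.
  rewrite -[h ^+ 2]real_normK ?num_real// expr2 mulrA mulrC ler_wpM2l//.
  rewrite ler_pdivlMr ?ltr_wpDl// in hb.
  apply: le_trans hb; rewrite mulrC ler_wpM2l// lerDl//.
apply: DeriveDef; first by apply/cvg_ex; exists g.
exact: cvg_lim lim.
Unshelve. all: by end_near. Qed.

Lemma cder_quad (f g : R -> R[i]) :
  (forall t, exists C, forall h, `|h| <= 1 ->
     cmod (f (t + h) - f t - h%:C * g t) <= C * h ^+ 2) -> cder f g.
Proof.
move=> H t; have [C HC] := H t; split; apply: (@quad_is_derive _ _ _ C) => h /HC.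
  apply: le_trans; apply: le_trans (le_Re_cmod _).
  by rewrite !ReImE mul0r subr0.
apply: le_trans; apply: le_trans (le_Im_cmod _).
by rewrite !ReImE mul0r addr0.
Qed.

Lemma cder_unique (f g g' : R -> R[i]) : cder f g -> cder f g' -> forall t, g t = g' t.
Proof.
move=> h h' t; have [r m] := h t; have [r' m'] := h' t.
by apply: complex_ext; rewrite -?(@derive_val _ _ _ _ _ _ _ r) -?(@derive_val _ _ _ _ _ _ _ m) derive_val.
Qed.

Lemma cder_const (f : R -> R[i]) : cder f (fun=> 0) -> forall t s, f t = f s.
Proof.
move=> h t s; apply: complex_ext.
  by apply: (@is_derive_0_is_cst _ (fun t => complex.Re (f t))) => x; have [] := h x.
by apply: (@is_derive_0_is_cst _ (fun t => complex.Im (f t))) => x; have [] := h x.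
Qed.

Lemma cder_continuous (f g : R -> R[i]) : cder f g ->
  continuous (fun t => complex.Re (f t)) /\ continuous (fun t => complex.Im (f t)).
Proof.
move=> h; split => t; have [r m] := h t.
  by apply: differentiable_continuous; apply/derivable1_diffP; exact: (@ex_derive _ _ _ _ _ _ _ r).
by apply: differentiable_continuous; apply/derivable1_diffP; exact: (@ex_derive _ _ _ _ _ _ _ m).
Qed.

End CurveDerivatives.

Section ExponentialFamilies.
Context d (T : measurableType d) (R : realType) (mu : {measure set T -> \bar R}).
Variables (g omega : T -> R[i]) (rho : T -> R).
Hypotheses (mg : cmeas g) (mo : cmeas omega).
Hypothesis orho : forall x, cmod (omega x) <= rho x.
Hypothesis ig : forall M, rint mu (fun x => cmod (g x) * expR (M * rho x)).

Lemma exp_family_cinteg (s : R[i]) : cinteg mu (fun x => g x * cexp (s * omega x)).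
Proof.
apply: (cinteg_le _ _ (ig (cmod s))).
  by apply: cmeasM => //; apply: cmeas_cexp; apply: cmeasM => //; exact: cmeas_cst.
move=> x; rewrite cmodM ler_wpM2l ?cmod_ge0// cmod_cexp ler_expR.
rewrite (le_trans (ler_norm _))// (le_trans (le_Re_cmod _))// cmodM.
by rewrite ler_wpM2l ?cmod_ge0.
Qed.

Lemma sqr_le_exp (y : R) : 0 <= y -> y ^+ 2 <= expR (2 * y).
Proof.
move=> y0; rewrite mulr_natl mulr2n expRD -expr2 ler_sqr ?nnegrE ?expR_ge0//.
by apply: le_trans (expR_ge1Dx _); rewrite lerDr.
Qed.

Lemma le_exp (y : R) : y <= expR y.
Proof. by apply: le_trans (expR_ge1Dx _); rewrite lerDr. Qed.

Lemma exp_family_cinteg1 (s : R[i]) :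
  cinteg mu (fun x => omega x * g x * cexp (s * omega x)).
Proof.
apply: (cinteg_le _ _ (ig (cmod s + 1))).
  apply: cmeasM; first exact: cmeasM.
  by apply: cmeas_cexp; apply: cmeasM => //; exact: cmeas_cst.
move=> x; rewrite !cmodM mulrC mulrA mulrC ler_wpM2l ?cmod_ge0// mulrDl expRD mul1r.
rewrite ler_pM ?cmod_ge0// ?(le_trans (orho x))// ?le_exp// cmod_cexp ler_expR.
rewrite (le_trans (ler_norm _))// (le_trans (le_Re_cmod _))// cmodM.
by rewrite ler_wpM2l ?cmod_ge0.
Qed.

(** The Taylor remainder of [cexp (h * omega)] is integrated directly. The increment is complex, so
    the bound serves both real derivatives of moments and holomorphy of Fock functions. In
    [cmod s + 3], the [3] pays [2 rho] for [|omega|^2] and [rho] for the exponential in the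
    remainder. *)
Lemma exp_family_quad (s h : R[i]) : cmod h <= 1 ->
  cmod (cint mu (fun x => g x * cexp ((s + h) * omega x)) -
        cint mu (fun x => g x * cexp (s * omega x)) -
        h * cint mu (fun x => omega x * g x * cexp (s * omega x))) <=
  2 * (2 * \int[mu]_x (cmod (g x) * expR ((cmod s + 3) * rho x))) * cmod h ^+ 2.
Proof.
move=> h1.
have i1 := exp_family_cinteg (s + h).
have i2 := exp_family_cinteg s.
have i3 := cintegZ h (exp_family_cinteg1 s).
rewrite -cintZ; last exact: exp_family_cinteg1.
rewrite -cintB// -cintB//; last exact: cintegB.
have -> : 2 * (2 * \int[mu]_x (cmod (g x) * expR ((cmod s + 3) * rho x))) * cmod h ^+ 2 =
  2 * \int[mu]_x (2 * cmod h ^+ 2 * (cmod (g x) * expR ((cmod s + 3) * rho x))).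
  by rewrite RintegralZl//; [ring|exact: ig].
apply: cmod_cint.
- exact: (cinteg_meas (cintegB (cintegB i1 i2) i3)).
- move=> x; rewrite (_ : _ - _ = g x * cexp (s * omega x) *
    (cexp (h * omega x) - 1 - h * omega x)); last first.
    by rewrite mulrDl cexpD /=; ring.
  rewrite cmodM; apply: (@le_trans _ _ ((cmod (g x) * expR (cmod s * rho x)) *
     (2 * (cmod h ^+ 2 * expR (2 * rho x) * expR (rho x))))).
    have r0 : 0 <= rho x := le_trans (cmod_ge0 _) (orho x).
    apply: ler_pM; rewrite ?cmod_ge0//.
      rewrite cmodM ler_wpM2l ?cmod_ge0// cmod_cexp ler_expR.
      rewrite (le_trans (ler_norm _))// (le_trans (le_Re_cmod _))// cmodM.
      by rewrite ler_wpM2l ?cmod_ge0.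
    apply: le_trans (cexp_taylor2 _) _; rewrite ler_pM2l// cmodM.
    apply: ler_pM; rewrite ?expR_ge0 ?sqr_ge0//.
      rewrite exprMn ler_wpM2l ?sqr_ge0//.
      apply: le_trans (sqr_le_exp (cmod_ge0 _)) _.
      by rewrite ler_expR ler_wpM2l.
    by rewrite ler_expR (le_trans _ (orho x))// ler_piMl ?cmod_ge0.
  have -> : expR ((cmod s + 3) * rho x) =
      expR (cmod s * rho x) * (expR (2 * rho x) * expR (rho x)).
    by rewrite -!expRD; congr expR; ring.
  by rewrite le_eqVlt; apply/orP; left; apply/eqP; ring.
- by apply: rintZ; exact: ig.
Qed.

Lemma exp_family_cder :
  cder (fun t : R => cint mu (fun x => g x * cexp (t%:C * omega x)))
       (fun t : R => cint mu (fun x => omega x * g x * cexp (t%:C * omega x))).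
Proof.
apply: cder_quad => t; eexists => h h1.
have := @exp_family_quad t%:C h%:C; rewrite !cmod_real real_normK ?num_real//.
rewrite (_ : (t + h)%:C = t%:C + h%:C); last by apply: complex_ext; rewrite !ReImE ?addr0.
by apply.
Qed.

End ExponentialFamilies.

Section ComplexGaussian.
Context (R : realType).
Notation leb := (@lebesgue_measure R).
Notation leb2 := (lebC R).
Notation P := (measurableTypeR R * measurableTypeR R)%type.
Implicit Types (c x y h : R).

Lemma ge0_integral_shift (G : R -> R) h : continuous G -> (forall x, 0 <= G x) ->
  (\int[leb]_x (G x)%:E = \int[leb]_x (G (x + h))%:E)%E.
Proof.
move=> cG G0; pose F := fun x : R => x + h.
have dF (x : R) : is_derive x 1 F 1.
  by apply: is_derive_eq; rewrite addr0.
have F' : derive1 F = fun=> 1.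
  by apply/funext => x; rewrite derive1E derive_val.
rewrite (@increasing_ge0_integration_by_substitutionT _ F G)//.
- by apply: eq_integral => x _; rewrite F' /= mulr1.
- by move=> x y xy; rewrite /F ltrD2r.
- by rewrite F'; move=> x; exact: cvg_cst.
- by rewrite F'; exact: is_cvg_cst.
- by rewrite F'; exact: is_cvg_cst.
- apply/cvgrNyPle => A; near=> x; rewrite /F -lerBrDr; near: x.
  by apply: nbhs_ninfty_le; exact: num_real.
- apply/cvgryPge => A; near=> x; rewrite /F -lerBlDr; near: x.
  by apply: nbhs_pinfty_ge; exact: num_real.
Unshelve. all: by end_near. Qed.

(** Substitution in a nonnegative integral is applied to [k] and to [g + k], and the two identities
    are subtracted. *)
Lemma Rintegral_shift (g k : R -> R) h : continuous g -> continuous k ->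
  (forall x, `|g x| <= k x) -> rint leb k -> rint leb (fun x => k (x + h)) ->
  \int[leb]_x g (x + h) = \int[leb]_x g x.
Proof.
move=> cg ck gk ik ikh.
have mg : measurable_fun setT (g : measurableTypeR R -> R) by exact: continuous_measurable_fun.
have mgh : measurable_fun setT ((fun x => g (x + h)) : measurableTypeR R -> R).
  apply: continuous_measurable_fun => x; apply: continuous_comp; last exact: cg.
  by apply: cvgD; [exact: cvg_id|exact: cvg_cst].
have ig : rint leb g by apply: (@rint_le _ _ _ leb g k).
have igh : rint leb (fun x => g (x + h)).
  by apply: (@rint_le _ _ _ leb (fun x => g (x + h)) (fun x => k (x + h))) => // x; exact: gk.
have e1 : \int[leb]_x (k x) = \int[leb]_x (k (x + h)).
  rewrite /Rintegral (@ge0_integral_shift k h)// => x.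
  exact: le_trans (normr_ge0 _) (gk x).
have e2 : \int[leb]_x (g x + k x) = \int[leb]_x (g (x + h) + k (x + h)).
  rewrite /Rintegral (@ge0_integral_shift (fun x => g x + k x) h)// => x.
    by apply: cvgD; [exact: cg|exact: ck].
  by have := gk x; rewrite ler_norml -lerBlDr sub0r => /andP[].
move: e2; rewrite !RintegralD// e1 => /addIr ->.
by [].
Qed.

(** Completing the square with half of the Gaussian; the other half stays integrable. *)
Lemma gauss_bound c (M : R) : 0 < c -> forall y,
  expR (M * y - c * y ^+ 2) <= expR (M ^+ 2 / (2 * c)) * expR (- (c / 2 * y ^+ 2)).
Proof.
move=> c0 y; rewrite -expRD ler_expR.
have -> : M * y - c * y ^+ 2 = M ^+ 2 / (2 * c) + - (c / 2 * y ^+ 2) -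
   (M / c - y) ^+ 2 * (c / 2) by field; lra.
by rewrite gerBl mulr_ge0 ?sqr_ge0// divr_ge0// ltW.
Qed.

Definition gauss_exp c (s : R[i]) (x : R) : R[i] := cexp (s * x%:C - (c * x ^+ 2)%:C).

Lemma cmod_gauss_exp c s x : cmod (gauss_exp c s x) = expR (complex.Re s * x - c * x ^+ 2).
Proof. by rewrite cmod_cexp !ReImE; congr expR; ring. Qed.

Lemma gauss_expM c s s' x : gauss_exp c (s + s') x = gauss_exp c s x * cexp (s' * x%:C).
Proof. by rewrite /gauss_exp -cexpD; congr cexp; ring. Qed.

Lemma cmeas_gauss_exp c s : cmeas (gauss_exp c s : measurableTypeR R -> _).
Proof.
apply: cmeas_cexp; apply: cmeasB.
  by apply: cmeasM; [exact: cmeas_cst|exact: cmeas_real].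
by apply: cmeas_real; apply: measurable_funM => //; exact: measurable_funX.
Qed.

Lemma gauss_exp_rint c s (M : R) : 0 < c ->
  rint leb (fun x => cmod (gauss_exp c s x) * expR (M * `|x|)).
Proof.
move=> c0; have c2 : 0 < c / 2 by rewrite divr_gt0.
have [ig _] := gauss1 0 c2.
apply: (@rint_le _ _ _ leb _ _ _ _ (rintZ (expR ((cmod s + M) ^+ 2 / (2 * c))) ig)).
  apply: measurable_funM; first exact/measurable_cmod/cmeas_gauss_exp.
  apply: measurableT_comp => //; apply: measurable_funM => //.
move=> x; rewrite subr0 ger0_norm ?mulr_ge0 ?cmod_ge0 ?expR_ge0//.
rewrite cmod_gauss_exp -expRD -(real_normK (num_real x)).
apply: le_trans (gauss_bound _ c0 _); rewrite ler_expR mulrDl.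
rewrite addrAC lerD2r lerD2r.
rewrite (le_trans (ler_norm _))// normrM ler_wpM2r//.
exact: le_Re_cmod.
Qed.

Lemma gauss_exp_der c (s eta : R[i]) : 0 < c -> cmod eta <= 1 ->
  cder (fun t => cint leb (gauss_exp c (s + t%:C * eta)))
       (fun t => cint leb (fun x => eta * x%:C * gauss_exp c (s + t%:C * eta) x)).
Proof.
move=> c0 e1.
have mo : cmeas ((fun x => eta * x%:C) : measurableTypeR R -> _).
  by apply: cmeasM; [exact: cmeas_cst|exact: cmeas_real].
have le x : cmod (eta * x%:C) <= `|x| by rewrite cmodM cmod_real ler_piMl.
have H := @exp_family_cder _ _ _ leb (gauss_exp c s) (fun x => eta * x%:C) (fun x => `|x|)
  (cmeas_gauss_exp c s) mo le (fun M => gauss_exp_rint s M c0).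
have E t x : gauss_exp c (s + t%:C * eta) x = gauss_exp c s x * cexp (t%:C * (eta * x%:C)).
  by rewrite gauss_expM mulrA.
have -> : (fun t => cint leb (gauss_exp c (s + t%:C * eta))) =
   (fun t : R => cint leb (fun x => gauss_exp c s x * cexp (t%:C * (eta * x%:C)))).
  by apply/funext => t; apply: eq_cint => x; exact: E.
apply: (cder_eq H).
by move=> t; apply: eq_cint => x; rewrite E; ring.
Qed.

(** Translating by [h = p / (2 c)], where the modulus peaks, removes the real part of the parameter
    and leaves a purely imaginary one. *)
Lemma gauss_exp_shift c (p q : R) : 0 < c ->
  cint leb (gauss_exp c (p +i* q)) =
  cexp (((p +i* 0) ^+ 2 + 2 * (p%:C * (0 +i* q))) * ((4 * c)^-1)%:C) * cint leb (gauss_exp c (0 +i* q)).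
Proof.
move=> c0; pose h := p / (2 * c).
have ci : cinteg leb (gauss_exp c (0 +i* q)).
  apply: (cinteg_le (cmeas_gauss_exp _ _) _ (@gauss_exp_rint c (0 +i* q) 0 c0)) => x.
  by rewrite mul0r expR0 mulr1.
rewrite -cintZ//.
transitivity (cint leb (fun x => gauss_exp c (p +i* q) (x + h))).
  have [g d1] : exists g, cder (gauss_exp c (p +i* q)) g.
    rewrite (_ : gauss_exp _ _ = fun x => cexp ((p +i* q) * x%:C + - c%:C * (x%:C * x%:C))).
      eexists; apply: cder_cexp; apply: cderD; first exact/cderZ/cder_id.
      by apply: cderZ; apply: cderM; exact: cder_id.
    by apply/funext => x; rewrite /gauss_exp rmorphM rmorphXn /= expr2 mulNr.
  have [c1 c2] := cder_continuous d1.
  pose k x := expR (p * x - c * x ^+ 2).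
  have kE x : k x = expR (p ^+ 2 / (4 * c)) * expR (- (c * (x - h) ^+ 2)).
    by rewrite -expRD /h; congr expR; field; lra.
  have ck : continuous k.
    apply: continuous_expR_comp => x; apply: cvgB; apply: cvgM; try exact: cvg_cst; try exact: cvg_id.
    by apply: cvgM; exact: cvg_id.
  have ik : rint leb k.
    by rewrite (funext kE); apply: rintZ; have [] := gauss1 h c0.
  have ikh : rint leb (fun x => k (x + h)).
    under eq_fun do rewrite kE addrK -[X in _ * X ^+ 2]subr0.
    by apply: rintZ; have [] := gauss1 0 c0.
  apply: complex_ext; rewrite /cint !ReImE; symmetry.
    apply: (Rintegral_shift c1 ck _ ik ikh) => x.
    by apply: le_trans (le_Re_cmod _) _; rewrite cmod_gauss_exp.
  apply: (Rintegral_shift c2 ck _ ik ikh) => x.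
  by apply: le_trans (le_Im_cmod _) _; rewrite cmod_gauss_exp.
apply: eq_cint => x; rewrite /gauss_exp -cexpD; congr cexp.
apply: complex_ext; rewrite /h !expr2 !ReImE /=; field; lra.
Qed.

(** For a parameter [i q], the first moment [F1 q] is found by differentiating the translation
    formula in the real direction. It yields [F' = - q / (2 c) F] in [q], so [exp (q^2 / (4 c)) F]
    is constant, equal to the real Gaussian integral. This takes the place of a contour shift. *)
Lemma gauss_exp_integral c (s : R[i]) : 0 < c ->
  cint leb (gauss_exp c s) = (Num.sqrt (pi / c))%:C * cexp (s ^+ 2 * ((4 * c)^-1)%:C).
Proof.
move=> c0.
pose F1 (q : R) := cint leb (fun x => x%:C * gauss_exp c (0 +i* q) x).
have F1E q : F1 q = (0 +i* (q / (2 * c))) * cint leb (gauss_exp c (0 +i* q)).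
  have d1 := @gauss_exp_der c (0 +i* q) 1 c0 _.
  rewrite cmod1 in d1; have {}d1 := d1 (lexx _).
  have d2 : cder (fun t : R => cint leb (gauss_exp c (0 +i* q + t%:C * 1)))
    (fun t => ((2 * t%:C + 2 * (0 +i* q)) * ((4 * c)^-1)%:C *
      cexp ((t%:C * t%:C + 2 * (t%:C * (0 +i* q))) * ((4 * c)^-1)%:C)) *
      cint leb (gauss_exp c (0 +i* q))).
    under [X in cder X]eq_fun => t.
      rewrite (_ : 0 +i* q + t%:C * 1 = t +i* q); last by apply: complex_ext; rewrite !ReImE /=; ring.
      rewrite gauss_exp_shift// -[t +i* 0]/(t%:C) expr2.
      over.
    apply: cder_eq.
      apply: cderM; last exact: cder_cst.
      apply: cder_cexp; apply: cderM; last exact: cder_cst.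
      apply: cderD; first by apply: cderM; exact: cder_id.
      apply: cderZ; apply: cderM; [exact: cder_id|exact: cder_cst].
    by move=> t /=; ring.
  have e := cder_unique d1 d2 0.
  have E0 : 0 +i* q + 0%:C * 1 = 0 +i* q by apply: complex_ext; rewrite !ReImE /=; ring.
  have E1 : (0%:C * 0%:C + 2 * (0%:C * (0 +i* q))) * ((4 * c)^-1)%:C = 0 :> R[i].
    by apply: complex_ext; rewrite !ReImE /=; ring.
  have E2 : (2 * 0%:C + 2 * (0 +i* q)) * ((4 * c)^-1)%:C = 0 +i* (q / (2 * c)) :> R[i].
    by apply: complex_ext; rewrite !ReImE /=; field; lra.
  rewrite E0 E1 E2 cexp0 mulr1 in e; rewrite -e /F1.
  by apply: eq_cint => x; rewrite (mul1r (x%:C : R[i])).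
have d3 : cder (fun q => cexp ((q%:C * q%:C) * ((4 * c)^-1)%:C) * cint leb (gauss_exp c (0 +i* q))) (fun=> 0).
  have d1 := @gauss_exp_der c 0 (iC R) c0 _.
  rewrite cmod_iC in d1; have {}d1 := d1 (lexx _).
  have E (q : R) : 0 + q%:C * iC R = 0 +i* q by apply: complex_ext; rewrite !ReImE /=; ring.
  have d2 : cder (fun q => cint leb (gauss_exp c (0 +i* q))) (fun q => iC R * F1 q).
    under [X in cder X]eq_fun do rewrite -E.
    apply: (cder_eq d1) => q; rewrite E /F1 -cintZ.
      by apply: eq_cint => x; rewrite mulrA.
    apply: (@cinteg_le _ _ _ leb _ _ _ _ (@gauss_exp_rint c (0 +i* q) 1 c0)).
      by apply: cmeasM; [exact: cmeas_real|exact: cmeas_gauss_exp].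
    move=> x; rewrite cmodM cmod_real mulrC ler_wpM2l ?cmod_ge0// mul1r.
    exact: le_exp.
  apply: cder_eq.
    apply: cderM; last exact: d2.
    by apply: cder_cexp; apply: cderM; [apply: cderM; exact: cder_id|exact: cder_cst].
  move=> q /=; rewrite F1E.
  set A := cexp _; set B := cint _ _.
  have -> : iC R * ((0 +i* (q / (2 * c))) * B) = - (q / (2 * c))%:C * B.
    by rewrite mulrA; congr (_ * _); apply: complex_ext; rewrite !ReImE /=; ring.
  rewrite (_ : (1 * q%:C + q%:C * 1) * ((4 * c)^-1)%:C + q%:C * q%:C * 0 = (q / (2 * c))%:C); last first.
    by apply: complex_ext; rewrite !ReImE /=; field; lra.
  ring.
have F0 : cint leb (gauss_exp c (0 +i* 0)) = (Num.sqrt (pi / c))%:C.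
  have [_ e] := gauss1 0 c0.
  apply: complex_ext; rewrite /cint !ReImE.
    rewrite -e; apply: eq_Rintegral => x _.
    rewrite /gauss_exp /cexp !ReImE -[RHS]mulr1 -[in RHS]cos0 /=.
    by congr (expR _ * cos _); ring.
  rewrite (_ : (fun x => _) = fun=> 0) ?/Rintegral ?integral0//.
  apply/funext => x; rewrite /gauss_exp /cexp !ReImE /= (_ : _ - 0 = 0); last by ring.
  by rewrite sin0 mulr0.
case: s => p q; rewrite gauss_exp_shift//.
have := cder_const d3 q 0; rewrite F0 !mul0r cexp0 mul1r => e.
have {e} -> : cint leb (gauss_exp c (0 +i* q)) = (Num.sqrt (pi / c))%:C * cexp (- (q%:C * q%:C * ((4 * c)^-1)%:C)).
  by rewrite -e cexpN mulrAC mulfV ?mul1r// cexp_neq0.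
rewrite mulrCA -cexpD; congr (_ * cexp _).
apply: complex_ext; rewrite !expr2 !ReImE /=; ring.
Qed.

End ComplexGaussian.

Section GaussianMoments.
Context (R : realType).
Notation leb := (@lebesgue_measure R).
Notation leb2 := (lebC R).
Notation P := (measurableTypeR R * measurableTypeR R)%type.
Variable c : R.
Hypothesis c0 : 0 < c.
Implicit Types (a b s : R[i]) (g : P -> R[i]).

Let ic : R[i] := (c^-1)%:C.

(** With [a] and [b] independent, the integral is a generating function for the moments in [w] and
    [conj w]. *)
Definition gauss2c a b (p : P) : R[i] :=
  cexp (a * toC p + b * conjc (toC p) - (c * cmod (toC p) ^+ 2)%:C).

Lemma cmeas_gauss2c a b : cmeas (gauss2c a b).
Proof.
have mt := measurable_toC R.
apply: cmeas_cexp; apply: cmeasB.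
  apply: cmeasD; apply: cmeasM => //; try exact: cmeas_cst.
  exact: cmeasJ.
apply: cmeas_real; apply: measurable_funM => //; apply: measurable_funX.
exact: measurable_cmod.
Qed.

Let Z a b : R[i] := (pi / c)%:C * cexp (a * b * ic).

Lemma gauss2c_integral a b : cint leb2 (gauss2c a b) = Z a b.
Proof.
have E (p : P) : gauss2c a b p = gauss_exp c (a + b) p.1 * gauss_exp c (iC R * (a - b)) p.2.
  rewrite /gauss2c /gauss_exp -cexpD; congr cexp.
  by apply: complex_ext; rewrite !ReImE ?cmod_sqr /=; ring.
rewrite (eq_cint _ E).
have rg s : rint leb (fun x => cmod (gauss_exp c s x)).
  by have := gauss_exp_rint s 0 c0; under eq_fun do rewrite mul0r expR0 mulr1.
rewrite (@cint_leb2_prod R _ _ (fun x => cmod (gauss_exp c (a + b) x))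
  (fun x => cmod (gauss_exp c (iC R * (a - b)) x)) (cmeas_gauss_exp c (a + b))
  (cmeas_gauss_exp c (iC R * (a - b))) (rg _) (rg _) (fun=> lexx _) (fun=> lexx _)).
rewrite !gauss_exp_integral// mulrACA -rmorphM /= -expr2 sqr_sqrtr; last first.
  by rewrite divr_ge0 ?pi_ge0// ltW.
rewrite -cexpD /Z; congr (_ * cexp _).
apply: complex_ext; rewrite /ic !expr2 !ReImE /=; field; exact: lt0r_neq0.
Qed.

(** Finiteness of all exponential moments; it survives multiplication by [w] or [conj w], so moments
    can be differentiated repeatedly. *)
Definition gadm g := cmeas g /\ forall M, rint leb2 (fun p => cmod (g p) * expR (M * cmod (toC p))).

Lemma gadm_gauss2c a b : gadm (gauss2c a b).
Proof.
split=> [|M]; first exact: cmeas_gauss2c.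
have c2 : 0 < c / 2 by rewrite divr_gt0.
have [ig _] := gauss2 0 c2.
apply: (@rint_le _ _ _ leb2 _ _ _ _ (rintZ (expR ((cmod a + cmod b + M) ^+ 2 / (2 * c))) ig)).
  apply: measurable_funM; first exact/measurable_cmod/cmeas_gauss2c.
  apply: measurableT_comp => //; apply: measurable_funM => //.
  exact/measurable_cmod/measurable_toC.
move=> p; rewrite subr0 ger0_norm ?mulr_ge0 ?cmod_ge0 ?expR_ge0//.
rewrite cmod_cexp -expRD; apply: le_trans (gauss_bound _ c0 _); rewrite ler_expR.
have := le_Re_cmod (a * toC p); have := le_Re_cmod (b * conjc (toC p)).
rewrite !cmodM cmod_conj !ler_norml => /andP[_ h1] /andP[_ h2].
rewrite cReD cReN cReD Re_real; lra.
Qed.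

Lemma gadmM g (omega : P -> R[i]) : cmeas omega -> (forall p, cmod (omega p) <= cmod (toC p)) ->
  gadm g -> gadm (fun p => omega p * g p).
Proof.
move=> mo ol [mg ig]; split=> [|M]; first exact: cmeasM.
apply: (@rint_le _ _ _ leb2 _ _ _ _ (ig (M + 1))).
  apply: measurable_funM; first exact/measurable_cmod/cmeasM.
  apply: measurableT_comp => //; apply: measurable_funM => //.
  exact/measurable_cmod/measurable_toC.
move=> p; rewrite ger0_norm ?mulr_ge0 ?cmod_ge0 ?expR_ge0// mulrDl expRD mul1r cmodM.
rewrite -mulrA mulrCA ler_wpM2l ?cmod_ge0// mulrC ler_wpM2l ?expR_ge0//.
by rewrite (le_trans (ol p))// le_exp.
Qed.

Lemma gadm_cinteg g : gadm g -> cinteg leb2 g.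
Proof.
move=> [mg ig]; apply: (cinteg_le mg _ (ig 0)) => p.
by rewrite mul0r expR0 mulr1.
Qed.

(** A moment is the derivative at [0] of an integral known in closed form, by uniqueness of
    derivatives. *)
Lemma moment_step g (omega : P -> R[i]) (Phi Phi' : R -> R[i]) :
  cmeas omega -> (forall p, cmod (omega p) <= cmod (toC p)) -> gadm g ->
  (forall t : R, cint leb2 (fun p => g p * cexp (t%:C * omega p)) = Phi t) ->
  cder Phi Phi' ->
  cint leb2 (fun p => omega p * g p) = Phi' 0.
Proof.
move=> mo ol [mg ig] e d2; have d1 := exp_family_cder mg mo ol ig.
have d3 : cder Phi (fun t => cint leb2 (fun p => omega p * g p * cexp (t%:C * omega p))).
  by rewrite -(funext e).
rewrite -(cder_unique d3 d2 0); apply: eq_cint => p.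
have -> : cexp (0%:C * omega p) = 1 by rewrite -(cexp0 R); congr cexp; rewrite mul0r.
by rewrite mulr1.
Qed.

Let w (p : P) : R[i] := toC p.
Let wb (p : P) : R[i] := conjc (toC p).
Let mw : cmeas w. Proof. exact: measurable_toC. Qed.
Let mwb : cmeas wb. Proof. exact/cmeasJ/measurable_toC. Qed.
Let lw p : cmod (w p) <= cmod (toC p). Proof. exact: lexx. Qed.
Let lwb p : cmod (wb p) <= cmod (toC p). Proof. by rewrite cmod_conj. Qed.

Let gauss2c_addl a b t p : gauss2c a b p * cexp (t * w p) = gauss2c (a + t) b p.
Proof. by rewrite /gauss2c -cexpD /w; congr cexp; ring. Qed.

Let gauss2c_addr a b t p : gauss2c a b p * cexp (t * wb p) = gauss2c a (b + t) p.
Proof. by rewrite /gauss2c -cexpD /wb; congr cexp; ring. Qed.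

Let cder_Zl a b : cder (fun t => Z (a + t%:C) b) (fun t => b * ic * Z (a + t%:C) b).
Proof.
apply: cder_eq.
  apply: cderZ; apply: cder_cexp; apply: cderM; last exact: cder_cst.
  apply: cderM; last exact: cder_cst.
  by apply: cderD; [exact: cder_cst|exact: cder_id].
by move=> t /=; rewrite /Z; ring.
Qed.

Let cder_Zr a b : cder (fun t => Z a (b + t%:C)) (fun t => a * ic * Z a (b + t%:C)).
Proof.
apply: cder_eq.
  apply: cderZ; apply: cder_cexp; apply: cderM; last exact: cder_cst.
  apply: cderM; first exact: cder_cst.
  by apply: cderD; [exact: cder_cst|exact: cder_id].
by move=> t /=; rewrite /Z; ring.
Qed.

Let add0C a : a + (0 : R)%:C = a.
Proof. by apply: complex_ext; rewrite !ReImE addr0. Qed.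

Let G10 a b := gadmM mw lw (gadm_gauss2c a b).
Let G01 a b := gadmM mwb lwb (gadm_gauss2c a b).
Let G20 a b := gadmM mw lw (G10 a b).
Let G11 a b := gadmM mw lw (G01 a b).
Let G21 a b := gadmM mw lw (G11 a b).

Let m10 a b : cint leb2 (fun p => w p * gauss2c a b p) = b * ic * Z a b.
Proof.
rewrite (moment_step mw lw (gadm_gauss2c a b) _ (cder_Zl a b)) ?add0C// => t.
by rewrite -gauss2c_integral; apply: eq_cint => p; rewrite gauss2c_addl.
Qed.

Let m01 a b : cint leb2 (fun p => wb p * gauss2c a b p) = a * ic * Z a b.
Proof.
rewrite (moment_step mwb lwb (gadm_gauss2c a b) _ (cder_Zr a b)) ?add0C// => t.
by rewrite -gauss2c_integral; apply: eq_cint => p; rewrite gauss2c_addr.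
Qed.

Let m20 a b : cint leb2 (fun p => w p * (w p * gauss2c a b p)) = (b * ic) ^+ 2 * Z a b.
Proof.
have d := cderZ (b * ic) (cder_Zl a b).
rewrite (moment_step mw lw (G10 a b) _ d) ?add0C; first by ring.
by move=> t; rewrite -m10; apply: eq_cint => p; rewrite -mulrA gauss2c_addl.
Qed.

Let cder11 a b : cder (fun t => (a + t%:C) * ic * Z (a + t%:C) b)
  (fun t => (ic + (a + t%:C) * b * ic ^+ 2) * Z (a + t%:C) b).
Proof.
apply: cder_eq.
  apply: cderM; last exact: cder_Zl.
  apply: cderM; last exact: cder_cst.
  by apply: cderD; [exact: cder_cst|exact: cder_id].
by move=> t /=; ring.
Qed.

Let m11 a b : cint leb2 (fun p => w p * (wb p * gauss2c a b p)) =
  (ic + a * b * ic ^+ 2) * Z a b.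
Proof.
rewrite (moment_step mw lw (G01 a b) _ (cder11 a b)) ?add0C// => t.
by rewrite -m01; apply: eq_cint => p; rewrite -mulrA gauss2c_addl.
Qed.

Let m21 a b : cint leb2 (fun p => w p * (w p * (wb p * gauss2c a b p))) =
  (2 * b * ic ^+ 2 + a * b ^+ 2 * ic ^+ 3) * Z a b.
Proof.
have d : cder (fun t => (ic + (a + t%:C) * b * ic ^+ 2) * Z (a + t%:C) b)
  (fun t => (2 * b * ic ^+ 2 + (a + t%:C) * b ^+ 2 * ic ^+ 3) * Z (a + t%:C) b).
  apply: cder_eq.
    apply: cderM; last exact: cder_Zl.
    apply: cderD; first exact: cder_cst.
    apply: cderM; last exact: cder_cst.
    apply: cderM; last exact: cder_cst.
    by apply: cderD; [exact: cder_cst|exact: cder_id].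
  by move=> t /=; ring.
rewrite (moment_step mw lw (G11 a b) _ d) ?add0C// => t.
by rewrite -m11; apply: eq_cint => p; rewrite -!mulrA gauss2c_addl.
Qed.

Let polyE a b (p0 p1 p2 q0 q1 : R[i]) p :
  (p0 + p1 * toC p + p2 * toC p ^+ 2) * (q0 + q1 * conjc (toC p)) * gauss2c a b p =
  (p0 * q0) * gauss2c a b p + ((p1 * q0) * (w p * gauss2c a b p) +
  ((p2 * q0) * (w p * (w p * gauss2c a b p)) + ((p0 * q1) * (wb p * gauss2c a b p) +
  ((p1 * q1) * (w p * (wb p * gauss2c a b p)) +
   (p2 * q1) * (w p * (w p * (wb p * gauss2c a b p))))))).
Proof. by rewrite /w /wb; ring. Qed.

Lemma gauss2c_poly_cinteg a b (p0 p1 p2 q0 q1 : R[i]) :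
  cinteg leb2 (fun p => (p0 + p1 * toC p + p2 * toC p ^+ 2) * (q0 + q1 * conjc (toC p)) *
    gauss2c a b p).
Proof.
rewrite (funext (polyE a b p0 p1 p2 q0 q1)).
do ! (apply: cintegD; first (apply: cintegZ; apply: gadm_cinteg));
  last (apply: cintegZ; apply: gadm_cinteg).
- exact: gadm_gauss2c.
- exact: G10.
- exact: G20.
- exact: G01.
- exact: G11.
- exact: G21.
Qed.

(** Degree two in [w] and one in [conj w] is what [|V|^2 U] requires for profiles of degree one: two
    holomorphic factors and one conjugate. *)
Lemma gauss2c_moments a b (p0 p1 p2 q0 q1 : R[i]) :
  cint leb2 (fun p => (p0 + p1 * toC p + p2 * toC p ^+ 2) * (q0 + q1 * conjc (toC p)) *
    gauss2c a b p) =
  (p0 * q0 + p1 * q0 * (b * ic) + p2 * q0 * (b * ic) ^+ 2 + p0 * q1 * (a * ic) +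
   p1 * q1 * (ic + a * b * ic ^+ 2) + p2 * q1 * (2 * b * ic ^+ 2 + a * b ^+ 2 * ic ^+ 3)) *
  ((pi / c)%:C * cexp (a * b * ic)).
Proof.
rewrite -/(Z a b).
have i00 := gadm_cinteg (gadm_gauss2c a b).
have i10 := gadm_cinteg (G10 a b).
have i01 := gadm_cinteg (G01 a b).
have i20 := gadm_cinteg (G20 a b).
have i11 := gadm_cinteg (G11 a b).
have i21 := gadm_cinteg (G21 a b).
rewrite (eq_cint leb2 (polyE a b p0 p1 p2 q0 q1)).
rewrite !cintD; do ? (try exact: cintegZ; apply: cintegD).
rewrite !cintZ// m10 m01 m20 m11 m21 gauss2c_integral; ring.
Qed.

End GaussianMoments.

(** * The Bargmann projection *)

Section BargmannProjection.
Context (R : realType).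
Notation leb2 := (lebC R).
Notation lebS := (product_sfm (@lebesgue_measure R) (@lebesgue_measure R)).
Notation P := (measurableTypeR R * measurableTypeR R)%type.
Implicit Types (z w : R[i]) (F G : R[i] -> R[i]) (k C : R).

(** The kernel of [Pi_proj] with both Gaussian factors included: it is Hermitian, and its modulus
    depends on [w - z] only. *)
Definition kern z w : R[i] := (pi^-1)%:C *
  cexp (conjc w * z - (cmod z ^+ 2 / 2)%:C - (cmod w ^+ 2 / 2)%:C).

Lemma cmod_kern z w : cmod (kern z w) = pi^-1 * expR (- (2^-1 * cmod (w - z) ^+ 2)).
Proof.
rewrite cmodM cmod_real cmod_cexp ger0_norm ?invr_ge0 ?pi_ge0//.
by congr (_ * expR _); rewrite !ReImE !cmod_sqr !ReImE; field.
Qed.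

Lemma realCM (x y : R) : (x * y)%:C = x%:C * y%:C.
Proof. by apply: complex_ext; rewrite !ReImE; ring. Qed.

Lemma conjM z w : conjc (z * w) = conjc z * conjc w.
Proof. by rewrite rmorphM. Qed.

Lemma conj_kern z w : conjc (kern z w) = kern w z.
Proof.
rewrite /kern conjM -cexp_conj conjc_real; congr (_ * cexp _).
by apply: complex_ext; rewrite !ReImE; ring.
Qed.

Definition pmeas F := cmeas (fun p : P => F (toC p)).

Lemma pmeas_kern z : pmeas (kern z).
Proof.
apply: cmeasM; first exact: cmeas_cst.
apply: cmeas_cexp; apply: cmeasB; first apply: cmeasB; try exact: cmeas_cst.
  by apply: cmeasM; [exact/cmeasJ/measurable_toC|exact: cmeas_cst].
apply: cmeas_real; apply: measurable_funM => //; apply: measurable_funX.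
exact/measurable_cmod/measurable_toC.
Qed.

Lemma cmeas_kern2 d (T : measurableType d) (f g : T -> R[i]) : cmeas f -> cmeas g ->
  cmeas (fun x => kern (f x) (g x)).
Proof.
move=> mf mg; apply: cmeasM; first exact: cmeas_cst.
apply: cmeas_cexp; apply: cmeasB; first apply: cmeasB.
- by apply: cmeasM => //; exact: cmeasJ.
- apply: cmeas_real; apply: measurable_funM => //; apply: measurable_funX.
  exact: measurable_cmod.
- apply: cmeas_real; apply: measurable_funM => //; apply: measurable_funX.
  exact: measurable_cmod.
Qed.

Definition wbd k C F := pmeas F /\ forall z, cmod (F z) <= C * expR (- (k * cmod z)).

(** The Gaussian of rate [1/4] integrates to [4 pi], against the kernel's [1 / pi]; [cmod_cint]
    doubles the resulting [4]. The exponential is the cost of absorbing the weight. *)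
Definition Cpi k : R := 8 * expR (k ^+ 2).

Lemma Cpi_gt0 k : 0 < Cpi k. Proof. by rewrite mulr_gt0// expR_gt0. Qed.

(* The peak of the Gaussian kernel absorbs the weight, since
   [- k |w| <= - k |z| + k |w - z|]. *)
Lemma kern_weight k z w : 0 < k -> cmod (kern z w) * expR (- (k * cmod w)) <=
  pi^-1 * expR (k ^+ 2) * expR (- (k * cmod z)) * expR (- (4^-1 * cmod (w - z) ^+ 2)).
Proof.
move=> k0; rewrite cmod_kern -!mulrA ler_wpM2l ?invr_ge0 ?pi_ge0//.
have t : cmod z <= cmod w + cmod (w - z).
  by rewrite cmodBC -{1}(subrK w z) addrC cmodD.
rewrite -!expRD ler_expR.
have := ler_wpM2l (ltW k0) t; have := sqr_ge0 (k - cmod (w - z) / 2); nra.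
Qed.

Lemma kern_rint k z : 0 < k ->
  rint leb2 (fun p => cmod (kern z (toC p)) * expR (- (k * cmod (toC p)))) /\
  \int[leb2]_p (cmod (kern z (toC p)) * expR (- (k * cmod (toC p)))) <=
     Cpi k / 2 * expR (- (k * cmod z)).
Proof.
move=> k0.
have h4 : (0 : R) < 4^-1 by rewrite invr_gt0.
have [ig eg] := gauss2 z h4.
have ig' := rintZ (pi^-1 * expR (k ^+ 2) * expR (- (k * cmod z))) ig.
have i : rint leb2 (fun p => cmod (kern z (toC p)) * expR (- (k * cmod (toC p)))).
  apply: (@rint_le _ _ _ leb2 _ _ _ _ ig').
    apply: measurable_funM; first exact/measurable_cmod/pmeas_kern.
    apply: measurableT_comp => //; apply: measurableT_comp => //.
    by apply: measurable_funM => //; exact/measurable_cmod/measurable_toC.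
  by move=> p; rewrite ger0_norm ?mulr_ge0 ?cmod_ge0 ?expR_ge0// kern_weight.
split=> //; apply: le_trans (Rintegral_le i ig' (fun p => kern_weight z (toC p) k0)) _.
rewrite RintegralZl// eg /Cpi; have p0 := pi_gt0 R.
rewrite le_eqVlt; apply/orP; left; apply/eqP.
move: (pi : R) p0 => q q0; field; exact: lt0r_neq0.
Qed.

Lemma wbd_kernM k C F z : 0 < k -> wbd k C F ->
  cinteg leb2 (fun p => kern z (toC p) * F (toC p)).
Proof.
move=> k0 [mF bF]; have [i _] := kern_rint z k0.
apply: (@cinteg_le _ _ _ leb2 _ _ _ _ (rintZ C i)).
  by apply: cmeasM => //; exact: pmeas_kern.
by move=> p; rewrite cmodM mulrCA ler_wpM2l ?cmod_ge0.
Qed.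

Lemma Pi_kern k C F z : 0 < k -> wbd k C F ->
  Pi_proj F z = cint leb2 (fun p => kern z (toC p) * F (toC p)).
Proof.
move=> k0 bF; have i := wbd_kernM z k0 bF.
have e (p : P) : cexp (conjc (toC p) * z - (cmod (toC p) ^+ 2 / 2)%:C) * F (toC p) =
    (pi * expR (cmod z ^+ 2 / 2))%:C * (kern z (toC p) * F (toC p)).
  rewrite mulrA; congr (_ * _); rewrite /kern (realCM pi) -cexp_real.
  rewrite mulrACA -realCM mulfV ?gt_eqF ?pi_gt0//= mul1r -cexpD; congr cexp.
  by ring.
rewrite /Pi_proj; transitivity ((pi^-1 * expR (- (cmod z ^+ 2 / 2)))%:C *
   cint leb2 (fun p => (pi * expR (cmod z ^+ 2 / 2))%:C * (kern z (toC p) * F (toC p)))).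
  by congr (_ * _); apply: eq_cint => p; exact: e.
rewrite cintZ// mulrA -realCM mulrACA mulVf ?gt_eqF ?pi_gt0// mul1r -expRD addNr expR0.
by rewrite mul1r.
Qed.

(** Measurability holds because the projection is a partial integral of a jointly measurable
    function on two copies of the plane; the bound is [kern_weight], integrated. *)
Lemma Pi_bound k C F : 0 < k -> wbd k C F -> wbd k (Cpi k * C) (Pi_proj F).
Proof.
move=> k0 bF; have [mF leF] := bF.
have PE : Pi_proj F = fun z => cint leb2 (fun p => kern z (toC p) * F (toC p)).
  by apply/funext => z; exact: Pi_kern k0 bF.
split.
  rewrite /pmeas PE.
  have m : cmeas (fun x : P * P => kern (toC x.1) (toC x.2) * F (toC x.2)).
    apply: cmeasM; first (apply: cmeas_kern2).
    - exact: (cmeas_comp measurable_fst (measurable_toC R)).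
    - exact: (cmeas_comp measurable_snd (measurable_toC R)).
    - exact: (cmeas_comp measurable_snd mF).
  exact: (@cmeas_cint _ _ _ _ R lebS _ m).
move=> z; rewrite PE; have [i le] := kern_rint z k0.
have H := @cmod_cint _ _ _ leb2 (fun p => kern z (toC p) * F (toC p)) _ _ _ (rintZ C i).
apply: (le_trans (H _ _)).
- by apply: cmeasM => //; exact: pmeas_kern.
- by move=> p; rewrite cmodM mulrCA ler_wpM2l ?cmod_ge0.
have C0 : 0 <= C.
  have := leF 0; rewrite cmod0 mulr0 oppr0 expR0 mulr1; apply: le_trans.
  exact: cmod_ge0.
rewrite RintegralZl//; have := ler_wpM2l C0 le; lra.
Qed.

Lemma wbd_ge0 k C F : wbd k C F -> 0 <= C.
Proof.
move=> [_ /(_ 0)]; rewrite cmod0 mulr0 oppr0 expR0 mulr1; apply: le_trans.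
exact: cmod_ge0.
Qed.

Lemma PiD k C C' F G z : 0 < k -> wbd k C F -> wbd k C' G ->
  Pi_proj (fun w => F w + G w) z = Pi_proj F z + Pi_proj G z.
Proof.
move=> k0 bF bG; have iF := wbd_kernM z k0 bF; have iG := wbd_kernM z k0 bG.
have bFG : wbd k (C + C') (fun w => F w + G w).
  split; first by apply: cmeasD; [exact: (proj1 bF)|exact: (proj1 bG)].
  by move=> w; rewrite (le_trans (cmodD _ _))// mulrDl lerD ?(proj2 bF) ?(proj2 bG).
rewrite (Pi_kern z k0 bF) (Pi_kern z k0 bG) (Pi_kern z k0 bFG) -cintD//.
by apply: eq_cint => p; rewrite mulrDr.
Qed.

Lemma wbdZ k C F (c : R[i]) : wbd k C F -> wbd k (cmod c * C) (fun w => c * F w).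
Proof.
move=> [mF bF]; split; first by apply: cmeasM => //; exact: cmeas_cst.
by move=> w; rewrite cmodM -mulrA ler_wpM2l ?cmod_ge0.
Qed.

Lemma PiZ k C F (c : R[i]) z : 0 < k -> wbd k C F ->
  Pi_proj (fun w => c * F w) z = c * Pi_proj F z.
Proof.
move=> k0 bF; have iF := wbd_kernM z k0 bF.
rewrite (Pi_kern z k0 bF) (Pi_kern z k0 (wbdZ c bF)) -cintZ//.
by apply: eq_cint => p; rewrite mulrCA.
Qed.

Lemma PiB k C C' F G z : 0 < k -> wbd k C F -> wbd k C' G ->
  Pi_proj (fun w => F w - G w) z = Pi_proj F z - Pi_proj G z.
Proof.
move=> k0 bF bG; rewrite -[- Pi_proj G z]mulN1r -(PiZ _ _ k0 bG) -(PiD _ k0 bF (wbdZ _ bG)).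
by congr (Pi_proj _ z); apply/funext => w; rewrite mulN1r.
Qed.

Lemma Pi0 z : Pi_proj (fun=> 0) z = 0.
Proof.
rewrite /Pi_proj; under [X in cintegral X]eq_fun do rewrite mulr0.
by rewrite [cintegral _](cint0 leb2) mulr0.
Qed.

(** A complex Gaussian integral with [c = 1], [a = conj w] and [b = z], whose value supplies the
    factor [exp (conj w * z)]. *)
Lemma kern_reproducing z w :
  cint leb2 (fun p => kern z (toC p) * kern (toC p) w) = kern z w.
Proof.
have e (p : P) : kern z (toC p) * kern (toC p) w =
    (pi^-1 ^+ 2 * expR (- (cmod z ^+ 2 / 2) - (cmod w ^+ 2 / 2)))%:C *
    gauss2c 1 (conjc w) z p.
  rewrite /kern mulrACA -realCM -cexpD -expr2 (realCM (pi^-1 ^+ 2)) -cexp_real -mulrA -cexpD.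
  by congr (_ * cexp _); apply: complex_ext; rewrite !ReImE ?cmod_sqr /=; field.
rewrite (eq_cint _ e) cintZ; last exact/gadm_cinteg/gadm_gauss2c/ltr01.
rewrite gauss2c_integral ?ltr01// mulrA -realCM /kern.
have -> : pi^-1 ^+ 2 * expR (- (cmod z ^+ 2 / 2) - cmod w ^+ 2 / 2) * (pi / 1) =
    pi^-1 * expR (- (cmod z ^+ 2 / 2) - cmod w ^+ 2 / 2) :> R.
  by move: (pi : R) (pi_gt0 R) => q q0; field; exact: lt0r_neq0.
rewrite (realCM pi^-1) -cexp_real -mulrA -cexpD; congr (_ * cexp _).
by apply: complex_ext; rewrite !ReImE ?cmod_sqr invr1 /=; ring.
Qed.

Let rint_kern z : rint leb2 (fun p => cmod (kern z (toC p))).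
Proof.
under eq_fun do rewrite cmod_kern; apply: rintZ.
have h2 : (0 : R) < 2^-1 by rewrite invr_gt0.
by have [] := gauss2 z h2.
Qed.

Let rint_wt k C : 0 < k -> rint leb2 (fun p => C * expR (- (k * cmod (toC p)))).
Proof. by move=> k0; apply: rintZ; exact: rint_exp_cmod. Qed.

Let cmod_kern_le z w : cmod (kern z w) <= pi^-1.
Proof.
rewrite cmod_kern ler_piMr ?invr_ge0 ?pi_ge0// -expR0 ler_expR oppr_le0.
by rewrite mulr_ge0// exprn_ge0// cmod_ge0.
Qed.

(** Fubini and the reproducing identity. Bounding the inner kernel by [1 / pi] separates the
    majorant. *)
Lemma Pi_idem k C F z : 0 < k -> wbd k C F -> Pi_proj (Pi_proj F) z = Pi_proj F z.
Proof.
move=> k0 bF; have [mF leF] := bF.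
rewrite (Pi_kern z k0 (Pi_bound k0 bF)) (Pi_kern z k0 bF).
transitivity (cint leb2 (fun p => cint leb2 (fun q =>
    kern z (toC p) * (kern (toC p) (toC q) * F (toC q))))).
  apply: eq_cint => p; rewrite (Pi_kern _ k0 bF) -cintZ//.
  exact: (wbd_kernM _ k0 bF).
have m : cmeas (fun x : P * P =>
    kern z (toC x.1) * (kern (toC x.1) (toC x.2) * F (toC x.2))).
  apply: cmeasM; first exact: (cmeas_comp measurable_fst (pmeas_kern z)).
  apply: cmeasM; last exact: (cmeas_comp measurable_snd mF).
  apply: cmeas_kern2; first exact: (cmeas_comp measurable_fst (measurable_toC R)).
  exact: (cmeas_comp measurable_snd (measurable_toC R)).
have C0 := wbd_ge0 bF.
rewrite (@cint_Fubini _ _ _ _ R lebS lebS _ _ _ m (rint_kern z) (rint_wt (pi^-1 * C) k0)).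
  apply: eq_cint => q.
  transitivity (cint leb2 (fun p => F (toC q) * (kern z (toC p) * kern (toC p) (toC q)))).
    by apply: eq_cint => p; ring.
  rewrite cintZ ?kern_reproducing 1?mulrC//.
  apply: (@cinteg_le _ _ _ leb2 _ _ _ _ (rintZ pi^-1 (rint_kern z))).
    apply: cmeasM; first exact: pmeas_kern.
    by apply: cmeas_kern2; [exact: measurable_toC|exact: cmeas_cst].
  by move=> p; rewrite cmodM mulrC ler_wpM2r ?cmod_ge0 ?cmod_kern_le.
move=> p q; rewrite cmodM ler_wpM2l ?cmod_ge0// cmodM -[leRHS]mulrA.
by apply: ler_pM; rewrite ?cmod_ge0.
Qed.

(** Fubini and the Hermitian symmetry of the kernel; mass conservation rests on it. *)
Lemma Pi_selfadjoint k C C' F G : 0 < k -> wbd k C F -> wbd k C' G ->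
  cint leb2 (fun p => conjc (F (toC p)) * Pi_proj G (toC p)) =
  cint leb2 (fun p => conjc (Pi_proj F (toC p)) * G (toC p)).
Proof.
move=> k0 bF bG; have [mF leF] := bF; have [mG leG] := bG.
transitivity (cint leb2 (fun p => cint leb2 (fun q =>
    conjc (F (toC p)) * (kern (toC p) (toC q) * G (toC q))))).
  apply: eq_cint => p; rewrite (Pi_kern _ k0 bG) -cintZ//.
  exact: (wbd_kernM _ k0 bG).
have m : cmeas (fun x : P * P =>
    conjc (F (toC x.1)) * (kern (toC x.1) (toC x.2) * G (toC x.2))).
  apply: cmeasM; first exact/cmeasJ/(cmeas_comp measurable_fst mF).
  apply: cmeasM; last exact: (cmeas_comp measurable_snd mG).
  apply: cmeas_kern2; first exact: (cmeas_comp measurable_fst (measurable_toC R)).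
  exact: (cmeas_comp measurable_snd (measurable_toC R)).
have C0 := wbd_ge0 bF; have C'0 := wbd_ge0 bG.
rewrite (@cint_Fubini _ _ _ _ R lebS lebS _ _ _ m (rint_wt C k0) (rint_wt (pi^-1 * C') k0)).
  apply: eq_cint => q.
  transitivity (G (toC q) * cint leb2 (fun p => conjc (kern (toC q) (toC p) * F (toC p)))).
    rewrite -cintZ; first by apply: eq_cint => p; rewrite conjM conj_kern; ring.
    have [ri ii] := wbd_kernM (toC q) k0 bF; split; first by under eq_fun do rewrite cReJ.
    under eq_fun do rewrite cImJ -mulN1r; exact: rintZ.
  rewrite mulrC; congr (_ * _); rewrite (Pi_kern _ k0 bF) /cint.
  have [ri ii] := wbd_kernM (toC q) k0 bF.
  apply: complex_ext; rewrite !ReImE.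
    by apply: eq_Rintegral => p _; rewrite cReJ.
  rewrite -[RHS]mulN1r -RintegralZl//; apply: eq_Rintegral => p _.
  by rewrite cImJ mulN1r.
move=> p q; rewrite cmodM cmodM cmod_conj; apply: ler_pM; rewrite ?mulr_ge0 ?cmod_ge0//.
by rewrite -[leRHS]mulrA; apply: ler_pM; rewrite ?cmod_ge0.
Qed.

End BargmannProjection.

(** * Time-dependent functions with Gaussian decay in time *)

Section TimeDependentFunctions.
Context (R : realType) (k : R).
Hypothesis k0 : 0 < k.
Notation leb2 := (lebC R).
Notation P := (measurableTypeR R * measurableTypeR R)%type.
Notation tfun := (R -> R[i] -> R[i]).
Implicit Types (f g : tfun) (A B C T t h : R) (z : R[i]) (n m : nat).

Definition wt z : R := expR (- (k * cmod z)).

Lemma wt_ge0 z : 0 <= wt z. Proof. exact: expR_ge0. Qed.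
Lemma wt_le1 z : wt z <= 1.
Proof. by rewrite /wt -expR0 ler_expR oppr_le0 mulr_ge0 ?cmod_ge0// ltW. Qed.

(** Decay is demanded for positive times only. The division by [4] is the rate at which two
    Gaussians of different speeds cease to overlap. *)
Definition rho A t : R := expR (- (A * (Num.max t 0) ^+ 2 / 4)).

Lemma rho_ge0 A t : 0 <= rho A t. Proof. exact: expR_ge0. Qed.
Lemma rho_le1 A t : 0 <= A -> rho A t <= 1.
Proof.
by move=> A0; rewrite /rho -expR0 ler_expR oppr_le0 divr_ge0// mulr_ge0// sqr_ge0.
Qed.
Lemma rho0 t : rho 0 t = 1. Proof. by rewrite /rho !mul0r oppr0 expR0. Qed.

(** The rate [A] belongs to the class, while [B] and [C] depend on the function. The factor
    [exp (B |t|)] makes the class stable under products and absorbs the drift of the waves. *)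
Definition Cl A f := exists B C, 0 <= B /\
  forall t, wbd k (C * expR (B * `|t|) * rho A t) (f t).

(* A uniform quadratic remainder passes through products and the projection, so
   nothing has to be differentiated under the integral sign. *)
Definition tD f g := forall T, exists C, forall t h z, `|t| <= T -> `|h| <= 1 ->
  cmod (f (t + h) z - f t z - h%:C * g t z) <= C * h ^+ 2 * wt z.

(** Derivatives are carried as witnesses rather than as [dtn], which makes the closure properties
    plain inductions; [Sm_dtn] returns to [dtn]. *)
Fixpoint Sm A n f := match n with
  | 0%N => Cl A f
  | m.+1 => Cl A f /\ exists2 g, tD f g & Sm A m g
  end.

Lemma Cl_C_ge0 A f B C : (forall t, wbd k (C * expR (B * `|t|) * rho A t) (f t)) -> 0 <= C.
Proof.
move=> /(_ 0) /wbd_ge0; rewrite normr0 mulr0 expR0 mulr1.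
by rewrite pmulr_lge0// expR_gt0.
Qed.

Lemma wbd_le C C' F : C <= C' -> wbd k C F -> wbd k C' F.
Proof.
move=> CC' [mF bF]; split=> // z; apply: le_trans (bF z) _.
by rewrite ler_wpM2r// expR_ge0.
Qed.

Lemma wbdD C C' F G : wbd k C F -> wbd k C' G -> wbd k (C + C') (fun z => F z + G z).
Proof.
move=> [mF bF] [mG bG]; split; first exact: cmeasD.
by move=> z; rewrite (le_trans (cmodD _ _))// mulrDl lerD.
Qed.

Lemma wbdM C C' F G : wbd k C F -> wbd k C' G -> wbd k (C * C') (fun z => F z * G z).
Proof.
move=> bF0 bG0; have [mF bF] := bF0; have [mG bG] := bG0; split; first exact: cmeasM.
move=> z; rewrite cmodM.
apply: (@le_trans _ _ ((C * wt z) * (C' * wt z))); first by apply: ler_pM; rewrite ?cmod_ge0.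
rewrite mulrACA ler_wpM2l ?mulr_ge0 ?(wbd_ge0 bF0) ?(wbd_ge0 bG0)//.
by rewrite -[leRHS]mulr1 ler_wpM2l ?wt_ge0 ?wt_le1.
Qed.

Lemma wbdJ C F : wbd k C F -> wbd k C (fun z => conjc (F z)).
Proof. by move=> [mF bF]; split; [exact: cmeasJ|move=> z; rewrite cmod_conj]. Qed.

Lemma Cl_local A f T : 0 <= A -> Cl A f -> exists2 C, 0 <= C & forall t, `|t| <= T -> wbd k C (f t).
Proof.
move=> A0 [B [C [B0 b]]]; have C0 := Cl_C_ge0 b.
exists (C * expR (B * `|T|)); first by rewrite mulr_ge0 ?expR_ge0.
move=> t tT; apply: wbd_le (b t).
rewrite -[leRHS]mulr1; apply: ler_pM; rewrite ?mulr_ge0 ?expR_ge0 ?rho_ge0 ?rho_le1//.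
by rewrite ler_wpM2l// ler_expR ler_wpM2l// (le_trans tT)// ler_norm.
Qed.

Lemma ClD A f g : Cl A f -> Cl A g -> Cl A (fun t z => f t z + g t z).
Proof.
move=> [B [C [B0 b]]] [B' [C' [B'0 b']]]; have C0 := Cl_C_ge0 b; have C'0 := Cl_C_ge0 b'.
exists (B + B'), (C + C'); split; first by rewrite addr_ge0.
move=> t; apply: wbd_le (wbdD (b t) (b' t)).
rewrite -mulrDl ler_wpM2r ?rho_ge0// [leRHS]mulrDl [(B + B') * _]mulrDl.
by apply: lerD; rewrite ler_wpM2l// ler_expR; [rewrite lerDl|rewrite lerDr]; rewrite mulr_ge0.
Qed.

Lemma ClZ A f (c : R[i]) : Cl A f -> Cl A (fun t z => c * f t z).
Proof.
move=> [B [C [B0 b]]]; exists B, (cmod c * C); split=> // t.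
by rewrite -!mulrA mulrA; have := wbdZ c (b t); rewrite !mulrA.
Qed.

Lemma ClM A f g : Cl A f -> Cl 0 g -> Cl A (fun t z => f t z * g t z).
Proof.
move=> [B [C [B0 b]]] [B' [C' [B'0 b']]].
exists (B + B'), (C * C'); split; first by rewrite addr_ge0.
move=> t; have := wbdM (b t) (b' t); apply: wbd_le.
by rewrite rho0 mulr1 mulrDl expRD le_eqVlt; apply/orP; left; apply/eqP; ring.
Qed.

Lemma ClJ A f : Cl A f -> Cl A (fun t z => conjc (f t z)).
Proof. by move=> [B [C [B0 b]]]; exists B, C; split=> // t; exact: wbdJ. Qed.

Lemma ClPi A f : Cl A f -> Cl A (fun t => Pi_proj (f t)).
Proof.
move=> [B [C [B0 b]]]; exists B, (Cpi k * C); split=> // t.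
by have := Pi_bound k0 (b t); rewrite !mulrA.
Qed.

Lemma Cl_weaken A f : 0 <= A -> Cl A f -> Cl 0 f.
Proof.
move=> A0 [B [C [B0 b]]]; have C0 := Cl_C_ge0 b; exists B, C; split=> // t.
apply: wbd_le (b t).
by rewrite rho0 ler_wpM2l ?rho_le1// mulr_ge0 ?expR_ge0.
Qed.

Lemma Cl0 A : Cl A (fun=> fun=> 0).
Proof.
exists 0, 0; split=> // t; split; first exact: cmeas_cst.
by move=> z; rewrite cmod0 !mul0r.
Qed.

Lemma tD_ext f f' g g' : (forall t z, f t z = f' t z) -> (forall t z, g t z = g' t z) ->
  tD f g -> tD f' g'.
Proof.
move=> ff' gg'; have -> : f' = f by apply/funext => t; apply/funext => z.
by have -> : g' = g by apply/funext => t; apply/funext => z.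
Qed.

Lemma tD_cst (F : R[i] -> R[i]) : tD (fun=> F) (fun=> fun=> 0).
Proof.
move=> T; exists 0 => t h z _ _; rewrite subrr mulr0 subr0 cmod0 !mul0r.
exact: lexx.
Qed.

Lemma tDD f f' g g' : tD f f' -> tD g g' ->
  tD (fun t z => f t z + g t z) (fun t z => f' t z + g' t z).
Proof.
move=> df dg T; have [C b] := df T; have [C' b'] := dg T; exists (C + C') => t h z tT h1.
rewrite (_ : _ - _ = (f (t + h) z - f t z - h%:C * f' t z) +
  (g (t + h) z - g t z - h%:C * g' t z)); last by ring.
by rewrite (le_trans (cmodD _ _))// !mulrDl lerD ?b ?b'.
Qed.

Lemma tDZ f f' (c : R[i]) : tD f f' -> tD (fun t z => c * f t z) (fun t z => c * f' t z).
Proof.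
move=> df T; have [C b] := df T; exists (cmod c * C) => t h z tT h1.
rewrite (_ : _ - _ = c * (f (t + h) z - f t z - h%:C * f' t z)); last by ring.
rewrite cmodM; apply: le_trans (ler_wpM2l (cmod_ge0 c) (b t h z tT h1)) _; by rewrite !mulrA.
Qed.

Lemma tDJ f f' : tD f f' -> tD (fun t z => conjc (f t z)) (fun t z => conjc (f' t z)).
Proof.
move=> df T; have [C b] := df T; exists C => t h z tT h1.
rewrite (_ : _ - _ = conjc (f (t + h) z - f t z - h%:C * f' t z)) ?cmod_conj ?b//.
by apply: complex_ext; rewrite !ReImE; ring.
Qed.

Lemma tD_lip f f' : Cl 0 f' -> tD f f' -> forall T, exists2 C, 0 <= C & forall t h z,
  `|t| <= T -> `|h| <= 1 -> cmod (f (t + h) z - f t z) <= C * `|h| * wt z.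
Proof.
move=> cf' df T; have [C b] := df T; have [C' C'0 b'] := Cl_local T (lexx 0) cf'.
exists (`|C| + C'); first by rewrite addr_ge0.
move=> t h z tT h1.
rewrite -[_ - _](subrK (h%:C * f' t z)) (le_trans (cmodD _ _))// !mulrDl lerD//.
  apply: le_trans (b t h z tT h1) _; rewrite ler_wpM2r ?wt_ge0//.
  apply: (@le_trans _ _ (`|C| * h ^+ 2)); first by rewrite ler_wpM2r ?sqr_ge0 ?ler_norm.
  by rewrite ler_wpM2l// -real_normK ?num_real// expr2 ler_piMr.
rewrite cmodM cmod_real [C' * _]mulrC -mulrA ler_wpM2l//.
exact: (proj2 (b' t tT) z).
Qed.

(** The remainder splits into that of [f] times [g (t + h)], [f] times that of [g], and [h f'] times
    an increment of [g], which is again quadratic. *)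
Lemma tDM f f' g g' : Cl 0 f -> Cl 0 g -> Cl 0 f' -> Cl 0 g' -> tD f f' -> tD g g' ->
  tD (fun t z => f t z * g t z) (fun t z => f' t z * g t z + f t z * g' t z).
Proof.
move=> cf cg cf' cg' df dg T.
have [C1 b1] := df T; have [C2 b2] := dg T.
have [C3 C30 b3] := Cl_local T (lexx 0) cf; have [C4 C40 b4] := Cl_local (T + 1) (lexx 0) cg.
have [C5 C50 b5] := Cl_local T (lexx 0) cf'; have [C6 C60 b6] := tD_lip cg' dg T.
exists (`|C1| * C4 + C3 * `|C2| + C5 * C6) => t h z tT h1.
rewrite (_ : _ - _ = (f (t + h) z - f t z - h%:C * f' t z) * g (t + h) z +
   f t z * (g (t + h) z - g t z - h%:C * g' t z) +
   h%:C * f' t z * (g (t + h) z - g t z)); last by ring.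
have w1 := wt_le1 z; have w0 := wt_ge0 z; have h20 := sqr_ge0 h.
have th : `|t + h| <= T + 1 by rewrite (le_trans (ler_normD _ _))// lerD.
have N1 : cmod (f (t + h) z - f t z - h%:C * f' t z) <= `|C1| * h ^+ 2 * wt z.
  by apply: le_trans (b1 t h z tT h1) _; rewrite ler_wpM2r// ler_wpM2r// ler_norm.
have N2 : cmod (g (t + h) z - g t z - h%:C * g' t z) <= `|C2| * h ^+ 2 * wt z.
  by apply: le_trans (b2 t h z tT h1) _; rewrite ler_wpM2r// ler_wpM2r// ler_norm.
have le1 C F s : 0 <= C -> wbd k C (F s : R[i] -> R[i]) -> cmod (F s z) <= C.
  move=> C0 [_ b]; apply: le_trans (b z) _.
  by rewrite -[leRHS]mulr1 ler_wpM2l.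
rewrite [leRHS](_ : _ = `|C1| * h ^+ 2 * wt z * C4 + C3 * (`|C2| * h ^+ 2 * wt z) +
  C5 * C6 * h ^+ 2 * wt z); last by ring.
apply: (le_trans (cmodD _ _)); apply: lerD.
  apply: (le_trans (cmodD _ _)); apply: lerD; rewrite cmodM.
    by apply: ler_pM; rewrite ?cmod_ge0//; apply: (le1 _ _ g) => //; exact: b4.
  by apply: ler_pM; rewrite ?cmod_ge0//; apply: (le1 _ _ f) => //; exact: b3.
rewrite !cmodM cmod_real -[h ^+ 2]real_normK ?num_real//.
rewrite [leRHS](_ : _ = (`|h| * C5) * (C6 * `|h| * wt z)); last by ring.
apply: ler_pM; rewrite ?mulr_ge0 ?cmod_ge0//; last exact: b6.
by rewrite ler_wpM2l//; apply: (le1 _ _ f') => //; exact: b5.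
Qed.

(** By linearity the remainder of the projected curve is the projection of the remainder, whose
    weighted bound survives by [Pi_bound]. *)
Lemma tDPi f f' : Cl 0 f -> Cl 0 f' -> tD f f' ->
  tD (fun t => Pi_proj (f t)) (fun t => Pi_proj (f' t)).
Proof.
move=> cf cf' df T; have [C b] := df T; exists (Cpi k * `|C|) => t h z tT h1.
have [C1 C10 b1] := Cl_local (T + 1) (lexx 0) cf; have [C2 C20 b2] := Cl_local T (lexx 0) cf'.
have th : `|t + h| <= T + 1 by rewrite (le_trans (ler_normD _ _))// lerD.
have t1 : `|t| <= T + 1 by rewrite (le_trans tT)// lerDl.
have B1 := b1 _ th; have B2 := b1 _ t1; have B3 := wbdZ h%:C (b2 t tT).
have B4 : wbd k (C1 + cmod (-1) * C1) (fun w => f (t + h) w - f t w).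
  have := wbdD B1 (wbdZ (-1) B2); congr (wbd _ _ _).
  by apply/funext => w; rewrite mulN1r.
rewrite -(PiZ _ _ k0 (b2 t tT)) -(PiB _ k0 B1 B2) -(PiB _ k0 B4 B3).
have B : wbd k (`|C| * h ^+ 2) (fun w => f (t + h) w - f t w - h%:C * f' t w).
  split; first by apply: cmeasB; [exact: (proj1 B4)|exact: (proj1 B3)].
  move=> w; apply: le_trans (b t h w tT h1) _.
  by rewrite ler_wpM2r ?wt_ge0// ler_wpM2r ?sqr_ge0// ler_norm.
by have [_] := Pi_bound k0 B => /(_ z); rewrite !mulrA.
Qed.

Lemma tD_is_derive f g z t : tD f g ->
  is_derive t 1 (fun s => complex.Re (f s z)) (complex.Re (g t z)) /\
  is_derive t 1 (fun s => complex.Im (f s z)) (complex.Im (g t z)).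
Proof.
move=> df; have [C b] := df `|t|.
split; apply: (@quad_is_derive _ _ _ _ (C * wt z)) => h h1.
  rewrite mulrAC; apply: le_trans (b t h z (lexx _) h1).
  by apply: le_trans (le_Re_cmod _); rewrite !ReImE mul0r subr0.
rewrite mulrAC; apply: le_trans (b t h z (lexx _) h1).
by apply: le_trans (le_Im_cmod _); rewrite !ReImE mul0r addr0.
Qed.

Lemma tD_cder f g z : tD f g -> cder (fun t => f t z) (fun t => g t z).
Proof. by move=> df t; exact: tD_is_derive. Qed.

Lemma Sm_Cl A n f : Sm A n f -> Cl A f.
Proof. by case: n => [//|n []]. Qed.

Lemma Sm_pred A n f : Sm A n.+1 f -> Sm A n f.
Proof.
elim: n f => [|n IH] f; first by case.
by move=> [cf [g dg sg]]; split=> //; exists g => //; exact: IH.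
Qed.

Lemma SmD A n f g : Sm A n f -> Sm A n g -> Sm A n (fun t z => f t z + g t z).
Proof.
elim: n f g => [|n IH] f g /=; first exact: ClD.
move=> [cf [f' df sf]] [cg [g' dg sg]]; split; first exact: ClD.
by exists (fun t z => f' t z + g' t z); [exact: tDD|exact: IH].
Qed.

Lemma SmZ A n f (c : R[i]) : Sm A n f -> Sm A n (fun t z => c * f t z).
Proof.
elim: n f => [|n IH] f /=; first exact: ClZ.
move=> [cf [f' df sf]]; split; first exact: ClZ.
by exists (fun t z => c * f' t z); [exact: tDZ|exact: IH].
Qed.

Lemma SmJ A n f : Sm A n f -> Sm A n (fun t z => conjc (f t z)).
Proof.
elim: n f => [|n IH] f /=; first exact: ClJ.
move=> [cf [f' df sf]]; split; first exact: ClJ.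
by exists (fun t z => conjc (f' t z)); [exact: tDJ|exact: IH].
Qed.

Lemma Sm_weaken A n f : 0 <= A -> Sm A n f -> Sm 0 n f.
Proof.
move=> A0; elim: n f => [|n IH] f /=; first exact: Cl_weaken.
move=> [cf [f' df sf]]; split; first exact: Cl_weaken cf.
by exists f' => //; exact: IH.
Qed.

(** Decay of one factor suffices; the other may be a wave, which does not decay. *)
Lemma SmM A n f g : 0 <= A -> Sm A n f -> Sm 0 n g -> Sm A n (fun t z => f t z * g t z).
Proof.
move=> A0; elim: n f g => [|n IH] f g /=; first exact: ClM.
move=> [cf [f' df sf]] [cg [g' dg sg]]; split; first exact: ClM.
exists (fun t z => f' t z * g t z + f t z * g' t z).
  apply: tDM => //; try exact: Cl_weaken cf.
  - exact: Cl_weaken (Sm_Cl sf).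
  - exact: Sm_Cl sg.
apply: SmD; apply: IH => //.
  by apply: Sm_pred; split=> //; exists g'.
by apply: Sm_pred; split=> //; exists f'.
Qed.

Lemma SmPi A n f : 0 <= A -> Sm A n f -> Sm A n (fun t => Pi_proj (f t)).
Proof.
move=> A0; elim: n f => [|n IH] f /=; first exact: ClPi.
move=> [cf [f' df sf]]; split; first exact: ClPi.
exists (fun t => Pi_proj (f' t)); last exact: IH.
by apply: tDPi => //; [exact: Cl_weaken cf|exact: Cl_weaken (Sm_Cl sf)].
Qed.

Lemma Sm0 A n : Sm A n (fun=> fun=> 0).
Proof.
elim: n => [|n IH] /=; first exact: Cl0.
by split; [exact: Cl0|exists (fun=> fun=> 0) => //; exact: tD_cst].
Qed.

Lemma Sm_ext A n f g : (forall t z, f t z = g t z) -> Sm A n f -> Sm A n g.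
Proof. by move=> fg; have -> : g = f by apply/funext => t; apply/funext => z. Qed.

Lemma Sm_sum A n (I : Type) (s : seq I) (f : I -> tfun) : (forall i, Sm A n (f i)) ->
  Sm A n (fun t z => \sum_(i <- s) f i t z).
Proof.
move=> sf; elim: s => [|a s IH].
  by apply: Sm_ext (Sm0 A n) => t z; rewrite big_nil.
by apply: Sm_ext (SmD (sf a) IH) => t z; rewrite big_cons.
Qed.

Lemma dtnS f g m : tD f g -> dtn m.+1 f = dtn m g.
Proof.
move=> df; apply/funext => t; apply/funext => z; rewrite /dtn !derive1Sn.
have -> : derive1 (fun s => complex.Re (f s z)) = fun s => complex.Re (g s z).
  apply/funext => s; have [h _] := tD_is_derive z s df.
  by rewrite derive1E; exact: derive_val.
have -> // : derive1 (fun s => complex.Im (f s z)) = fun s => complex.Im (g s z).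
apply/funext => s; have [_ h] := tD_is_derive z s df.
by rewrite derive1E; exact: derive_val.
Qed.

Lemma dtn0 f : dtn 0 f = f.
Proof. by apply/funext => t; apply/funext => z; rewrite /dtn !derive1n0; apply: complex_ext. Qed.

Lemma Sm_dtn A n f m : Sm A n f -> (m < n)%N ->
  Cl A (dtn m f) /\ tD (dtn m f) (dtn m.+1 f).
Proof.
elim: m n f => [|m IH] [//|n] f [cf [g dg sg]] mn.
  by rewrite (dtnS _ dg) !dtn0.
by rewrite !(dtnS _ dg); exact: IH sg mn.
Qed.

Definition Fock f := forall t z, Pi_proj (f t) z = f t z.

(** The projection commutes with time derivatives, and derivatives are unique. *)
Lemma tD_Fock f g : Cl 0 f -> Cl 0 g -> Fock f -> tD f g -> Fock g.
Proof.
move=> cf cg Ff dfg t z; have d := tDPi cf cg dfg.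
have d' : tD f (fun t => Pi_proj (g t)) by apply: tD_ext d.
by have := cder_unique (tD_cder z d') (tD_cder z dfg) t.
Qed.

Lemma Fock_dtn f m : (forall n, Sm 0 n f) -> Fock f -> Fock (dtn m f).
Proof.
move=> sf Ff; elim: m => [|m IH]; first by rewrite dtn0.
have [c1 d] := Sm_dtn (sf m.+1) (ltnSn m); have [c2 _] := Sm_dtn (sf m.+2) (ltnSn m.+1).
exact: tD_Fock c1 c2 IH d.
Qed.

End TimeDependentFunctions.

(** * Entire representatives, square integrability and smooth curves in the weighted Fock space *)

Section FockSpaceMembership.
Context (R : realType).
Notation leb2 := (lebC R).
Notation P := (measurableTypeR R * measurableTypeR R)%type.
Implicit Types (F : R[i] -> R[i]) (z : R[i]) (k C delta : R).

(** The [L^2] norm of [exp (- delta |z|)]. *)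
Definition cL2 delta : R := Num.sqrt (\int[leb2]_p expR (- (2 * delta * cmod (toC p)))).

Lemma L2norm_le delta C F : 0 < delta -> wbd delta C F ->
  (L2norm F <= (C * cL2 delta)%:E)%E.
Proof.
move=> d0 bF; have C0 := wbd_ge0 bF; have [mF leF] := bF.
have d20 : 0 < 2 * delta by rewrite mulr_gt0.
have ie := rint_exp_cmod d20.
rewrite /L2norm unlock /=.
under eq_integral do rewrite powR_mulrn ?normr_ge0//.
have leI : (\int[leb2]_p (`|cmod (F (toC p))| ^+ 2)%:E <=
    (C ^+ 2 * \int[leb2]_p expR (- (2 * delta * cmod (toC p))))%:E)%E.
  rewrite EFinM /Rintegral fineK; last exact: integrable_fin_num ie.
  have me : measurable_fun setT (fun p : P => expR (- (2 * delta * cmod (toC p)))).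
    exact: rint_measurable ie.
  rewrite -ge0_integralZl_EFin ?sqr_ge0//; last exact/measurable_EFinP.
  apply: ge0_le_integral => //.
  - apply/measurable_EFinP; apply: measurable_funX; apply: measurableT_comp => //.
    exact: measurable_cmod.
  - by apply/measurable_EFinP; apply: measurable_funM.
  move=> p _; rewrite -EFinM lee_fin ger0_norm ?cmod_ge0//.
  have -> : expR (- (2 * delta * cmod (toC p))) = expR (- (delta * cmod (toC p))) ^+ 2.
    by rewrite expr2 -expRD; congr expR; ring.
  rewrite -exprMn ler_sqr ?nnegrE ?cmod_ge0//.
  by rewrite mulr_ge0// expR_ge0.
have Iin : (\int[leb2]_p (`|cmod (F (toC p))| ^+ 2)%:E)%E \in `[0%E, +oo%E].
  by rewrite in_itv /= leey andbT; apply: integral_ge0 => p _; rewrite lee_fin sqr_ge0.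
have Jin : (C ^+ 2 * \int[leb2]_p expR (- (2 * delta * cmod (toC p))))%:E \in `[0%E, +oo%E].
  rewrite in_itv /= leey andbT lee_fin mulr_ge0 ?sqr_ge0//.
  by apply: Rintegral_ge0 => p _; exact: expR_ge0.
have r2 : 0 <= 2^-1 :> R by rewrite invr_ge0.
apply: (le_trans (gt0_ler_poweR r2 Iin Jin leI)).
rewrite poweR_EFin lee_fin powR12_sqrt; last first.
  by rewrite mulr_ge0 ?sqr_ge0//; apply: Rintegral_ge0 => p _; exact: expR_ge0.
by rewrite sqrtrM ?sqr_ge0// sqrtr_sqr ger0_norm.
Qed.

Lemma wbd_isL2 delta C F : 0 < delta -> wbd delta C F -> isL2 F.
Proof.
move=> d0 bF; have [[mr mi] _] := bF; split=> //.
by apply: le_lt_trans (L2norm_le d0 bF) _; rewrite ltry.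
Qed.

Lemma wbd_expweight k kappa C F : wbd k C F -> wbd (k - kappa) C (expweight kappa F).
Proof.
move=> bF; have C0 := wbd_ge0 bF; have [mF leF] := bF; split.
  apply: cmeasM => //; apply: cmeas_real; apply: measurableT_comp => //.
  by apply: measurable_funM => //; exact/measurable_cmod/measurable_toC.
move=> z; rewrite cmodM cmod_real ger0_norm ?expR_ge0//.
apply: le_trans (ler_wpM2l (expR_ge0 _) (leF z)) _.
rewrite mulrCA -expRD ler_wpM2l// ler_expR; lra.
Qed.

Lemma Xnorm_le k kappa C F : kappa < k -> wbd k C F ->
  (Xnorm kappa F <= (C * cL2 (k - kappa))%:E)%E.
Proof.
move=> kk bF; apply: L2norm_le; first by rewrite subr_gt0.
exact: wbd_expweight.
Qed.

Lemma entire_of_quad (f f' : R[i] -> R[i]) :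
  (forall z, exists C, forall h, cmod h <= 1 ->
     cmod (f (z + h) - f z - h * f' z) <= C * cmod h ^+ 2) -> entire f.
Proof.
move=> H z; have [C HC] := H z.
have C0 : 0 <= C.
  have := HC 1; rewrite cmod1 lexx expr1n mulr1 => /(_ isT).
  exact: le_trans (cmod_ge0 _).
apply/cvg_ex; exists (f' z).
apply/cvgrPdist_le => e e0.
have [e' e'0 eE] : exists2 e', 0 < e' & e = e'%:C.
  exists (complex.Re e); last by rewrite RRe_real// gtr0_real.
  by move: e0; rewrite ltcE /= => /andP[_].
near=> h.
have h0 : h != 0 by near: h; exact: nbhs_dnbhs_neq.
have h1 : `|h| <= (Num.min 1 (e' / (C + 1)))%:C.
  near: h; apply: dnbhs0_le; rewrite ltcR.
  by rewrite lt_min ltr01 divr_gt0// ltr_wpDl.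
move: h1; rewrite norm_cmod lecR le_min => /andP[ha hb].
have h0' : cmod h != 0 by apply: contra_neq h0 => /cmod_eq0.
have hp : 0 < cmod h by rewrite lt_neqAle eq_sym h0' cmod_ge0.
rewrite eE norm_cmod lecR.
have -> : f' z - h^-1 *: (f (h *: 1 + z) - f z) =
  - (h^-1 * (f (z + h) - f z - h * f' z)).
  have E : h^-1 * (h * f' z) = f' z by rewrite mulrA mulVf ?mul1r.
  have -> : h *: (1 : R[i]^o) + z = z + h by rewrite addrC; congr (_ + _); exact: mulr1.
  rewrite [RHS](_ : _ = h^-1 * (h * f' z) - h^-1 * (f (z + h) - f z)); last by ring.
  by rewrite E.
rewrite cmodN; rewrite -(@ler_pM2l _ (cmod h))// -cmodM mulrA mulfV// mul1r.
apply: le_trans (HC h ha) _; rewrite expr2 mulrA mulrC ler_wpM2l ?cmod_ge0//.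
rewrite ler_pdivlMr ?ltr_wpDl// in hb.
by apply: le_trans hb; rewrite mulrC ler_wpM2l ?cmod_ge0// lerDl.
Unshelve. all: by end_near. Qed.

(** Since [F] equals its projection, its holomorphic factor is an integral of the exponentials
    [cexp (z * conj w)], complex differentiable by [exp_family_quad]. *)
Lemma Fock_entire k C F : 0 < k -> wbd k C F -> (forall z, Pi_proj F z = F z) ->
  exists2 f : R[i] -> R[i], entire f &
    forall z, F z = (expR (- (cmod z ^+ 2 / 2)))%:C * f z.
Proof.
move=> k0 bF FF; have [mF leF] := bF; have C0 := wbd_ge0 bF.
pose g (p : P) := cexp (- (cmod (toC p) ^+ 2 / 2)%:C) * F (toC p).
pose om (p : P) := conjc (toC p).
have mg : cmeas g.
  apply: cmeasM => //; apply: cmeas_cexp; apply: cmeasN; apply: cmeas_real.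
  by apply: measurable_funM => //; apply: measurable_funX; exact/measurable_cmod/measurable_toC.
have mo : cmeas om by exact/cmeasJ/measurable_toC.
have lo p : cmod (om p) <= cmod (toC p) by rewrite cmod_conj.
have h2 : (0 : R) < 2^-1 by rewrite invr_gt0.
have h4 : (0 : R) < 2^-1 / 2 by rewrite divr_gt0.
have [i4 _] := gauss2 0 h4.
have ig M : rint leb2 (fun p => cmod (g p) * expR (M * cmod (toC p))).
  apply: (@rint_le _ _ _ leb2 _ _ _ _ (rintZ (C * expR (M ^+ 2 / (2 * 2^-1))) i4)).
    apply: measurable_funM; first exact: measurable_cmod.
    apply: measurableT_comp => //; apply: measurable_funM => //.
    exact/measurable_cmod/measurable_toC.
  move=> p; rewrite subr0 ger0_norm ?mulr_ge0 ?cmod_ge0 ?expR_ge0//.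
  rewrite -mulrA; apply: le_trans (ler_wpM2l C0 (gauss_bound M h2 (cmod (toC p)))).
  rewrite expRD [expR _ * expR (- _)]mulrC mulrA ler_wpM2r ?expR_ge0//.
  rewrite cmodM mulrC; apply: ler_pM; rewrite ?cmod_ge0//.
    apply: le_trans (leF _) _; rewrite -[leRHS]mulr1 ler_wpM2l//.
    by rewrite -expR0 ler_expR oppr_le0 mulr_ge0 ?cmod_ge0// ltW.
  by rewrite cmod_cexp ler_expR !ReImE; lra.
exists (fun z => (pi^-1)%:C * cint leb2 (fun p => g p * cexp (z * om p))).
  apply: (@entire_of_quad _ (fun z => (pi^-1)%:C * cint leb2 (fun p => om p * g p * cexp (z * om p)))).
  move=> z; eexists => h h1.
  rewrite mulrCA -!mulrBr cmodM.
  apply: le_trans (ler_wpM2l (cmod_ge0 _) (exp_family_quad mg mo lo ig z h1)) _.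
  rewrite [leLHS]mulrA; exact: lexx.
move=> z; rewrite -FF /Pi_proj mulrA [_%:C * (pi^-1)%:C]mulrC -realCM; congr (_ * _).
apply: eq_cint => p; rewrite /g /om [RHS]mulrAC -cexpD; congr (cexp _ * _).
by rewrite addrC [z * _]mulrC.
Qed.

Lemma inX_of_wbd k kappa C F : 0 < kappa -> kappa < k -> wbd k C F ->
  (forall z, Pi_proj F z = F z) -> inX kappa F.
Proof.
move=> kp kk bF FF; have k0 := lt_trans kp kk; split.
  by split; [exact: Fock_entire bF FF|exact: wbd_isL2 bF].
by apply: (@wbd_isL2 (k - kappa) C); [rewrite subr_gt0|exact: wbd_expweight].
Qed.

(** A quadratic remainder in the weight [k] makes the error of the difference quotient [O(h)] in the
    norm of weight [kappa < k]. *)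
Lemma Sm_smooth_in_X k kappa (w : R -> R[i] -> R[i]) : 0 < kappa -> kappa < k ->
  (forall n, Sm k 0 n w) -> Fock w -> smooth_in_X kappa w.
Proof.
move=> kp kk sw fw m t; have k0 := lt_trans kp kk.
have [cm dm] := Sm_dtn (sw m.+1) (ltnSn m); have [cm1 _] := Sm_dtn (sw m.+2) (ltnSn m.+1).
have [C1 C10 b1] := Cl_local (`|t| + 1) (lexx 0) cm.
have [C2 C20 b2] := Cl_local (`|t| + 1) (lexx 0) cm1.
have t1 : `|t| <= `|t| + 1 by rewrite lerDl.
have th h : `|h| <= 1 -> `|t + h| <= `|t| + 1.
  by move=> h1; rewrite (le_trans (ler_normD _ _))// lerD.
split; first by apply: (inX_of_wbd kp kk (b1 t t1)) => z; exact: (Fock_dtn k0).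
have [C bC] := dm `|t|.
apply: (@squeeze_cvge _ _ _ _ (fun=> 0%E) _ (fun h : R => (`|C| * `|h| * cL2 (k - kappa))%:E)).
- near=> h; rewrite Lnorm_ge0 /=; apply: Xnorm_le kk _.
  have h0 : h != 0 by near: h; exact: nbhs_dnbhs_neq.
  have h1 : `|h| <= 1 by near: h; exact: dnbhs0_le.
  split.
    apply: cmeasB; last exact: (proj1 (b2 _ t1)).
    apply: cmeasM; first exact: cmeas_cst.
    by apply: cmeasB; [exact: (proj1 (b1 _ (th _ h1)))|exact: (proj1 (b1 _ t1))].
  move=> z.
  rewrite (_ : _ - _ = (h^-1)%:C * (dtn m w (t + h) z - dtn m w t z - h%:C * dtn m.+1 w t z)); last first.
    by rewrite [RHS]mulrBr mulrA -realCM mulVf// mul1r.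
  rewrite cmodM cmod_real normfV ler_pdivrMl ?normr_gt0//.
  apply: le_trans (bC t h z (lexx _) h1) _.
  rewrite [leRHS](_ : _ = `|C| * h ^+ 2 * wt k z); last first.
    by rewrite -[h ^+ 2]real_normK ?num_real// /wt; ring.
  by rewrite ler_wpM2r ?wt_ge0// ler_wpM2r ?sqr_ge0// ler_norm.
- exact: cvg_cst.
- have lim : `|C| * `|h| * cL2 (k - kappa) @[h --> (0 : R)^'] --> (0 : R).
    have E0 : (0 : R) = `|C| * `|0 : R| * cL2 (k - kappa) by rewrite normr0 mulr0 mul0r.
    rewrite [X in _ --> X]E0; apply: cvgM; last exact: cvg_cst.
    apply: cvgM; first exact: cvg_cst.
    by apply: cvg_within_filter; exact: norm_continuous.
  by apply/fine_cvgP; split; [near=> h|exact: lim].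
Unshelve. all: by end_near. Qed.

End FockSpaceMembership.

(** * Travelling waves and solitons *)

Section Waves.
Context (R : realType) (alpha gamma : R[i]) (lam : R).
Notation tfun := (R -> R[i] -> R[i]).
Notation P := (measurableTypeR R * measurableTypeR R)%type.
Implicit Types (f g : tfun) (t : R) (z : R[i]).

(** The phase in [travelling_wave] cancels the [conj z] term of [|z + alpha t|^2 / 2], so what
    remains is a holomorphic exponential times [exp (- |z|^2 / 2)]: a magnetic translation, which
    stays in the Fock space. *)
Definition wave_exp t z : R[i] := cexp (gamma * (z + alpha * t%:C) -
  z * conjc alpha * t%:C - (cmod alpha ^+ 2 / 2 * t ^+ 2)%:C - iC R * (lam * t)%:C -
  (cmod z ^+ 2 / 2)%:C).

(** Polynomials in [t] and [z] times one exponential. The class is stable under time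
    differentiation, so one induction bounds every derivative of a soliton. *)
Inductive wave : tfun -> Prop :=
| wave_base : wave wave_exp
| waveZ c f : wave f -> wave (fun t z => c * f t z)
| wave_t f : wave f -> wave (fun t z => t%:C * f t z)
| wave_z f : wave f -> wave (fun t z => z * f t z)
| waveD f g : wave f -> wave g -> wave (fun t z => f t z + g t z).

Lemma wave_ext f g : (forall t z, f t z = g t z) -> wave f -> wave g.
Proof. by move=> fg; have -> : g = f by apply/funext => t; apply/funext => z. Qed.

Lemma cmod_wave_exp t z : cmod (wave_exp t z) =
  expR (complex.Re (gamma * (z + alpha * t%:C)) - cmod (z + alpha * t%:C) ^+ 2 / 2).
Proof.
by rewrite cmod_cexp; congr expR; rewrite !cmod_sqr !ReImE; field.
Qed.

Lemma wave_exp_cder z : cder (fun t => wave_exp t z)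
  (fun t => (gamma * alpha - z * conjc alpha - iC R * lam%:C) * wave_exp t z +
     - (cmod alpha ^+ 2)%:C * (t%:C * wave_exp t z)).
Proof.
pose a0 := gamma * z - (cmod z ^+ 2 / 2)%:C.
pose a1 := gamma * alpha - z * conjc alpha - iC R * lam%:C.
pose a2 := - (cmod alpha ^+ 2 / 2)%:C : R[i].
have E t : wave_exp t z = cexp (a0 + (a1 * t%:C + a2 * (t%:C * t%:C))).
  by rewrite /wave_exp; congr cexp; apply: complex_ext; rewrite !ReImE; ring.
have -> : (fun t => wave_exp t z) = fun t => cexp (a0 + (a1 * t%:C + a2 * (t%:C * t%:C))).
  by apply/funext => t; exact: E.
apply: cder_eq.
  apply: cder_cexp; apply: cderD; first exact: cder_cst.
  apply: cderD; first exact/cderZ/cder_id.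
  by apply: cderZ; apply: cderM; exact: cder_id.
move=> t /=; rewrite [RHS](_ : _ = (gamma * alpha - z * conjc alpha - iC R * lam%:C -
  (cmod alpha ^+ 2)%:C * t%:C) * wave_exp t z); last by ring.
rewrite E; congr (_ * _).
by rewrite /a1 /a2; apply: complex_ext; rewrite !ReImE; field.
Qed.

Lemma wave_der f : wave f -> exists2 g, wave g & forall z, cder (fun t => f t z) (fun t => g t z).
Proof.
elim=> [|c f0 _ [g wg dg]|f0 wf [g wg dg]|f0 _ [g wg dg]|f0 g0 _ [g1 w1 d1] _ [g2 w2 d2]].
- exists (fun t z => (gamma * alpha - z * conjc alpha - iC R * lam%:C) * wave_exp t z +
     - (cmod alpha ^+ 2)%:C * (t%:C * wave_exp t z)); last exact: wave_exp_cder.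
  apply: waveD; last by apply: waveZ; apply: wave_t; exact: wave_base.
  apply: (@wave_ext (fun t z => (gamma * alpha - iC R * lam%:C) * wave_exp t z +
     - conjc alpha * (z * wave_exp t z))); first by move=> t z; ring.
  apply: waveD; first by apply: waveZ; exact: wave_base.
  by apply: waveZ; apply: wave_z; exact: wave_base.
- by exists (fun t z => c * g t z); [exact: waveZ|move=> z; exact: cderZ].
- exists (fun t z => f0 t z + t%:C * g t z); first by apply: waveD => //; exact: wave_t.
  move=> z; apply: cder_eq; first exact: cderM (@cder_id R) (dg z).
  by move=> t /=; rewrite mul1r.
- by exists (fun t z => z * g t z); [exact: wave_z|move=> z; exact: cderZ].
- by exists (fun t z => g1 t z + g2 t z); [exact: waveD|move=> z; exact: cderD].
Qed.

Lemma wave_meas f t : wave f -> pmeas (f t).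
Proof.
have mt := measurable_toC R.
have mc (c : R[i]) : cmeas ((fun=> c) : P -> R[i]) by exact: cmeas_cst.
elim=> [|c f0 _ m|f0 _ m|f0 _ m|f0 g0 _ m1 _ m2].
- apply: cmeas_cexp; do ! (first [apply: cmeasB|apply: cmeasD|apply: cmeasM]) => //; try exact: mc.
  apply: cmeas_real; apply: measurable_funM => //; apply: measurable_funX.
  exact: measurable_cmod.
- exact: cmeasM.
- exact: cmeasM.
- exact: cmeasM.
- exact: cmeasD.
Qed.

Let X t z := cmod (z + alpha * t%:C).

Let X_ge t z : cmod z <= X t z + cmod alpha * `|t|.
Proof. by rewrite -(cmod_real t) -cmodM -{1}(addrK (alpha * t%:C) z) cmodB. Qed.

(** Each factor [t] or [z] costs one more exponential of [|t| + |z + alpha t|], hence [B + 1]; the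
    Gaussian stays centred at [- alpha t]. *)
Lemma wave_bound f : wave f -> exists B C, [/\ 0 <= B, 0 <= C & forall t z,
  cmod (f t z) <= C * expR (B * (`|t| + cmod (z + alpha * t%:C))) *
                  expR (- (2^-1 * cmod (z + alpha * t%:C) ^+ 2))].
Proof.
have nn t z : 0 <= `|t| + X t z by rewrite addr_ge0 ?cmod_ge0.
elim=> [|c f0 _ [B [C [B0 C0 b]]]|f0 _ [B [C [B0 C0 b]]]|f0 _ [B [C [B0 C0 b]]]|
  f0 g0 _ [B [C [B0 C0 b]]] _ [B' [C' [B'0 C'0 b']]]].
- exists (cmod gamma), 1; split=> //; first exact: cmod_ge0.
  move=> t z; rewrite mul1r cmod_wave_exp -expRD ler_expR [_ / 2]mulrC lerD2r.
  rewrite (le_trans (ler_norm _))// (le_trans (le_Re_cmod _))// cmodM.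
  by rewrite ler_wpM2l ?cmod_ge0// lerDr.
- exists B, (cmod c * C); split=> //; first by rewrite mulr_ge0 ?cmod_ge0.
  by move=> t z; rewrite cmodM -!mulrA ler_wpM2l ?cmod_ge0// mulrA.
- exists (B + 1), C; split=> //; first by rewrite addr_ge0.
  move=> t z; rewrite cmodM cmod_real [(B + 1) * _]mulrDl mul1r expRD.
  rewrite [leRHS](_ : _ = expR (`|t| + X t z) * (C * expR (B * (`|t| + X t z)) *
     expR (- (2^-1 * X t z ^+ 2)))); last by rewrite /X; ring.
  apply: ler_pM => //; first exact: cmod_ge0.
  by apply: le_trans (le_exp _) _; rewrite ler_expR lerDl cmod_ge0.
- exists (B + 1), ((1 + cmod alpha) * C); split; first by rewrite addr_ge0.
    by rewrite mulr_ge0// addr_ge0 ?cmod_ge0.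
  move=> t z; rewrite cmodM [(B + 1) * _]mulrDl mul1r expRD.
  rewrite [leRHS](_ : _ = ((1 + cmod alpha) * expR (`|t| + X t z)) *
    (C * expR (B * (`|t| + X t z)) * expR (- (2^-1 * X t z ^+ 2)))); last by rewrite /X; ring.
  apply: ler_pM; rewrite ?cmod_ge0//.
  apply: (@le_trans _ _ ((1 + cmod alpha) * (`|t| + X t z))).
    apply: le_trans (X_ge t z) _; rewrite mulrDl mul1r mulrDr.
    have := mulr_ge0 (cmod_ge0 alpha) (cmod_ge0 (z + alpha * t%:C)).
    by have := normr_ge0 t; rewrite /X; lra.
  by rewrite ler_wpM2l ?le_exp// addr_ge0 ?cmod_ge0.
- exists (B + B'), (C + C'); split; rewrite ?addr_ge0//.
  move=> t z; apply: (le_trans (cmodD _ _)); rewrite mulrDl mulrDl.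
  apply: lerD; [apply: le_trans (b t z) _|apply: le_trans (b' t z) _];
    rewrite ler_wpM2r ?expR_ge0// ler_wpM2l// ler_expR ler_wpM2r ?nn//.
    by rewrite lerDl.
  by rewrite lerDr.
Qed.

Variable k : R.
Hypothesis k0 : 0 < k.

(** Moving the centre of the weight from [- alpha t] to [0] costs [exp (k |alpha| |t|)]. *)
Lemma wave_Cl f : wave f -> Cl k 0 f.
Proof.
move=> wf; have [B [C [B0 C0 b]]] := wave_bound wf.
exists (B + k * cmod alpha), (C * expR ((B + k) ^+ 2)); split.
  by rewrite addr_ge0// mulr_ge0 ?cmod_ge0// ltW.
move=> t; split; first exact: wave_meas.
move=> z; apply: le_trans (b t z) _; rewrite rho0 mulr1 -!mulrA ler_wpM2l// -!expRD ler_expR.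
have := sqr_ge0 (B + k - X t z); have := ler_wpM2l (ltW k0) (X_ge t z).
rewrite -/(X t z); move: (X t z) (cmod alpha) (cmod z) `|t| => x a y s h1 h2.
nra.
Qed.

Lemma wave_tD f : wave f -> exists2 g, wave g & tD k f g.
Proof.
move=> wf; have [g wg dg] := wave_der wf; have [g2 wg2 dg2] := wave_der wg.
exists g => // T; have [C C0 bC] := Cl_local (T + 1) (lexx 0) (wave_Cl wg2).
exists (2 * C) => t h z tT h1.
have := @taylor2 _ _ _ _ t h (C * wt k z) (dg z) (dg2 z).
rewrite (_ : 2 * (C * wt k z) * h ^+ 2 = 2 * C * h ^+ 2 * wt k z); last by ring.
apply => s st; apply: (proj2 (bC s _)).
have := ler_normD (s - t) t; rewrite subrK; lra.
Qed.

Lemma wave_Sm f n : wave f -> Sm k 0 n f.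
Proof.
elim: n f => [|n IH] f wf /=; first exact: wave_Cl.
by split; [exact: wave_Cl|have [g wg dg] := wave_tD wf; exists g => //; exact: IH].
Qed.

End Waves.

Section WaveInteraction.
Context (R : realType) (alpha alpha' gamma gamma' : R[i]) (lam lam' k A : R).
Hypotheses (k0 : 0 < k) (A0 : 0 <= A) (sepA : A <= cmod (alpha - alpha') ^+ 2).
Notation tfun := (R -> R[i] -> R[i]).
Implicit Types (f g : tfun) (t : R) (z : R[i]).

(* By the parallelogram identity the two Gaussian exponents add up to
   [|alpha - alpha'|^2 t^2 / 4 + |2 z + (alpha + alpha') t|^2 / 4]. *)
Lemma interaction_Cl f g : wave alpha gamma lam f -> wave alpha' gamma' lam' g ->
  Cl k A (fun t z => f t z * conjc (g t z)).
Proof.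
move=> wf wg; have [B [C [B0 C0 b]]] := wave_bound wf; have [B' [C' [B'0 C'0 b']]] := wave_bound wg.
pose M := B + B' + k; pose D := cmod (alpha - alpha').
have M0 : 0 <= M by rewrite !addr_ge0// ltW.
have D0 : 0 <= D by exact: cmod_ge0.
exists (B + B' + M * D + k * cmod alpha), (C * C' * expR (M ^+ 2)); split.
  by rewrite !addr_ge0// mulr_ge0 ?cmod_ge0// ltW.
move=> t; split.
  by apply: cmeasM; [exact: (wave_meas t wf)|exact/cmeasJ/(wave_meas t wg)].
move=> z; rewrite cmodM cmod_conj.
apply: le_trans (ler_pM (cmod_ge0 _) (cmod_ge0 _) (b t z) (b' t z)) _.
set X := cmod (z + alpha * t%:C); set Y := cmod (z + alpha' * t%:C).
set S := cmod (z + alpha * t%:C + (z + alpha' * t%:C)).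
rewrite [leLHS](_ : _ = C * C' * (expR (B * (`|t| + X)) * expR (- (2^-1 * X ^+ 2)) *
  (expR (B' * (`|t| + Y)) * expR (- (2^-1 * Y ^+ 2))))); last by ring.
rewrite -!mulrA mulrA [leRHS]mulrA ler_wpM2l ?mulr_ge0// /rho -!expRD ler_expR.
have X0 : 0 <= X by exact: cmod_ge0.
have Y0 : 0 <= Y by exact: cmod_ge0.
have par : X ^+ 2 + Y ^+ 2 = (D ^+ 2 * t ^+ 2 + S ^+ 2) / 2.
  by rewrite /X /Y /D /S !cmod_sqr !ReImE; field.
have dt : cmod (z + alpha * t%:C - (z + alpha' * t%:C)) = D * `|t|.
  by rewrite /D -(cmod_real t) -cmodM; congr cmod; ring.
have hX : 2 * X <= S + D * `|t|.
  have := cmodD (z + alpha * t%:C + (z + alpha' * t%:C)) (z + alpha * t%:C - (z + alpha' * t%:C)).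
  rewrite dt -/S; apply: le_trans.
  rewrite [X in cmod X](_ : _ = 2%:C * (z + alpha * t%:C)); last first.
    by apply: complex_ext; rewrite !ReImE; ring.
  by rewrite cmodM cmod_real ger0_norm.
have hY : 2 * Y <= S + D * `|t|.
  have := cmodB (z + alpha * t%:C + (z + alpha' * t%:C)) (z + alpha * t%:C - (z + alpha' * t%:C)).
  rewrite dt -/S; apply: le_trans.
  rewrite [X in cmod X](_ : _ = 2%:C * (z + alpha' * t%:C)); last first.
    by apply: complex_ext; rewrite !ReImE; ring.
  by rewrite cmodM cmod_real ger0_norm.
have hz : cmod z <= X + cmod alpha * `|t|.
  by rewrite -(cmod_real t) -cmodM -{1}(addrK (alpha * t%:C) z) cmodB.
have hA : A * Num.max t 0 ^+ 2 <= D ^+ 2 * t ^+ 2.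
  apply: (@le_trans _ _ (A * t ^+ 2)); last by rewrite ler_wpM2r ?sqr_ge0.
  rewrite ler_wpM2l//; case: (leP t 0) => _ //; by rewrite expr0n sqr_ge0.
have hkz := ler_wpM2l (ltW k0) hz.
have hMX := ler_wpM2l M0 hX; have hMY := ler_wpM2l M0 hY.
have hS := sqr_ge0 (M - S / 2).
have hBX : B * X + B' * Y + k * X <= M * X + M * Y.
  have := mulr_ge0 B0 Y0; have := mulr_ge0 B'0 X0; have := mulr_ge0 (ltW k0) Y0.
  by rewrite /M; lra.
move: hA hkz hMX hMY hS hBX par; rewrite /M.
move: (Num.max t 0 ^+ 2) (cmod z) (cmod alpha) `|t| => m y a s; lra.
Qed.

Lemma interaction_Sm f g n : wave alpha gamma lam f -> wave alpha' gamma' lam' g ->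
  Sm k A n (fun t z => f t z * conjc (g t z)).
Proof.
elim: n f g => [|n IH] f g wf wg /=; first exact: interaction_Cl.
split; first exact: interaction_Cl.
have [f' wf' df] := wave_tD k0 wf; have [g' wg' dg] := wave_tD k0 wg.
exists (fun t z => f' t z * conjc (g t z) + f t z * conjc (g' t z)).
  have cf := wave_Cl k0 wf; have cg := wave_Cl k0 wg.
  have cf' := wave_Cl k0 wf'; have cg' := wave_Cl k0 wg'.
  exact: (tDM k0 cf (ClJ cg) cf' (ClJ cg') df (tDJ dg)).
by apply: SmD; apply: IH.
Qed.

End WaveInteraction.

(** * A single wave as an exact solution in the Fock space *)

Section Soliton.
Context (R : realType) (K theta : R) (gamma alpha : R[i]).
Notation leb2 := (lebC R).
Notation P := (measurableTypeR R * measurableTypeR R)%type.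
Implicit Types (s a b lam t : R) (z w : R[i]).

Definition soliton s a lam : R -> R[i] -> R[i] :=
  travelling_wave lam alpha (profile s K a theta gamma).

(** The coefficient of the degree-one part of the profile, of squared modulus [3 / 4]; only its sign
    differs between [U] and [V]. *)
Let nu : R[i] := (Num.sqrt 3 / 2)%:C * iC R * cexp (iC R * theta%:C).
Let amp a : R[i] := K%:C * ((Num.sqrt pi)^-1)%:C * cexp (iC R * a%:C) *
  cexp (- (cmod gamma ^+ 2 / 2)%:C).
Let xi t z : R[i] := z + alpha * t%:C - conjc gamma.

Lemma solitonE s a lam t z : soliton s a lam t z =
  amp a * ((2^-1)%:C + s%:C * nu * xi t z) * wave_exp alpha gamma lam t z.
Proof.
rewrite /soliton /travelling_wave /profile /phi fact0 (_ : 1`! = 1%N)// !mulr1 ?expr0 ?mulr1 expr1.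
rewrite realCM /nu /amp /xi.
set e1 := cexp (- (iC R * _)); set e2 := cexp (iC R * a%:C); set e3 := cexp (iC R * theta%:C).
set e4 := cexp (gamma * _ - _ - _); set e5 := cexp (_ * _ * _).
have -> : wave_exp alpha gamma lam t z = e1 * e4 * e5 * cexp (cmod gamma ^+ 2 / 2)%:C.
  rewrite /wave_exp /e1 /e4 /e5 -!cexpD; congr cexp.
  by apply: complex_ext; rewrite !ReImE ?cmod_sqr ?ReImE; lra.
rewrite cexpN; have := cexp_neq0 (cmod gamma ^+ 2 / 2)%:C.
set e6 := cexp _%:C; move: e1 e2 e3 e4 e5 e6 => e1 e2 e3 e4 e5 e6 e60.
by move: ((Num.sqrt pi)^-1)%:C => sp; field.
Qed.

Lemma soliton_wave s a lam : wave alpha gamma lam (soliton s a lam).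
Proof.
pose c1 := amp a * ((2^-1)%:C - s%:C * nu * conjc gamma).
pose c2 := amp a * s%:C * nu.
apply: (@wave_ext _ _ _ _ (fun t z => c1 * wave_exp alpha gamma lam t z +
  (c2 * (z * wave_exp alpha gamma lam t z) +
   (c2 * alpha) * (t%:C * wave_exp alpha gamma lam t z)))).
  by move=> t z; rewrite solitonE /c1 /c2 /xi; ring.
apply: waveD; first by apply: waveZ; exact: wave_base.
by apply: waveD; apply: waveZ; [apply: wave_z|apply: wave_t]; exact: wave_base.
Qed.

Lemma cmod_nu_sqr : nu * conjc nu = (3 / 4)%:C.
Proof.
rewrite -cmod_sqrC /nu !cmodM cmod_iC cmod_cexp cmod_real !ReImE.
rewrite mul0r mul1r subr0 expR0 !mulr1 real_normK ?num_real// exprMn sqr_sqrtr//.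
by congr (_%:C); field.
Qed.

Lemma cmod_amp a : cmod (amp a) ^+ 2 = K ^+ 2 / pi * expR (- cmod gamma ^+ 2).
Proof.
rewrite /amp !cmodM !cmod_cexp !cmod_real !ReImE mul0r mul1r subr0 expR0 mulr1.
rewrite !exprMn !real_normK ?num_real// exprVn sqr_sqrtr ?pi_ge0//.
by rewrite [expR _ ^+ 2]expr2 -expRD; congr (_ * expR _); field.
Qed.

(** Unlike in [wave_bound], the constant is uniform in time, as needed to bound the waves and their
    mass at all times. Half of the Gaussian exponent absorbs the affine factor. *)
Lemma soliton_decay s a lam : exists2 C, 0 <= C & forall t z,
  cmod (soliton s a lam t z) <= C * expR (- (4^-1 * cmod (xi t z) ^+ 2)).
Proof.
exists (cmod (amp a) * (2^-1 + cmod (s%:C * nu)) * (expR (cmod gamma ^+ 2 / 2) * expR 1)).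
  by rewrite !mulr_ge0 ?cmod_ge0 ?expR_ge0// addr_ge0 ?cmod_ge0.
move=> t z; rewrite solitonE cmodM (cmodM (amp a)).
have x0 := cmod_ge0 (xi t z).
have n0 : 0 <= cmod (s%:C * nu) by exact: cmod_ge0.
have h1 : cmod ((2^-1)%:C + s%:C * nu * xi t z) <=
    (2^-1 + cmod (s%:C * nu)) * expR (cmod (xi t z)).
  apply: (le_trans (cmodD _ _)); rewrite (cmodM (s%:C * nu)) cmod_real ger0_norm ?invr_ge0//.
  rewrite [leRHS]mulrDl; apply: lerD.
    by rewrite ler_peMr ?invr_ge0// -expR0 ler_expR.
  by rewrite ler_wpM2l// le_exp.
have h2 : cmod (wave_exp alpha gamma lam t z) =
    expR (cmod gamma ^+ 2 / 2) * expR (- (2^-1 * cmod (xi t z) ^+ 2)).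
  rewrite cmod_wave_exp -expRD; congr expR.
  by rewrite /xi !cmod_sqr !ReImE; field.
rewrite h2 [leRHS](_ : _ = (cmod (amp a) * (2^-1 + cmod (s%:C * nu)) * expR (cmod gamma ^+ 2 / 2)) *
  (expR 1 * expR (- (4^-1 * cmod (xi t z) ^+ 2)))); last by ring.
apply: (@le_trans _ _ ((cmod (amp a) * (2^-1 + cmod (s%:C * nu)) * expR (cmod gamma ^+ 2 / 2)) *
  (expR (cmod (xi t z)) * expR (- (2^-1 * cmod (xi t z) ^+ 2))))).
  rewrite [leRHS](_ : _ = cmod (amp a) * ((2^-1 + cmod (s%:C * nu)) * expR (cmod (xi t z))) *
    (expR (cmod gamma ^+ 2 / 2) * expR (- (2^-1 * cmod (xi t z) ^+ 2)))); last by ring.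
  by rewrite ler_wpM2r ?mulr_ge0 ?expR_ge0// ler_wpM2l ?cmod_ge0.
rewrite ler_wpM2l//; first by rewrite !mulr_ge0 ?cmod_ge0 ?expR_ge0// addr_ge0.
by rewrite -!expRD ler_expR; have := sqr_ge0 (cmod (xi t z) - 2); nra.
Qed.

(** The reproducing integral is evaluated in closed form, from the moments of a Gaussian with
    [c = 1]. *)
Lemma soliton_Fock s a lam : Fock (soliton s a lam).
Proof.
move=> t z; have [C C0 bC] := Cl_local `|t| (lexx 0) (wave_Cl ltr01 (soliton_wave s a lam)).
rewrite (Pi_kern _ ltr01 (bC t (lexx _))).
pose be := conjc gamma - alpha * t%:C.
pose cst := - (cmod z ^+ 2 / 2)%:C + gamma * alpha * t%:C - (cmod alpha ^+ 2 / 2 * t ^+ 2)%:C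
  - iC R * (lam * t)%:C : R[i].
have E (p : P) : kern z (toC p) * soliton s a lam t (toC p) =
  ((pi^-1)%:C * amp a * cexp cst) *
  (((2^-1)%:C - s%:C * nu * be + (s%:C * nu) * toC p + 0 * toC p ^+ 2) *
   (1 + 0 * conjc (toC p)) * gauss2c 1 (conjc be) z p).
  rewrite solitonE /kern.
  transitivity ((pi^-1)%:C * amp a * ((2^-1)%:C + s%:C * nu * xi t (toC p)) *
    (cexp (conjc (toC p) * z - (cmod z ^+ 2 / 2)%:C - (cmod (toC p) ^+ 2 / 2)%:C) *
     wave_exp alpha gamma lam t (toC p))); first by ring.
  rewrite [cexp _ * wave_exp _ _ _ _ _](_ : _ = cexp cst * gauss2c 1 (conjc be) z p).
    by rewrite /xi /be; ring.
  rewrite /wave_exp /gauss2c -!cexpD; congr cexp.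
  by rewrite /cst /be; apply: complex_ext; rewrite !ReImE ?cmod_sqr ?ReImE; field.
have c1 : (0 : R) < 1 by exact: ltr01.
rewrite (eq_cint _ E) cintZ; last first.
  exact: gauss2c_poly_cinteg.
rewrite gauss2c_moments// solitonE.
have -> : wave_exp alpha gamma lam t z = cexp cst * cexp (conjc be * z * (1^-1)%:C).
  rewrite /wave_exp -cexpD; congr cexp.
  by rewrite /cst /be; apply: complex_ext; rewrite invr1 !ReImE; field.
rewrite divr1 invr1 (_ : 1%:C = 1 :> R[i])//.
rewrite [LHS](_ : _ = ((pi^-1)%:C * pi%:C) * (amp a * ((2^-1)%:C + s%:C * nu * (z - be)) *
  (cexp cst * cexp (conjc be * z * 1)))); last by ring.
rewrite -realCM mulVf ?gt_eqF ?pi_gt0// mul1r /xi /be.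
by congr (_ * _ * _); ring.
Qed.

(** The common factor of [lambda], [mu] and [alpha]; [16 kap = K^2 / (2 pi)] is the size of the
    projected cubic term. *)
Let kap : R := K ^+ 2 / (32 * pi).

Hypothesis alphaE : alpha =
  (Num.sqrt 3 / (32 * pi) * K ^+ 2)%:C * cexp (- (iC R * theta%:C)).

Let alphaE' : alpha = (Num.sqrt 3 * kap)%:C * cexp (- (iC R * theta%:C)).
Proof.
rewrite alphaE; congr (_%:C * _); rewrite /kap.
by move: (pi : R) (pi_gt0 R) => q q0; field; exact: lt0r_neq0.
Qed.

Let conj_alpha : conjc alpha = - (2 * kap)%:C * iC R * nu.
Proof.
rewrite alphaE' conjM conjc_real -cexp_conj /nu.
have -> : conjc (- (iC R * theta%:C)) = iC R * theta%:C.
  by apply: complex_ext; rewrite !ReImE; ring.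
rewrite [RHS](_ : _ = (- (2 * kap)%:C * (Num.sqrt 3 / 2)%:C * (iC R * iC R)) *
  cexp (iC R * theta%:C)); last by ring.
congr (_ * _); rewrite iC_sqr.
by apply: complex_ext; rewrite !ReImE; field.
Qed.

Let nu_alpha : nu * alpha = (3 / 2 * kap)%:C * iC R.
Proof.
rewrite alphaE' /nu cexpN; have := cexp_neq0 (iC R * theta%:C).
set e := cexp _ => e0.
rewrite [LHS](_ : _ = (Num.sqrt 3 / 2)%:C * (Num.sqrt 3 * kap)%:C * iC R * (e * e^-1)); last by ring.
rewrite mulfV// mulr1 -realCM; congr (_%:C * _).
rewrite [LHS](_ : _ = Num.sqrt 3 ^+ 2 / 2 * kap); last by ring.
by rewrite sqr_sqrtr//.
Qed.

(* Completing the square turns the integrand into polynomials in [w], [conj w]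
   times one complex Gaussian; [beta = conj gamma - alpha t] is the centre. *)
Lemma soliton_nonlinearity s a lam b lam' t z : s ^+ 2 = 1 ->
  Pi_proj (fun w => (cmod (soliton (- s) b lam' t w) ^+ 2)%:C * soliton s a lam t w) z =
  (16 * kap)%:C * ((8^-1)%:C + s%:C * (3 / 8)%:C * nu * xi t z - (8^-1)%:C * nu ^+ 2 * xi t z ^+ 2) *
  amp a * wave_exp alpha gamma lam t z.
Proof.
move=> s2.
have sC : s%:C * s%:C = 1 :> R[i] by rewrite -realCM -expr2 s2.
have cW s' a' l' := wave_Cl ltr01 (soliton_wave s' a' l').
have cG : Cl 1 0 (fun t w => (cmod (soliton (- s) b lam' t w) ^+ 2)%:C * soliton s a lam t w).
  have := ClM ltr01 (ClM ltr01 (cW (- s) b lam') (ClJ (cW (- s) b lam'))) (cW s a lam).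
  by congr (Cl _ _ _); apply/funext => u; apply/funext => w; rewrite cmod_sqrC.
have [C C0 bC] := Cl_local `|t| (lexx 0) cG.
rewrite (Pi_kern _ ltr01 (bC t (lexx _))).
pose be := conjc gamma - alpha * t%:C.
pose cst := - (cmod z ^+ 2 / 2)%:C + 2 * gamma * alpha * t%:C + conjc (gamma * alpha) * t%:C
   - (3 / 2 * cmod alpha ^+ 2 * t ^+ 2)%:C - iC R * (lam * t)%:C : R[i].
pose A : R[i] := (pi^-1 * (K ^+ 2 / pi * expR (- cmod gamma ^+ 2)))%:C * amp a * cexp cst.
(* The profiles have opposite signs, so by [s^2 = 1] the two holomorphic factors multiply to
   [1/4 - nu^2 xi^2], without linear term in [xi]; it is expanded here in powers of [w]. *)
pose p0 := (4^-1)%:C - nu ^+ 2 * be ^+ 2; pose p1 := 2 * nu ^+ 2 * be; pose p2 := - nu ^+ 2.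
pose q0 := (2^-1)%:C + s%:C * conjc nu * conjc be; pose q1 := - s%:C * conjc nu.
(* The Gaussian has [c = 2]: the kernel and the three factors of the cubic term contribute
   [|w|^2 / 2] each. *)
have E (p : P) : kern z (toC p) * ((cmod (soliton (- s) b lam' t (toC p)) ^+ 2)%:C *
    soliton s a lam t (toC p)) =
  A * ((p0 + p1 * toC p + p2 * toC p ^+ 2) * (q0 + q1 * conjc (toC p)) *
   gauss2c 2 (2 * conjc be) (z + be) p).
  set w := toC p.
  have -> : (cmod (soliton (- s) b lam' t w) ^+ 2)%:C =
     (K ^+ 2 / pi * expR (- cmod gamma ^+ 2))%:C *
     (((2^-1)%:C - s%:C * nu * xi t w) * ((2^-1)%:C - s%:C * conjc nu * conjc (xi t w))) *
     cexp (2 * (complex.Re (gamma * (w + alpha * t%:C)) - cmod (w + alpha * t%:C) ^+ 2 / 2))%:C.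
    have sq3 (x y v : R[i]) : (cmod (x * y * v) ^+ 2)%:C =
        (cmod x ^+ 2)%:C * (y * conjc y) * (cmod v ^+ 2)%:C.
      by rewrite !cmod_sqrC !conjM; ring.
    rewrite solitonE sq3 cmod_amp cmod_wave_exp; congr (_ * _ * _).
      congr (_ * _); first by apply: complex_ext; rewrite !ReImE; ring.
      by apply: complex_ext; rewrite !ReImE; ring.
    by rewrite cexp_real expr2 -expRD; congr (expR _)%:C; ring.
  rewrite solitonE /kern /A [(pi^-1 * _)%:C]realCM.
  set c1 := (pi^-1)%:C; set c2 := (K ^+ 2 / pi * _)%:C.
  set x := xi t w; set xb := conjc x.
  transitivity (c1 * c2 * amp a * (((2^-1)%:C + s%:C * nu * x) * ((2^-1)%:C - s%:C * nu * x) *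
     ((2^-1)%:C - s%:C * conjc nu * xb)) *
    (cexp (conjc w * z - (cmod z ^+ 2 / 2)%:C - (cmod w ^+ 2 / 2)%:C) *
     cexp (2 * (complex.Re (gamma * (w + alpha * t%:C)) - cmod (w + alpha * t%:C) ^+ 2 / 2))%:C *
     wave_exp alpha gamma lam t w)); first by ring.
  rewrite [cexp _ * cexp _ * wave_exp _ _ _ _ _](_ : _ = cexp cst * gauss2c 2 (2 * conjc be) (z + be) p); last first.
    rewrite /wave_exp /gauss2c -!cexpD; congr cexp; rewrite -/w.
    by rewrite /cst /be; apply: complex_ext; rewrite !ReImE ?cmod_sqr ?ReImE; field.
  rewrite [((2^-1)%:C + _) * _](_ : _ = (p0 + p1 * w + p2 * w ^+ 2)); last first.
    rewrite (_ : _ * _ = (2^-1)%:C * (2^-1)%:C - (s%:C * s%:C) * (nu * x) ^+ 2); last by ring.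
    rewrite sC -realCM /p0 /p1 /p2 /x /xi /be.
    rewrite (_ : 2^-1 * 2^-1 = 4^-1 :> R); last by field.
    ring.
  rewrite (_ : (2^-1)%:C - _ = q0 + q1 * conjc w); first by ring.
  rewrite /q0 /q1 /xb /x /xi /be.
  have -> : conjc (w + alpha * t%:C - conjc gamma) = conjc w - conjc (conjc gamma - alpha * t%:C).
    by apply: complex_ext; rewrite !ReImE; ring.
  ring.
have c2 : (0 : R) < 2 by [].
rewrite (eq_cint _ E) cintZ; last first.
  exact: gauss2c_poly_cinteg.
rewrite gauss2c_moments//.
have -> : wave_exp alpha gamma lam t z =
  cexp (- cmod gamma ^+ 2)%:C * (cexp cst * cexp (2 * conjc be * (z + be) * (2^-1)%:C)).
  rewrite /wave_exp -!cexpD; congr cexp.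
  by rewrite /cst /be; apply: complex_ext; rewrite !ReImE ?cmod_sqr ?ReImE; field.
rewrite /A [(pi^-1 * _)%:C]realCM [(K ^+ 2 / pi * _)%:C]realCM cexp_real.
set eg := (expR _)%:C; set ec := cexp cst; set eb := cexp (2 * _ * _ * _).
set T := (X in _ * (X * (_ * _)) = _).
(* The value [|nu|^2 = 3/4] turns the moments into a quadratic polynomial in [xi] with explicit
   coefficients. *)
have -> : T = (8^-1)%:C + s%:C * (3 / 8)%:C * nu * xi t z - (8^-1)%:C * nu ^+ 2 * xi t z ^+ 2.
  have realCV (x : R) : (x^-1)%:C = (x%:C)^-1 :> R[i] by exact: fmorphV.
  have realCn n : (n%:R : R)%:C = n%:R :> R[i] by exact: rmorph_nat.
  have n2 : (3 / 8)%:C = (nu * conjc nu) / 2 :> R[i].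
    by rewrite cmod_nu_sqr !realCM !realCV !realCn; field.
  rewrite n2 /T /p0 /p1 /p2 /q0 /q1 (_ : xi t z = z - be); last by rewrite /xi /be; ring.
  rewrite !realCV !realCn; move: (conjc nu) (conjc be) (s%:C) => nb bb sg.
  by field.
have -> : (16 * kap)%:C = (pi^-1)%:C * (K ^+ 2 / pi)%:C * (pi / 2)%:C :> R[i].
  rewrite -!realCM /kap; congr (_%:C).
  by move: (pi : R) (pi_gt0 R) => q q0'; field; exact: lt0r_neq0.
by ring.
Qed.

(** Both sides are quadratic polynomials in [xi] times the same exponential. The choice of [alpha]
    matches the coefficients of [xi^2], the constant [7] in [lam] then matches the constant terms,
    and the linear terms agree since [s^2 = 1]. *)
Lemma soliton_cder s a lam b lam' z : s ^+ 2 = 1 ->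
  lam = kap * (7 * s + 2 * Num.sqrt 3 *
        complex.Im (gamma * cexp (- (iC R * theta%:C)))) ->
  cder (fun t => soliton s a lam t z)
    (fun t => - (iC R * s%:C) * Pi_proj (fun w => (cmod (soliton (- s) b lam' t w) ^+ 2)%:C *
                soliton s a lam t w) z).
Proof.
move=> s2 lamE.
have sC : s%:C * s%:C = 1 :> R[i] by rewrite -realCM -expr2 s2.
(* The imaginary part in [lam] is exactly what cancels [gamma * alpha - conj (gamma * alpha)]. *)
have L : gamma * alpha - conjc gamma * conjc alpha - iC R * lam%:C = - (7 * s * kap)%:C * iC R.
  rewrite lamE alphaE'; apply: complex_ext; rewrite !ReImE; ring.
rewrite (_ : (fun t => soliton s a lam t z) = fun t => amp a *
   (((2^-1)%:C + s%:C * nu * (z + alpha * t%:C - conjc gamma)) * wave_exp alpha gamma lam t z)).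
  apply: cder_eq.
    apply: cderZ; apply: cderM; last exact: wave_exp_cder.
    apply: cderD; first exact: cder_cst.
    apply: cderZ; apply: cderD; last exact: cder_cst.
    apply: cderD; first exact: cder_cst.
    by apply: cderZ; exact: cder_id.
  move=> t /=; rewrite soliton_nonlinearity// (_ : z + _ - _ = xi t z)//.
  set e := wave_exp _ _ _ _ _.
  have -> : (gamma * alpha - z * conjc alpha - iC R * lam%:C) * e +
     - (cmod alpha ^+ 2)%:C * (t%:C * e) =
     ((gamma * alpha - conjc gamma * conjc alpha - iC R * lam%:C) - xi t z * conjc alpha) * e.
    by rewrite cmod_sqrC /xi; ring.
  rewrite L conj_alpha.
  rewrite [LHS](_ : _ = amp a * (s%:C * (nu * alpha) + ((2^-1)%:C + s%:C * nu * xi t z) *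
    (- (7 * s * kap)%:C * iC R - xi t z * (- (2 * kap)%:C * iC R * nu))) * e); last by ring.
  rewrite nu_alpha [RHS](_ : _ = amp a * (- (iC R * s%:C) * (16 * kap)%:C *
    ((8^-1)%:C + s%:C * (3 / 8)%:C * nu * xi t z - (8^-1)%:C * nu ^+ 2 * xi t z ^+ 2)) * e); last by ring.
  congr (_ * _ * _).
  have realCV (x : R) : (x^-1)%:C = (x%:C)^-1 :> R[i] by exact: fmorphV.
  have realCn n : (n%:R : R)%:C = n%:R :> R[i] by exact: rmorph_nat.
  move: (xi t z) (iC R) nu kap => x i n k.
  rewrite !realCM !realCV !realCn.
  move: (k%:C) (s%:C) sC => {}k sg sg2.
  apply/eqP; rewrite -subr_eq0; apply/eqP.
  (* Only the coefficient of [xi] fails to match identically in [s]; its defect is a multiple of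
     [s^2 - 1]. *)
  rewrite [LHS](_ : _ = (sg * sg - 1) * (- i * k * n * x)); last by field.
  by rewrite sg2 subrr mul0r.
by apply/funext => t; rewrite solitonE mulrA.
Qed.

End Soliton.

(** * The backward integral equation *)

Section GeometricLimits.
Context (R : realType).

(** Stands in for passages to the limit, both along the Picard iterates and at [t = +oo] along
    integer times. *)
Lemma le_geometric0 (x c : R) : (forall n, x <= c * 2^-1 ^+ n) -> x <= 0.
Proof.
move=> H; rewrite leNgt; apply/negP => x0.
have c0 : 0 <= c by have := H 0%N; rewrite expr0 mulr1; apply: le_trans; exact: ltW.
have H' n : x * n%:R <= c.
  apply: (@le_trans _ _ (x * 2 ^+ n)).
    rewrite ler_wpM2l ?(ltW x0)// -natrX ler_nat ltnW//; exact: ltn_expl.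
  have := H n; rewrite exprVn ler_pdivlMr// exprn_gt0//.
have := H' (Num.bound (c / x)); rewrite leNgt => /negP; apply.
rewrite mulrC -ltr_pdivrMr//; exact: (archi_boundP (divr_ge0 c0 (ltW x0))).
Qed.

(** The limit is the supremum of the increasing lower bounds [u n - e n], with [e n] the tail of the
    geometric series, so the rate comes with it. *)
Lemma geometric_limit_real (u : nat -> R) (c : R) :
  (forall n, `|u n.+1 - u n| <= c * 2^-1 ^+ n) ->
  exists x, forall n, `|u n - x| <= 2 * c * 2^-1 ^+ n.
Proof.
move=> H; pose e n := 2 * c * 2^-1 ^+ n : R.
have c0 : 0 <= c by have := H 0%N; rewrite expr0 mulr1; apply: le_trans.
have e0 n : 0 <= e n by rewrite !mulr_ge0// exprn_ge0.
have eS n : e n.+1 = e n - c * 2^-1 ^+ n by rewrite /e exprS; field.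
have up n m : u (n + m)%N + e (n + m)%N <= u n + e n.
  elim: m => [|m IH]; first by rewrite addn0.
  apply: le_trans IH; rewrite addnS eS.
  have := H (n + m)%N; rewrite ler_norml => /andP[_]; lra.
have dn n m : u n - e n <= u (n + m)%N - e (n + m)%N.
  elim: m => [|m IH]; first by rewrite addn0.
  apply: (le_trans IH); rewrite addnS eS.
  have := H (n + m)%N; rewrite ler_norml => /andP[]; lra.
pose S := [set y | exists n, y = u n - e n].
have ubS n : ubound S (u n + e n).
  move=> y [m ->].
  have h1 := dn m n; have h2 := up n m; have := e0 (n + m)%N.
  by rewrite addnC in h1; lra.
have nS : S !=set0 by exists (u 0%N - e 0%N); exists 0%N.
exists (sup S) => n; rewrite ler_norml; apply/andP; split.
  by rewrite lerBrDr addrC lerBlDr; apply: ge_sup => //; exact: ubS.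
rewrite lerBlDr -lerBlDl; apply: sup_upper_bound; last by exists n.
by split=> //; exists (u 0%N + e 0%N); exact: ubS.
Qed.

Lemma geometric_limit (u : nat -> R[i]) (c : R) :
  (forall n, cmod (u n.+1 - u n) <= c * 2^-1 ^+ n) ->
  exists x, forall n, cmod (u n - x) <= 4 * c * 2^-1 ^+ n.
Proof.
move=> H.
have [n|x Hx] := @geometric_limit_real (fun n => complex.Re (u n)) c.
  by apply: le_trans (H n); apply: le_trans (le_Re_cmod _); rewrite !ReImE.
have [n|y Hy] := @geometric_limit_real (fun n => complex.Im (u n)) c.
  by apply: le_trans (H n); apply: le_trans (le_Im_cmod _); rewrite !ReImE.
exists (x +i* y) => n; apply: le_trans (cmod_le _) _.
rewrite !ReImE; have := Hx n; have := Hy n; lra.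
Qed.

End GeometricLimits.

Section BackwardTimeIntegral.
Context (R : realType) (k : R).
Hypothesis k0 : 0 < k.
Notation leb := (@lebesgue_measure R).
Notation leb2 := (lebC R).
Notation lebS := (product_sfm (@lebesgue_measure R) (@lebesgue_measure R)).
Notation P := (measurableTypeR R * measurableTypeR R)%type.
Notation tfun := (R -> R[i] -> R[i]).
Variables (om : R -> R) (L : R).
Hypotheses (L0 : 0 < L) (om0 : forall t, 0 <= om t).
Hypothesis om_decay : forall t s, t <= s -> om s <= om t * expR (- (L * (s - t))).
Implicit Types (G : tfun) (C t s h : R) (z : R[i]).

(** Joint measurability in time and space is what survives projection, time integration and limits,
    so Picard iterates keep it. *)
Definition jmeas G := cmeas (fun x : measurableTypeR R * P => G x.1 (toC x.2)).

Definition obd C G := forall t z, cmod (G t z) <= C * om t * wt k z.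

Lemma jmeas_pmeas G t : jmeas G -> pmeas (G t).
Proof. by move=> m; exact: (cmeas_comp (measurable_pair1 t) m). Qed.

Lemma obd_wbd C G t : jmeas G -> obd C G -> wbd k (C * om t) (G t).
Proof. by move=> m b; split; [exact: jmeas_pmeas|exact: b]. Qed.

Lemma jmeas_Pi C G : jmeas G -> obd C G -> jmeas (fun t => Pi_proj (G t)).
Proof.
move=> m b; rewrite /jmeas.
have -> : (fun x : measurableTypeR R * P => Pi_proj (G x.1) (toC x.2)) =
   fun x => cint leb2 (fun q => kern (toC x.2) (toC q) * G x.1 (toC q)).
  by apply/funext => x; exact: (Pi_kern _ k0 (obd_wbd x.1 m b)).
have mm : cmeas (fun y : (measurableTypeR R * P) * P =>
    kern (toC y.1.2) (toC y.2) * G y.1.1 (toC y.2)).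
  have mt := measurable_toC R.
  apply: cmeasM.
    apply: cmeas_kern2.
      apply: (cmeas_comp (h := fun y : (measurableTypeR R * P) * P => y.1.2) _ mt).
      exact: measurableT_comp measurable_snd measurable_fst.
    exact: (cmeas_comp measurable_snd mt).
  apply: (cmeas_comp (h := fun y : (measurableTypeR R * P) * P => (y.1.1, y.2)) _ m).
  apply: measurable_fun_pair; last exact: measurable_snd.
  exact: measurableT_comp measurable_fst measurable_fst.
exact: (@cmeas_cint _ _ _ _ R lebS _ mm).
Qed.

Lemma obd_Pi C G : jmeas G -> obd C G -> obd (Cpi k * C) (fun t => Pi_proj (G t)).
Proof.
by move=> m b t z; have [_] := Pi_bound k0 (obd_wbd t m b) => /(_ z); rewrite !mulrA.
Qed.

(** The backward Duhamel integral of [Pi_proj (G s)] over [s >= t]; the factor in front of it is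
    supplied later. *)
Definition tint G : tfun := fun t z =>
  cint leb (fun s => (after t s)%:C * Pi_proj (G s) z).

Let cmeas_after (t : R) : cmeas ((fun s => (after t s)%:C) : measurableTypeR R -> _).
Proof.
apply: cmeas_real.
exact: (measurableT_comp (@measurable_after2 R) (measurable_pair1 (t : measurableTypeR R))).
Qed.

Let tint_dom C G t z : 0 <= C -> jmeas G -> obd C G ->
  [/\ cmeas ((fun s => (after t s)%:C * Pi_proj (G s) z) : measurableTypeR R -> _),
     rint leb (fun s => Cpi k * C * om t * wt k z * (after t s * expR (- (L * (s - t))))) &
     forall s, cmod ((after t s)%:C * Pi_proj (G s) z) <=
       Cpi k * C * om t * wt k z * (after t s * expR (- (L * (s - t))))].
Proof.
move=> C0 m b; have mp := jmeas_Pi m b; have bp := obd_Pi m b.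
have [ie _] := exp_tail t L0; split.
- apply: cmeasM; first exact: cmeas_after.
  have [x y] : {xy : P | z = toC xy} by exists (complex.Re z, complex.Im z); rewrite toC_ReIm.
  by rewrite y; exact: (cmeas_comp (measurable_pair2 x) mp).
- exact: rintZ.
- move=> s; rewrite cmodM cmod_real ger0_norm ?after_ge0//.
  rewrite /after; case: (leP t s) => ts; last by rewrite !mul0r mulr0.
  rewrite !mul1r; apply: le_trans (bp s z) _.
  rewrite [leRHS]mulrAC ler_wpM2r ?wt_ge0// -[leRHS]mulrA ler_wpM2l ?om_decay//.
  by rewrite mulr_ge0// ltW// Cpi_gt0.
Qed.

Lemma tint_cinteg C G t z : 0 <= C -> jmeas G -> obd C G ->
  cinteg leb (fun s => (after t s)%:C * Pi_proj (G s) z).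
Proof.
by move=> C0 m b; have [m1 i1 b1] := tint_dom t z C0 m b; exact: cinteg_le m1 b1 i1.
Qed.

(** By [om_decay] the integral of [om] over [[t, +oo[] is at most [om t / L]: a large [L] makes the
    backward integral small in its own weight. *)
Lemma obd_tint C G : 0 <= C -> jmeas G -> obd C G -> obd (2 * Cpi k * C / L) (tint G).
Proof.
move=> C0 m b t z; have [m1 i1 b1] := tint_dom t z C0 m b.
apply: le_trans (cmod_cint m1 b1 i1) _; have [ie ee] := exp_tail t L0.
rewrite RintegralZl// ee le_eqVlt; apply/orP; left; apply/eqP; ring.
Qed.

Lemma jmeas_tint C G : 0 <= C -> jmeas G -> obd C G -> jmeas (tint G).
Proof.
move=> C0 m b; have mp := jmeas_Pi m b.
have mm : cmeas (fun y : (measurableTypeR R * P) * measurableTypeR R =>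
    (after y.1.1 y.2)%:C * Pi_proj (G y.2) (toC y.1.2)).
  apply: cmeasM.
    apply: cmeas_real.
    apply: (measurableT_comp (f := fun x : measurableTypeR R * measurableTypeR R => after x.1 x.2)
      (g := fun y : (measurableTypeR R * P) * measurableTypeR R => (y.1.1, y.2))).
      exact: measurable_after2.
    apply: measurable_fun_pair; last exact: measurable_snd.
    exact: measurableT_comp measurable_fst measurable_fst.
  apply: (cmeas_comp (h := fun y : (measurableTypeR R * P) * measurableTypeR R => (y.2, y.1.2)) _ mp).
  apply: measurable_fun_pair; first exact: measurable_snd.
  exact: measurableT_comp measurable_snd measurable_fst.
exact: (@cmeas_cint _ _ _ _ R (@lebesgue_measure R) _ mm).
Qed.

Lemma jmeasB G G' : jmeas G -> jmeas G' -> jmeas (fun t z => G t z - G' t z).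
Proof. exact: cmeasB. Qed.

Lemma tintB C C' G G' t z : 0 <= C -> 0 <= C' -> jmeas G -> obd C G -> jmeas G' -> obd C' G' ->
  tint (fun s w => G s w - G' s w) t z = tint G t z - tint G' t z.
Proof.
move=> C0 C'0 m b m' b'; rewrite /tint -cintB; try exact: tint_cinteg.
- apply: eq_cint => s; rewrite (PiB _ k0 (obd_wbd s m b) (obd_wbd s m' b')).
  by rewrite mulrBr.
- exact: (tint_cinteg _ _ C0 m b).
- exact: (tint_cinteg _ _ C'0 m' b').
Qed.

Lemma after_diff (a b : R) : a <= b ->
  rint leb (fun s => after a s - after b s) /\ \int[leb]_s (after a s - after b s) = b - a.
Proof.
move=> ab.
have E : (fun s => after a s - after b s) = \1_`[a, b[.
  apply/funext => s; rewrite indicE mem_setE in_itv /= /after ltNge.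
  case: (leP b s) => bs; last by rewrite subr0 andbT; case: ifP.
  by rewrite (le_trans ab bs) subrr.
have ii : rint leb (\1_`[a, b[ : R -> R) by exact: (@integrable_indic_itv R a b true true).
rewrite E; split=> //.
rewrite /Rintegral integral_indic// setIT.
transitivity (fine (lebesgue_measure (`[a, b[%classic : set R))) => //.
rewrite lebesgue_measure_itv /= lte_fin.
case: ltP => [_|ba]; first by rewrite -EFinD.
by rewrite (le_anti (introT andP (conj ab ba))) subrr.
Qed.

Let after_diff_supp (t h s : R) : after (t + h) s - after t s != 0 -> `|s - t| <= `|h|.
Proof.
rewrite /after; case: (leP (t + h) s); case: (leP t s); rewrite ?subrr ?eqxx//.
  move=> h1 h2 _; have h0 : h < 0 by lra.
  by rewrite ltr0_norm ?subr_lt0// ltr0_norm//; lra.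
move=> h1 h2 _; have h0 : 0 < h by lra.
by rewrite ger0_norm ?subr_ge0// gtr0_norm//; lra.
Qed.

Let after_diff_abs (t h : R) : rint leb (fun s => `|after (t + h) s - after t s|) /\
  \int[leb]_s `|after (t + h) s - after t s| = `|h|.
Proof.
have [h0|h0] := leP 0 h.
  have [i e] := @after_diff t (t + h) (ltac:(lra)).
  have E : (fun s => `|after (t + h) s - after t s|) = (fun s => after t s - after (t + h) s).
    apply/funext => s; rewrite distrC ger0_norm// /after.
    by case: (leP (t + h) s) => a; case: (leP t s) => b; rewrite ?subr0 ?subrr// ?sub0r; lra.
  rewrite /Rintegral.
  under [X in _ /\ fine X = _]eq_integral do rewrite -[(`|_|)%:E]/((EFin \o (fun s => `|after (t + h) s - after t s|)) _) E.
  rewrite E ger0_norm//; split=> //; move: e; rewrite /Rintegral => ->; lra.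
have [i e] := @after_diff (t + h) t (ltac:(lra)).
have E : (fun s => `|after (t + h) s - after t s|) = (fun s => after (t + h) s - after t s).
  apply/funext => s; rewrite ger0_norm// /after.
  by case: (leP (t + h) s) => a; case: (leP t s) => b; rewrite ?subr0 ?subrr// ?sub0r; lra.
rewrite /Rintegral.
under [X in _ /\ fine X = _]eq_integral do rewrite -[(`|_|)%:E]/((EFin \o (fun s => `|after (t + h) s - after t s|)) _) E.
rewrite E ltr0_norm//; split=> //; move: e; rewrite /Rintegral => ->; lra.
Qed.

Let tint_diff C G t h z : 0 <= C -> jmeas G -> obd C G ->
  tint G (t + h) z - tint G t z =
  cint leb (fun s => (after (t + h) s - after t s)%:C * Pi_proj (G s) z).
Proof.
move=> C0 m b; rewrite /tint -cintB; try exact: (tint_cinteg _ _ C0 m b).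
apply: eq_cint => s; rewrite -mulrBl; congr (_ * _).
by apply: complex_ext; rewrite !ReImE; ring.
Qed.

Let tint_diff_cinteg C G t h z : 0 <= C -> jmeas G -> obd C G ->
  cinteg leb (fun s => (after (t + h) s - after t s)%:C * Pi_proj (G s) z).
Proof.
move=> C0 m b.
have := cintegB (tint_cinteg (t + h) z C0 m b) (tint_cinteg t z C0 m b).
congr (cinteg leb _); apply/funext => s; rewrite -mulrBl; congr (_ * _).
by apply: complex_ext; rewrite !ReImE; ring.
Qed.

Let om_mono t s : t <= s -> om s <= om t.
Proof.
move=> ts; apply: le_trans (om_decay ts) _; rewrite ler_piMr// -expR0 ler_expR.
by rewrite oppr_le0 mulr_ge0 ?subr_ge0// ltW.
Qed.

(** The two half-lines differ by an interval of length [|h|], on which the monotone weight is at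
    most [om (- (T + 1))]. This gives the fixed point the time regularity that [tint_tD] asks of its
    source. *)
Lemma tint_lip C G : 0 <= C -> jmeas G -> obd C G -> forall T, exists2 C', 0 <= C' &
  forall t h z, `|t| <= T -> `|h| <= 1 ->
    cmod (tint G (t + h) z - tint G t z) <= C' * `|h| * wt k z.
Proof.
move=> C0 m b T; have bp := obd_Pi m b; have cp := ltW (Cpi_gt0 k).
exists (2 * (Cpi k * C * om (- (T + 1)))); first by rewrite !mulr_ge0.
move=> t h z tT h1; rewrite (tint_diff _ _ _ C0 m b).
have [ia ea] := after_diff_abs t h.
have := @cmod_cint _ _ _ leb (fun s => (after (t + h) s - after t s)%:C * Pi_proj (G s) z)
  (fun s => (Cpi k * C * om (- (T + 1)) * wt k z) * `|after (t + h) s - after t s|).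
rewrite RintegralZl// ea.
rewrite (_ : 2 * (Cpi k * C * om (- (T + 1)) * wt k z * `|h|) =
   2 * (Cpi k * C * om (- (T + 1))) * `|h| * wt k z); last by ring.
apply; last exact: rintZ.
  exact: (cinteg_meas (tint_diff_cinteg t h z C0 m b)).
move=> s; rewrite cmodM cmod_real mulrC.
have [->|nz] := eqVneq (after (t + h) s - after t s) 0; first by rewrite normr0 !mulr0.
rewrite ler_wpM2r//; apply: le_trans (bp s z) _.
rewrite ler_wpM2r ?wt_ge0// ler_wpM2l ?mulr_ge0// om_mono//.
have := after_diff_supp nz; move: tT; rewrite !ler_norml => /andP[t1 t2] /andP[s1 s2]; lra.
Qed.

(** Replacing [G s] by [G t] costs [O(h)] on an interval of length [|h|], hence a quadratic error.
    The minus sign comes from [t] being the lower endpoint. *)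
Lemma tint_tD C G : 0 <= C -> jmeas G -> obd C G ->
  (forall T, exists2 C', 0 <= C' & forall t h z, `|t| <= T -> `|h| <= 1 ->
    cmod (G (t + h) z - G t z) <= C' * `|h| * wt k z) ->
  tD k (tint G) (fun t z => - Pi_proj (G t) z).
Proof.
move=> C0 m b lipG T; have [C' C'0 lG] := lipG T; have cp := ltW (Cpi_gt0 k).
exists (2 * (Cpi k * C')) => t h z tT h1.
have [ia ea] := after_diff_abs t h.
have ic : cinteg leb (fun s => (after (t + h) s - after t s)%:C * Pi_proj (G t) z).
  apply: (@cinteg_le _ _ _ leb _ (fun s => cmod (Pi_proj (G t) z) * `|after (t + h) s - after t s|)).
  - apply: cmeasM; last exact: cmeas_cst.
    rewrite (_ : (fun s => _) = fun s => (after (t + h) s)%:C - (after t s)%:C).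
      by apply: cmeasB; exact: cmeas_after.
    by apply/funext => s; apply: complex_ext; rewrite !ReImE; ring.
  - by move=> s; rewrite cmodM cmod_real mulrC.
  - exact: rintZ.
have ed : \int[leb]_s (after (t + h) s - after t s) = - h.
  have [h0|h0] := leP 0 h.
    have [i e] := @after_diff t (t + h) (ltac:(lra)).
    transitivity (\int[leb]_s (-1 * (after t s - after (t + h) s))).
      by apply: eq_Rintegral => s _; ring.
    by rewrite RintegralZl// e; ring.
  by have [i ->] := @after_diff (t + h) t (ltac:(lra)); lra.
have e1 : cint leb (fun s => (after (t + h) s - after t s)%:C * Pi_proj (G t) z) =
   - (h%:C * Pi_proj (G t) z).
  have ir : rint leb (fun s => after (t + h) s - after t s).
    have [h0|h0] := leP 0 h; last by have [] := @after_diff (t + h) t (ltac:(lra)).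
    have [i _] := @after_diff t (t + h) (ltac:(lra)).
    by have := rintZ (-1) i; congr (rint leb _); apply/funext => s; ring.
  have ci : cinteg leb (fun s => (after (t + h) s - after t s)%:C).
    split=> //; rewrite (_ : (fun s => _) = fun s => 0 * (after (t + h) s - after t s)).
      exact: rintZ.
    by apply/funext => s; rewrite mul0r.
  transitivity (cint leb (fun s => Pi_proj (G t) z * (after (t + h) s - after t s)%:C)).
    by apply: eq_cint => s; rewrite mulrC.
  rewrite cintZ//.
  have -> : cint leb (fun s => (after (t + h) s - after t s)%:C) = (- h)%:C.
    apply: complex_ext; rewrite /cint !ReImE; first by rewrite -ed.
    by rewrite /Rintegral integral0.
  by apply: complex_ext; rewrite !ReImE; ring.
have i3 := tint_diff_cinteg t h z C0 m b.
rewrite (tint_diff _ _ _ C0 m b) mulrN -e1 -cintB//.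
have := @cmod_cint _ _ _ leb (fun s => (after (t + h) s - after t s)%:C * Pi_proj (G s) z -
    (after (t + h) s - after t s)%:C * Pi_proj (G t) z)
  (fun s => (Cpi k * C' * `|h| * wt k z) * `|after (t + h) s - after t s|).
rewrite RintegralZl// ea -[h ^+ 2]real_normK ?num_real//.
rewrite (_ : 2 * (Cpi k * C' * `|h| * wt k z * `|h|) =
   2 * (Cpi k * C') * `|h| ^+ 2 * wt k z); last by ring.
apply; last exact: rintZ.
  exact: (cinteg_meas (cintegB i3 ic)).
move=> s; rewrite -mulrBr cmodM cmod_real mulrC.
have [->|nz] := eqVneq (after (t + h) s - after t s) 0; first by rewrite normr0 !mulr0.
rewrite ler_wpM2r//.
have sh := after_diff_supp nz.
rewrite -(PiB _ k0 (obd_wbd s m b) (obd_wbd t m b)).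
have B : wbd k (C' * `|h|) (fun w => G s w - G t w).
  split; first by apply: cmeasB; apply: jmeas_pmeas.
  move=> w; have := lG t (s - t) w tT (le_trans sh h1); rewrite (_ : t + (s - t) = s); last by ring.
  move/le_trans; apply; rewrite ler_wpM2r ?wt_ge0// ler_wpM2l//.
by have [_] := Pi_bound k0 B => /(_ z); rewrite !mulrA.
Qed.

Section Picard.
Variables (I : Type) (eps : I -> R[i]) (H : (I -> tfun) -> (I -> tfun)) (s0 ell : R).
Hypotheses (s00 : 0 <= s0) (ell0 : 0 <= ell) (eps1 : forall i, cmod (eps i) <= 1).
Hypothesis Hm : forall r, (forall i, jmeas (r i)) -> forall i, jmeas (H r i).
Hypothesis H0 : forall i, obd s0 (H (fun _ _ _ => 0) i).
Hypothesis HL : forall r r' C, 0 <= C -> (forall i, obd C (fun t z => r i t z - r' i t z)) ->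
  forall i, obd (ell * C) (fun t z => H r i t z - H r' i t z).
Hypothesis small : 4 * Cpi k * ell <= L.

Let Phi (r : I -> tfun) : I -> tfun := fun i t z => eps i * tint (H r i) t z.

Let jmeas0 : jmeas (fun _ _ => 0). Proof. exact: cmeas_cst. Qed.

Let obd_H r C : 0 <= C -> (forall i, obd C (r i)) -> forall i, obd (s0 + ell * C) (H r i).
Proof.
move=> C0 b i t z; rewrite -[H r i t z](subrK (H (fun _ _ _ => 0) i t z)).
apply: le_trans (cmodD _ _) _; rewrite [leRHS](_ : _ = ell * C * om t * wt k z + s0 * om t * wt k z); last by ring.
apply: lerD; last exact: H0.
by apply: (HL C0) => j u w; rewrite subr0; exact: b.
Qed.

Let Phi_obd r C : 0 <= C -> (forall i, jmeas (r i)) -> (forall i, obd C (r i)) ->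
  forall i, jmeas (Phi r i) /\ obd (2 * Cpi k * s0 / L + C / 2) (Phi r i).
Proof.
move=> C0 m b i; have CH : 0 <= s0 + ell * C by rewrite addr_ge0// mulr_ge0.
have mH := Hm m i; have bH := obd_H C0 b i; split.
  by apply: cmeasM; [exact: cmeas_cst|exact: (jmeas_tint CH mH bH)].
move=> t z; rewrite cmodM; apply: (@le_trans _ _ (cmod (tint (H r i) t z))).
  by rewrite ler_piMl ?cmod_ge0.
apply: le_trans (obd_tint CH mH bH t z) _.
rewrite ler_wpM2r ?wt_ge0// ler_wpM2r//.
have -> : 2 * Cpi k * (s0 + ell * C) / L = 2 * Cpi k * s0 / L + (4 * Cpi k * ell) * C / 2 / L.
  by field; exact: lt0r_neq0.
by rewrite lerD2l ler_pdivrMr// [C / 2 * L]mulrC [leRHS]mulrA ler_wpM2r ?invr_ge0// ler_wpM2r.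
Qed.

Let Phi_lip r r' C C1 C2 : 0 <= C -> 0 <= C1 -> 0 <= C2 ->
  (forall i, jmeas (r i)) -> (forall i, obd C1 (r i)) ->
  (forall i, jmeas (r' i)) -> (forall i, obd C2 (r' i)) ->
  (forall i, obd C (fun t z => r i t z - r' i t z)) ->
  forall i, obd (C / 2) (fun t z => Phi r i t z - Phi r' i t z).
Proof.
move=> C0 C10 C20 m b m' b' d i t z; rewrite /Phi -mulrBr.
have CH : 0 <= s0 + ell * C1 by rewrite addr_ge0// mulr_ge0.
have CH' : 0 <= s0 + ell * C2 by rewrite addr_ge0// mulr_ge0.
rewrite -(tintB _ _ CH CH' (Hm m i) (obd_H C10 b i) (Hm m' i) (obd_H C20 b' i)).
rewrite cmodM; apply: (@le_trans _ _ (cmod (tint (fun s w => H r i s w - H r' i s w) t z))).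
  by rewrite ler_piMl ?cmod_ge0.
have eC : 0 <= ell * C by rewrite mulr_ge0.
apply: le_trans (obd_tint eC (jmeasB (Hm m i) (Hm m' i)) (HL C0 d i) t z) _.
rewrite ler_wpM2r ?wt_ge0// ler_wpM2r//.
have -> : 2 * Cpi k * (ell * C) / L = (4 * Cpi k * ell) * C / 2 / L.
  by field; exact: lt0r_neq0.
by rewrite ler_pdivrMr// [C / 2 * L]mulrC [leRHS]mulrA ler_wpM2r ?invr_ge0// ler_wpM2r.
Qed.

(** The hypothesis [small] gives contraction ratio [1/2]. With [c0] the bound on the first iterate,
    all iterates stay in the ball of radius [2 c0], and convergence is used pointwise in [(t, z)]
    instead of in a function space. *)
Lemma Picard : exists r : I -> tfun,
  [/\ forall i, jmeas (r i), forall i, obd (8 * Cpi k * s0 / L) (r i) &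
      forall i t z, r i t z = eps i * tint (H r i) t z].
Proof.
pose c0 := 2 * Cpi k * s0 / L.
have c00 : 0 <= c0 by rewrite /c0 divr_ge0 ?mulr_ge0// ltW// Cpi_gt0.
pose u n := iter n Phi (fun _ _ _ => 0).
have ub n : (forall i, jmeas (u n i)) /\ (forall i, obd (2 * c0) (u n i)).
  elim: n => [|n [IHm IHb]].
    split=> [i|i t z]; first exact: jmeas0.
    rewrite /= cmod0; apply: mulr_ge0; last exact: wt_ge0.
    by apply: mulr_ge0; [exact: mulr_ge0|exact: om0].
  have c20 : 0 <= 2 * c0 by rewrite mulr_ge0.
  split=> i; have [mi bi] := Phi_obd c20 IHm IHb i => // t z.
  by apply: le_trans (bi t z) _; rewrite -/c0 (_ : c0 + 2 * c0 / 2 = 2 * c0)//; field.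
have ud n : forall i, obd (c0 * 2^-1 ^+ n) (fun t z => u n.+1 i t z - u n i t z).
  elim: n => [|n IH] i.
    move=> t z; rewrite subr0 expr0 mulr1.
    have [|_] := @Phi_obd (fun _ _ _ => 0) 0 (lexx _) (fun=> jmeas0) _ i.
      by move=> j s w; rewrite /= cmod0 !mul0r; exact: lexx.
    by move=> /(_ t z); rewrite mul0r addr0; exact.
  rewrite exprS mulrCA mulrC; have [m b] := ub n; have [m' b'] := ub n.+1.
  have cn : 0 <= c0 * 2^-1 ^+ n by rewrite mulr_ge0// exprn_ge0.
  have c20 : 0 <= 2 * c0 by rewrite mulr_ge0.
  exact: (Phi_lip cn c20 c20 m' b' m b IH).
have lim i t z : exists x, forall n, cmod (u n i t z - x) <= 4 * (c0 * om t * wt k z) * 2^-1 ^+ n.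
  apply: geometric_limit => n; apply: le_trans (ud n i t z) _.
  by rewrite le_eqVlt; apply/orP; left; apply/eqP; ring.
(* Limits are chosen point by point; measurability is recovered below because the iterates converge
   pointwise. *)
pose r i t z := projT1 (cid (lim i t z)).
have rl i t z n : cmod (u n i t z - r i t z) <= 4 * (c0 * om t * wt k z) * 2^-1 ^+ n.
  by rewrite /r; case: cid => x /= ->.
have rm i : jmeas (r i).
  apply: (@cmeas_lim _ _ _ (fun n x => u n i x.1 (toC x.2))) => [n|x].
    by have [m _] := ub n; exact: m.
  apply/cvgrPdist_le => e e0.
  have [N HN] : exists N, forall n, (N <= n)%N -> 4 * (c0 * om x.1 * wt k (toC x.2)) * 2^-1 ^+ n <= e.
    set c := 4 * _; have c_ge0 : 0 <= c.
      by apply: mulr_ge0 => //; apply: mulr_ge0; [exact: mulr_ge0|exact: wt_ge0].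
    exists (Num.bound (c / e)) => n Nn; rewrite exprVn ler_pdivrMr ?exprn_gt0// mulrC -ler_pdivrMr//.
    have := archi_boundP (divr_ge0 c_ge0 (ltW e0)) => /ltW /le_trans; apply.
    by rewrite -natrX ler_nat (leq_trans Nn)// ltnW// ltn_expl.
  exists N => // n /= /HN; rewrite sub0r normrN ger0_norm ?cmod_ge0//.
  exact: le_trans.
have rb i : obd (4 * c0) (r i).
  move=> t z; have := rl i t z 0%N; rewrite /u /= sub0r cmodN expr0 mulr1 !mulrA; exact.
exists r; split=> //.
  move=> i t z; apply: le_trans (rb i t z) _; rewrite /c0 le_eqVlt; apply/orP; left; apply/eqP; ring.
move=> i t z; apply/eqP; rewrite -subr_eq0; apply/eqP/cmod_eq0/le_anti; rewrite cmod_ge0 andbT.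
(* Both [r] and its image under [Phi] are geometrically close to the iterate [u n.+1], for every
   [n]. *)
apply: (@le_geometric0 _ _ (4 * (c0 * om t * wt k z))) => n.
rewrite -/(Phi r i t z) -[_ - _](subrKA (u n.+1 i t z)).
have [m b] := ub n; have c20 : 0 <= 2 * c0 by rewrite mulr_ge0.
have c40 : 0 <= 4 * c0 by rewrite mulr_ge0.
have d j : obd (4 * c0 * 2^-1 ^+ n) (fun s w => u n j s w - r j s w).
  by move=> s w; apply: le_trans (rl j s w n) _; rewrite le_eqVlt; apply/orP; left; apply/eqP; ring.
have dn : 0 <= 4 * c0 * 2^-1 ^+ n by rewrite mulr_ge0// exprn_ge0.
have h1 := Phi_lip dn c20 c40 m b rm rb d i t z.
have h2 := rl i t z n.+1; rewrite cmodBC in h2.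
apply: le_trans (cmodD _ _) _; rewrite exprS in h2.
by apply: le_trans (lerD h2 h1) _; rewrite le_eqVlt; apply/orP; left; apply/eqP; field.
Qed.

End Picard.

End BackwardTimeIntegral.

(** * The truncated cubic nonlinearity and the decaying time weight *)

Section Truncation.
Context (R : realType) (M : R).
Hypothesis M0 : 0 < M.
Implicit Types z w : R[i].

(** Dividing by this number is the radial retraction onto the closed disc of radius [M]. *)
Definition trunc_den z : R := Num.max 1 (cmod z / M).
Definition trunc z : R[i] := (trunc_den z)^-1%:C * z.

Lemma trunc_den_ge1 z : 1 <= trunc_den z.
Proof. by rewrite le_max lexx. Qed.

Lemma trunc_den_gt0 z : 0 < trunc_den z.
Proof. exact: lt_le_trans ltr01 (trunc_den_ge1 z). Qed.

Lemma cmod_trunc z : cmod (trunc z) = (trunc_den z)^-1 * cmod z.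
Proof. by rewrite cmodM cmod_real ger0_norm// invr_ge0 ltW// trunc_den_gt0. Qed.

Lemma trunc_le z : cmod (trunc z) <= M.
Proof.
rewrite cmod_trunc ler_pdivrMl ?trunc_den_gt0// -ler_pdivrMr//.
by rewrite le_max lexx orbT.
Qed.

Lemma trunc_id z : cmod z <= M -> trunc z = z.
Proof.
move=> zM; rewrite /trunc (_ : trunc_den z = 1).
  by apply: complex_ext; rewrite !ReImE invr1; ring.
by apply/max_idPl; rewrite ler_pdivrMr// mul1r.
Qed.

(** The denominator is Lipschitz with constant [1 / M] while [|trunc w| <= M], so each of the two
    terms of the difference costs [|z - w|]. *)
Lemma trunc_lip z w : cmod (trunc z - trunc w) <= 2 * cmod (z - w).
Proof.
have a1 := trunc_den_ge1 z; have a0 := trunc_den_gt0 z.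
have b1 := trunc_den_ge1 w; have b0 := trunc_den_gt0 w.
have wM : (trunc_den w)^-1 * cmod w <= M by rewrite -cmod_trunc trunc_le.
have hd : `|trunc_den w - trunc_den z| <= cmod (z - w) / M.
  have h (x y : R[i]) : trunc_den x - trunc_den y <= cmod (x - y) / M.
    rewrite lerBlDr /trunc_den ge_max; apply/andP; split.
      apply: (@le_trans _ _ (Num.max 1 (cmod y / M))); first by rewrite le_max lexx.
      by rewrite lerDr divr_ge0 ?cmod_ge0// ltW.
    apply: (@le_trans _ _ (cmod (x - y) / M + cmod y / M)).
      rewrite -mulrDl ler_wpM2r ?invr_ge0 ?(ltW M0)//.
      by rewrite -{1}(subrK y x) cmodD.
    by rewrite lerD2l le_max lexx orbT.
  rewrite ler_norml; have := h z w; have := h w z; rewrite (cmodBC w z); lra.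
have -> : trunc z - trunc w = (trunc_den z)^-1%:C * (z - w) +
    ((trunc_den w - trunc_den z) * (trunc_den z)^-1)%:C * trunc w.
  have e : (trunc_den z)^-1 - (trunc_den w)^-1 =
      (trunc_den w - trunc_den z) * (trunc_den z)^-1 * (trunc_den w)^-1.
    by field; rewrite !lt0r_neq0.
  rewrite /trunc [X in _ = _ + X]mulrA -realCM -e.
  by apply: complex_ext; rewrite !ReImE; ring.
apply: (le_trans (cmodD _ _)); rewrite mulr_natl mulr2n; apply: lerD.
  by rewrite cmodM cmod_real ger0_norm ?invr_ge0 ?(ltW a0)// ler_piMl ?cmod_ge0// invf_le1.
rewrite cmodM cmod_real normrM [`|_^-1|]ger0_norm ?invr_ge0 ?(ltW a0)//.
apply: (@le_trans _ _ (cmod (z - w) / M * M)); last by rewrite divfK// lt0r_neq0.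
apply: ler_pM; rewrite ?mulr_ge0 ?cmod_ge0 ?invr_ge0 ?(ltW a0) ?trunc_le//.
apply: le_trans hd; rewrite ler_piMr// invf_le1//.
Qed.

Lemma cmeas_trunc d (T : measurableType d) (f : T -> R[i]) : cmeas f -> cmeas (fun x => trunc (f x)).
Proof.
move=> mf; apply: cmeasM => //; apply: cmeas_real.
have mm : measurable_fun setT (fun x => trunc_den (f x)).
  apply: measurable_maxr => //.
  by apply: measurable_funM => //; exact: measurable_cmod.
(* Rewriting the inverse as an exponential of a logarithm exhibits its measurability. *)
have E x : (trunc_den (f x))^-1 = expR (- ln (trunc_den (f x))).
  by rewrite expRN lnK// posrE trunc_den_gt0.
under eq_fun do rewrite E.
apply: measurableT_comp => //; apply: measurableT_comp => //.
exact: (measurableT_comp (@measurable_ln R) mm).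
Qed.

Definition cubic (v u : R[i]) : R[i] := (cmod v ^+ 2)%:C * u.

Lemma trunc_cubic_lip (v u v' u' : R[i]) :
  cmod (cubic (trunc v) (trunc u) - cubic (trunc v') (trunc u')) <=
  4 * M ^+ 2 * cmod (v - v') + 2 * M ^+ 2 * cmod (u - u').
Proof.
have -> : cubic (trunc v) (trunc u) - cubic (trunc v') (trunc u') =
  (cmod (trunc v) ^+ 2 - cmod (trunc v') ^+ 2)%:C * trunc u' +
  (cmod (trunc v) ^+ 2)%:C * (trunc u - trunc u').
  rewrite /cubic (_ : (_ - _)%:C = (cmod (trunc v) ^+ 2)%:C - (cmod (trunc v') ^+ 2)%:C).
    by ring.
  by apply: complex_ext; rewrite !ReImE; ring.
have hv := trunc_lip v v'; have hu := trunc_lip u u'.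
have v1 := trunc_le v; have v2 := trunc_le v'; have u1 := trunc_le u'.
have v1' := cmod_ge0 (trunc v); have v2' := cmod_ge0 (trunc v').
have M0' := ltW M0.
have d : `|cmod (trunc v) - cmod (trunc v')| <= 2 * cmod (v - v').
  apply: le_trans hv; rewrite ler_norml; apply/andP; split.
    rewrite lerNl opprB lerBlDr.
    by rewrite cmodBC -{1}(subrK (trunc v) (trunc v')) cmodD.
  by rewrite lerBlDr -{1}(subrK (trunc v') (trunc v)) cmodD.
apply: (le_trans (cmodD _ _)); apply: lerD; rewrite cmodM cmod_real.
  rewrite subr_sqr normrM (ger0_norm (addr_ge0 v1' v2')).
  rewrite [leRHS](_ : _ = 2 * cmod (v - v') * (M + M) * M); last by ring.
  apply: ler_pM => //; [by rewrite mulr_ge0 ?addr_ge0|exact: cmod_ge0|].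
  by apply: ler_pM => //; [exact: addr_ge0|exact: lerD].
rewrite ger0_norm ?sqr_ge0// [leRHS](_ : _ = M ^+ 2 * (2 * cmod (u - u'))); last by ring.
by apply: ler_pM; rewrite ?sqr_ge0 ?cmod_ge0// ler_sqr ?nnegrE.
Qed.

(** Truncation multiplies by real numbers only, so [conj u] times the truncated term is real; this
    keeps the mass conserved. *)
Lemma trunc_cubic_real (v u : R[i]) :
  complex.Im (conjc u * cubic (trunc v) (trunc u)) = 0.
Proof.
rewrite /cubic /trunc; set c := (_ ^+ 2)%:C; set d := _%:C.
rewrite (_ : _ * _ = c * d * (u * conjc u)); last by ring.
by rewrite -cmod_sqrC /c /d !ReImE; ring.
Qed.

End Truncation.

Section DecayWeight.
Context (R : realType) (A B L : R).
Hypotheses (A0 : 0 < A) (B0 : 0 <= B) (BL : B <= L) (L0 : 0 < L).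
Implicit Types t s : R.

(** The factor [exp (- (L * t))] of [decay_weight] forces the rate [L] at all times. Delaying the
    Gaussian until [T0], with [A * T0 / 2 = B + L], compensates it: for [t >= T0] the exponent is
    [B t - A t^2 / 4] up to a constant, so the weight dominates the source. *)
Let T0 : R := 2 * (B + L) / A.
Definition decay_weight t : R := expR (- (L * t)) * rho A (t - T0).

Let T00 : 0 <= T0. Proof. by rewrite /T0 divr_ge0 ?mulr_ge0 ?addr_ge0 ?(ltW L0)// ltW. Qed.

Let AT0 : A * T0 = 2 * (B + L). Proof. by rewrite /T0 mulrC divfK// lt0r_neq0. Qed.

Lemma decay_weight_ge0 t : 0 <= decay_weight t.
Proof. by rewrite mulr_ge0 ?expR_ge0. Qed.

Lemma decay_weight_decay t s : t <= s ->
  decay_weight s <= decay_weight t * expR (- (L * (s - t))).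
Proof.
move=> ts; rewrite /decay_weight [leRHS]mulrAC -[expR (- (L * t)) * expR _]expRD.
rewrite (_ : - (L * t) + - (L * (s - t)) = - (L * s)); last by ring.
rewrite ler_wpM2l ?expR_ge0// /rho ler_expR lerN2 ler_wpM2r ?invr_ge0// ler_wpM2l ?(ltW A0)//.
have n0 x : 0 <= Num.max x 0 :> R by rewrite le_max lexx orbT.
by rewrite ler_sqr ?nnegrE// ge_max !le_max lexx orbT andbT lerB.
Qed.

Lemma decay_weight_le t : 0 <= t -> decay_weight t <= expR (- (L * t)).
Proof. by move=> t0; rewrite ler_piMr ?expR_ge0// rho_le1 ?ltW. Qed.

(** Between [0] and [T0] the exponents differ by [A (t - T0)^2 / 4]; at negative times [B <= L]
    decides. *)
Lemma le_decay_weight t :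
  expR (B * `|t|) * rho A t <= expR (A * T0 ^+ 2 / 4) * decay_weight t.
Proof.
rewrite /decay_weight /rho -!expRD ler_expR.
move: (T0) AT0 T00 => T eT Tpos.
have sq := mulr_ge0 (ltW A0) (sqr_ge0 (t - T)); have sT := mulr_ge0 (ltW A0) (sqr_ge0 T).
have eTt : A * T * t = 2 * (B + L) * t by rewrite eT.
rewrite /Num.max; case: (ltP t 0) => t0; case: (ltP (t - T) 0) => tT.
- rewrite ltr0_norm// expr0n /=.
  have h1 : 0 <= (L - B) * - t by rewrite mulr_ge0 ?subr_ge0// oppr_ge0 ltW.
  by move: h1 sT; lra.
- by exfalso; lra.
- by rewrite ger0_norm// expr0n /=; move: sq eTt; lra.
- by rewrite ger0_norm//; move: sq eTt; lra.
Qed.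

(** The way back from the weight to the class [Cl A]: the Gaussian rate is intact and only the
    exponential factor grows. *)
Lemma decay_weight_rho t :
  decay_weight t <= expR (A * T0 ^+ 2 / 4) * (expR ((L + A * T0 / 2) * `|t|) * rho A t).
Proof.
rewrite /decay_weight /rho -!expRD ler_expR.
move: (T0) T00 => T Tpos.
have sT := mulr_ge0 (ltW A0) (sqr_ge0 T); have AT := mulr_ge0 (ltW A0) Tpos.
rewrite /Num.max; case: (ltP t 0) => t0; case: (ltP (t - T) 0) => tT.
- rewrite ltr0_norm// expr0n /=.
  have h1 : 0 <= A * T * - t by rewrite mulr_ge0// oppr_ge0 ltW.
  by move: h1 sT; lra.
- by exfalso; lra.
- rewrite ger0_norm// expr0n /=.
  have h1 : 0 <= L * t by rewrite mulr_ge0// ltW.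
  have h2 := mulr_ge0 AT t0.
  have h3 : A * t ^+ 2 <= A * T ^+ 2.
    by rewrite ler_wpM2l ?(ltW A0)// ler_sqr ?nnegrE//; lra.
  by move: h1 h2 h3; lra.
- rewrite ger0_norm//.
  have h1 : 0 <= L * t by rewrite mulr_ge0// ltW.
  by move: h1 sT; lra.
Qed.

End DecayWeight.

(** * Mass *)

Section WaveJointMeasurability.
Context (R : realType) (alpha gamma : R[i]) (lam : R).
Notation leb2 := (lebC R).
Notation P := (measurableTypeR R * measurableTypeR R)%type.

Lemma wave_jmeas f : wave alpha gamma lam f -> jmeas f.
Proof.
have mt : cmeas (fun x : measurableTypeR R * P => (x.1)%:C).
  by apply: cmeas_real; exact: measurable_fst.
have mz : cmeas (fun x : measurableTypeR R * P => toC x.2).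
  by apply: (cmeas_comp (h := snd)) (@measurable_toC R); exact: measurable_snd.
have mr (g : measurableTypeR R * P -> R) n : measurable_fun setT g ->
    cmeas (fun x => (cmod alpha ^+ 2 / 2 * g x ^+ n)%:C).
  move=> mg; apply: cmeas_real; apply: measurable_funM; first exact: measurable_cst.
  exact: measurable_funX.
elim=> {f} [|c f _ mf|f _ mf|f _ mf|f g _ mf _ mg].
- apply: cmeas_cexp; apply: cmeasB; last first.
    apply: cmeas_real; apply: measurable_funM; last exact: measurable_cst.
    exact/measurable_funX/measurable_cmod.
  apply: cmeasB; last first.
    apply: cmeasM; first exact: cmeas_cst.
    apply: cmeas_real; apply: measurable_funM; first exact: measurable_cst.
    exact: measurable_fst.
  apply: cmeasB; last by apply: mr; exact: measurable_fst.
  apply: cmeasB; last by apply: cmeasM => //; apply: cmeasM => //; exact: cmeas_cst.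
  apply: cmeasM; first exact: cmeas_cst.
  by apply: cmeasD => //; apply: cmeasM => //; exact: cmeas_cst.
- by apply: cmeasM => //; exact: cmeas_cst.
- exact: cmeasM.
- exact: cmeasM.
- exact: cmeasD.
Qed.

End WaveJointMeasurability.

Section Mass.
Context (R : realType) (k : R).
Hypothesis k0 : 0 < k.
Notation leb2 := (lebC R).
Notation P := (measurableTypeR R * measurableTypeR R)%type.
Notation tfun := (R -> R[i] -> R[i]).
Implicit Types (f g : tfun) (F : R[i] -> R[i]) (C t h : R) (z : R[i]).

Definition mass F : R := \int[leb2]_p (cmod (F (toC p)) ^+ 2).

Lemma rint_mass C F : wbd k C F -> rint leb2 (fun p => cmod (F (toC p)) ^+ 2).
Proof.
move=> bF; have [mF FC] := wbdM k0 bF bF.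
apply: (@rint_le _ _ _ leb2 _ (fun p => C * C * wt k (toC p))).
- exact/measurable_funX/measurable_cmod/(proj1 bF).
- by move=> p; rewrite ger0_norm ?sqr_ge0//; have := FC (toC p); rewrite cmodM.
- exact/rintZ/rint_exp_cmod.
Qed.

Lemma mass_le C F : wbd k C F -> mass F <= C ^+ 2 * \int[leb2]_p wt k (toC p).
Proof.
move=> bF; have [_ FC] := wbdM k0 bF bF.
rewrite -RintegralZl//; last exact: rint_exp_cmod.
apply: Rintegral_le; first exact: rint_mass bF.
  exact/rintZ/rint_exp_cmod.
by move=> p; have := FC (toC p); rewrite cmodM -!expr2.
Qed.

Lemma massD_le C C' F G : wbd k C F -> wbd k C' G ->
  mass (fun z => F z + G z) <= 2 * mass F + 2 * mass G.
Proof.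
move=> bF bG; have iF := rint_mass bF; have iG := rint_mass bG.
rewrite /mass -!RintegralZl// -RintegralD//; [|exact: rintZ|exact: rintZ].
apply: Rintegral_le; first exact: rint_mass (wbdD bF bG).
  by apply: rintD; exact: rintZ.
move=> p; set x := F _; set y := G _.
apply: (@le_trans _ _ ((cmod x + cmod y) ^+ 2)).
  by rewrite ler_sqr ?nnegrE ?addr_ge0 ?cmod_ge0// cmodD.
by have := sqr_ge0 (cmod x - cmod y); lra.
Qed.

(** The reproducing formula with [2 x y <= x^2 + y^2], whose [2] matches that of [cmod_cint];
    [pi^-1] is the squared [L^2] norm of the kernel. A bound affine in the mass suffices later. *)
Lemma Fock_le_mass C F z : wbd k C F -> Pi_proj F z = F z -> cmod (F z) <= pi^-1 + mass F.
Proof.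
move=> bF <-; rewrite (Pi_kern _ k0 bF).
have [ig eg] := @gauss2 R 1 z ltr01.
have iF := rint_mass bF.
have E p : cmod (kern z (toC p)) ^+ 2 = pi^-1 ^+ 2 * expR (- (1 * cmod (toC p - z) ^+ 2)).
  rewrite cmod_kern exprMn -expRM_natl; congr (_ * expR _); by field.
have ik : rint leb2 (fun p => cmod (kern z (toC p)) ^+ 2).
  by rewrite (funext E); exact: rintZ.
have -> : pi^-1 = \int[leb2]_p (cmod (kern z (toC p)) ^+ 2) :> R.
  by rewrite (funext E) RintegralZl// eg; move: (pi : R) (pi_gt0 R) => q q0; field; exact: lt0r_neq0.
rewrite /mass -RintegralD//.
have -> : \int[leb2]_p (cmod (kern z (toC p)) ^+ 2 + cmod (F (toC p)) ^+ 2) =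
    2 * \int[leb2]_p (2^-1 * (cmod (kern z (toC p)) ^+ 2 + cmod (F (toC p)) ^+ 2)).
  by rewrite RintegralZl ?mulrA ?mulfV ?mul1r//; exact: rintD.
apply: (@cmod_cint _ _ _ leb2).
- by apply: cmeasM; [exact: pmeas_kern|exact: (proj1 bF)].
- by move=> p; rewrite cmodM; have := sqr_ge0 (cmod (kern z (toC p)) - cmod (F (toC p))); lra.
- exact/rintZ/rintD.
Qed.

Lemma cint_conj (f : P -> R[i]) : cinteg leb2 f ->
  cint leb2 (fun p => conjc (f p)) = conjc (cint leb2 f).
Proof.
move=> [i1 i2]; apply: complex_ext; rewrite !ReImE.
  by apply: eq_Rintegral => p _; rewrite !ReImE.
rewrite -mulN1r -RintegralZl//; by apply: eq_Rintegral => p _; rewrite !ReImE mulN1r.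
Qed.

Lemma tD_cint f g : Cl k 0 f -> Cl k 0 g -> tD k f g ->
  cder (fun t => cint leb2 (fun p => f t (toC p))) (fun t => cint leb2 (fun p => g t (toC p))).
Proof.
move=> cf cg d; apply: cder_quad => t.
have [C bC] := d `|t|.
have ci (F : tfun) s : Cl k 0 F -> cinteg leb2 (fun p => F s (toC p)).
  move=> [B [D [_ bd]]]; have [m b] := bd s.
  by apply: (@cinteg_le _ _ _ leb2 _ _ m (fun p => b (toC p))); exact/rintZ/rint_exp_cmod.
exists (2 * (C * \int[leb2]_p wt k (toC p))) => h h1.
rewrite -cintB//; [|exact: ci|exact: ci].
rewrite -cintZ; last exact: ci.
have c1 := cintegB (ci _ (t + h) cf) (ci _ t cf); have c2 := cintegZ h%:C (ci _ t cg).
rewrite -cintB// [leRHS](_ : _ = 2 * \int[leb2]_p (C * h ^+ 2 * wt k (toC p))); last first.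
  by rewrite RintegralZl//; [ring|exact: rint_exp_cmod].
apply: (@cmod_cint _ _ _ leb2).
- by have := cintegB c1 c2; exact: cinteg_meas.
- by move=> p; exact: bC.
- exact/rintZ/rint_exp_cmod.
Qed.

(** The derivative of the mass is twice the real part of [c] times the integral of [conj f * Pi T].
    Self-adjointness and [Pi f = f] remove the projection, leaving a real integral times the
    imaginary number [c]. *)
Lemma mass_conservation f T (c : R[i]) : Cl k 0 f -> Cl k 0 T -> Fock f ->
  tD k f (fun t z => c * Pi_proj (T t) z) -> complex.Re c = 0 ->
  (forall t z, complex.Im (conjc (f t z) * T t z) = 0) ->
  forall t s, mass (f t) = mass (f s).
Proof.
move=> cf cT Ff df c0 imT.
have cP := ClZ c (ClPi k0 cT).
have cJ := ClJ cf; have cPJ := ClJ cP.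
have dM := tDM k0 cf cJ cP cPJ df (tDJ df).
have dI := tD_cint (ClM k0 cf cJ) (ClD (ClM k0 cP cJ) (ClM k0 cf cPJ)) dM.
have E t : mass (f t) = complex.Re (cint leb2 (fun p => f t (toC p) * conjc (f t (toC p)))).
  by rewrite !ReImE; apply: eq_Rintegral => p _; rewrite -cmod_sqrC !ReImE.
suff D0 : cder (fun t => cint leb2 (fun p => f t (toC p) * conjc (f t (toC p)))) (fun=> 0).
  by move=> t s; rewrite !E (cder_const D0 t s).
apply: cder_eq dI _ => t.
have [B1 [C1 [_ b1]]] := cf; have [B2 [C2 [_ b2]]] := cT.
have bf := b1 t; have bT := b2 t.
have ci D F : wbd k D F -> cinteg leb2 (fun p => F (toC p)).
  move=> [m b].
  by apply: (@cinteg_le _ _ _ leb2 _ _ m (fun p => b (toC p))); exact/rintZ/rint_exp_cmod.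
have bPi := Pi_bound k0 bT.
have i1 := ci _ _ (wbdM k0 (wbdJ bf) bPi).
set X := cint leb2 (fun p => conjc (f t (toC p)) * T t (toC p)).
have EX : cint leb2 (fun p => conjc (f t (toC p)) * Pi_proj (T t) (toC p)) = X.
  rewrite (Pi_selfadjoint k0 bf bT); apply: eq_cint => p; by rewrite Ff.
have X0 : complex.Im X = 0.
  rewrite /X ReImE; transitivity (\int[leb2]_p (0 : R)).
    by apply: eq_Rintegral => p _; exact: imT.
  by have := congr1 (@complex.Im R) (cint0 leb2); rewrite !ReImE.
pose g (p : P) := c * (conjc (f t (toC p)) * Pi_proj (T t) (toC p)).
have ig : cinteg leb2 g by exact: cintegZ.
transitivity (cint leb2 (fun p => g p + conjc (g p))).
  apply: eq_cint => p; rewrite /g !conjM conjcK; ring.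
have igJ : cinteg leb2 (fun p => conjc (g p)).
  apply: (ci (cmod c * (C1 * expR (B1 * `|t|) * rho 0 t * (Cpi k * (C2 * expR (B2 * `|t|) * rho 0 t))))
    (fun z => conjc (c * (conjc (f t z) * Pi_proj (T t) z)))).
  exact: (wbdJ (wbdZ c (wbdM k0 (wbdJ bf) bPi))).
rewrite cintD// cint_conj// /g cintZ// EX.
move: (X) X0 => Y Y0; by apply: complex_ext; rewrite !ReImE c0 Y0; ring.
Qed.

End Mass.

(** * Construction of the flow *)

Section Vanishing.
Context (R : realType) (k A : R).
Hypotheses (k0 : 0 < k) (A0 : 0 < A).

Lemma expRN_le_half n : expR (- n%:R) <= 2^-1 ^+ n :> R.
Proof.
rewrite -mulr_natl -mulrN mulr_natl -[- 1 *+ n]mulr_natl expRM_natl.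
rewrite lerXn2r ?nnegrE ?expR_ge0// expRN lef_pV2 ?posrE ?expR_gt0//.
by have := @expR_ge1Dx R 1; lra.
Qed.

(** Gaussian decay beats [exp (B t)]; integer times provide the scale on which [le_geometric0]
    operates. *)
Lemma Cl_vanish f : Cl k A f -> exists2 C, 0 <= C &
  forall n, wbd k (C * 2^-1 ^+ n) (f n%:R).
Proof.
move=> [B [C [B0 bf]]]; have C0 := Cl_C_ge0 bf.
have B1 : B <= B + 1 by rewrite lerDl.
have B10 : 0 < B + 1 by rewrite ltr_wpDl.
(* The constant is that of [le_decay_weight] with [L = B + 1], a rate at least [1]. *)
exists (C * expR (A * (2 * (B + (B + 1)) / A) ^+ 2 / 4)); first by rewrite mulr_ge0 ?expR_ge0.
move=> n; apply: wbd_le (bf n%:R); rewrite -[leLHS]mulrA -[leRHS]mulrA ler_wpM2l//.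
apply: le_trans (le_decay_weight A0 B0 B1 B10 _) _; rewrite ler_wpM2l ?expR_ge0//.
apply: le_trans (decay_weight_le _ _ _ _) _ => //.
apply: le_trans (expRN_le_half n); rewrite ler_expR lerN2.
by rewrite ler_peMl// lerDr.
Qed.

End Vanishing.

Section CubicTerms.
Context (R : realType) (k A : R).
Hypotheses (k0 : 0 < k) (A0 : 0 <= A).
Notation tfun := (R -> R[i] -> R[i]).
Implicit Types (u v q r : tfun).

Lemma cmeas_cubic d (T : measurableType d) (f g : T -> R[i]) :
  cmeas f -> cmeas g -> cmeas (fun x => cubic (f x) (g x)).
Proof.
by move=> mf mg; apply: cmeasM => //; exact/cmeas_real/measurable_funX/measurable_cmod.
Qed.

Lemma Sm_cubic n v u : Sm k 0 n v -> Sm k 0 n u ->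
  Sm k 0 n (fun t z => cubic (v t z) (u t z)).
Proof.
move=> sv su; apply: (@Sm_ext _ _ _ _ (fun t z => v t z * conjc (v t z) * u t z)).
  by move=> t z; rewrite /cubic cmod_sqrC.
by apply: SmM => //; apply: SmM => //; exact: SmJ.
Qed.

(** Each term of the expanded difference contains [q], [conj q] or [r], and inherits its decay. *)
Lemma Sm_cubicD n v u q r : Sm k 0 n v -> Sm k 0 n u -> Sm k A n q -> Sm k A n r ->
  Sm k A n (fun t z => cubic (v t z + q t z) (u t z + r t z) - cubic (v t z) (u t z)).
Proof.
move=> sv su sq sr; have sq0 := Sm_weaken A0 sq; have sr0 := Sm_weaken A0 sr.
apply: (@Sm_ext _ _ _ _ (fun t z => r t z * (v t z * conjc (v t z)) +
  (q t z * (conjc (v t z + q t z) * (u t z + r t z)) +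
   conjc (q t z) * (v t z * (u t z + r t z))))).
  move=> t z; rewrite /cubic !cmod_sqrC (_ : conjc (v t z + q t z) = conjc (v t z) + conjc (q t z)).
    by ring.
  by apply: complex_ext; rewrite !ReImE// opprD.
have svq := SmJ (SmD sv sq0); have sur := SmD su sr0.
apply: SmD; first by apply: SmM => //; apply: SmM => //; exact: SmJ.
by apply: SmD; apply: SmM => //; [exact: SmM|exact: SmJ|exact: SmM].
Qed.

End CubicTerms.

Section SeparatedWaves.
Context (R : realType) (k A : R) (n : nat).
Hypotheses (k0 : 0 < k) (A0 : 0 < A).
Notation leb2 := (lebC R).
Notation P := (measurableTypeR R * measurableTypeR R)%type.
Notation tfun := (R -> R[i] -> R[i]).
Variable Wj : bool -> 'I_n -> tfun.

(* [true] labels [u] and [false] labels [v]. *)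
Definition sgn (b : bool) : R := if b then 1 else -1.
(** Its opposite is the coefficient of the projected term once the equation is solved for the time
    derivative: [-i] for [u], [i] for [v]. *)
Definition irot b : R[i] := iC R * (sgn b)%:C.

Lemma Re_rot b : complex.Re (irot b) = 0.
Proof. by rewrite !ReImE mul0r mulr0 subr0. Qed.

Lemma cmod_rot b : cmod (irot b) = 1.
Proof. by rewrite cmodM cmod_iC mul1r cmod_real; case: b; rewrite /= ?normrN normr1. Qed.

Lemma iC_rot b : iC R * - irot b = (sgn b)%:C.
Proof. by rewrite mulrN /irot mulrA iC_sqr mulN1r opprK. Qed.

Definition selfint b j : tfun := fun t z => cubic (Wj (~~ b) j t z) (Wj b j t z).

Hypothesis Wsm : forall b j m, Sm k 0 m (Wj b j).
Hypothesis WF : forall b j, Fock (Wj b j).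
Hypothesis Wmeas : forall b j, jmeas (Wj b j).
Hypothesis Wder : forall b j z, cder (fun t => Wj b j t z)
  (fun t => - irot b * Pi_proj (selfint b j t) z).
Hypothesis Wdecay : forall b j, exists2 C, 0 <= C & forall t, exists v, forall z,
  cmod (Wj b j t z) <= C * expR (- (4^-1 * cmod (z - v) ^+ 2)).
Hypothesis Wsep : forall b b' i j m, i != j ->
  Sm k A m (fun t z => Wj b i t z * conjc (Wj b' j t z)).

Definition Wsum b : tfun := fun t z => \sum_j Wj b j t z.
Definition selfsum b : tfun := fun t z => \sum_j selfint b j t z.
Definition source b : tfun :=
  fun t z => cubic (Wsum (~~ b) t z) (Wsum b t z) - selfsum b t z.

Lemma selfint_Sm b j m : Sm k 0 m (selfint b j).
Proof. exact: Sm_cubic. Qed.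

Lemma Wsum_Sm b m : Sm k 0 m (Wsum b).
Proof. exact: Sm_sum. Qed.

Lemma selfsum_Sm b m : Sm k 0 m (selfsum b).
Proof. by apply: Sm_sum => j; exact: selfint_Sm. Qed.

(* Every term left in the source pairs waves of two different speeds. *)
Lemma source_Sm b m : Sm k A m (source b).
Proof.
have A0' := ltW A0.
(* The waves with index [j] blanked out: their sum over [i] is [V - v], and [|V|^2 - |v|^2 = (V - v)
   conj V + v conj (V - v)]. *)
pose E c j i : tfun := fun t z => if i == j then 0 else Wj c i t z.
have sE c j i : Sm k 0 m (E c j i).
  rewrite /E; case: eqVneq => _; [exact: Sm0|exact: Wsm].
have pair c c' j i : Sm k A m (fun t z => E c j i t z * conjc (Wj c' j t z)).
  rewrite /E; case: eqVneq => ij; last exact: Wsep.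
  by apply: Sm_ext (Sm0 k A m) => t z; rewrite mul0r.
apply: (@Sm_ext _ _ _ _ (fun t z => \sum_j
  (\sum_i \sum_l E (~~ b) j i t z * conjc (Wj (~~ b) l t z) * Wj b j t z +
   \sum_i Wj (~~ b) j t z * conjc (E (~~ b) j i t z) * Wj b j t z))).
  move=> t z; rewrite /source /selfsum /Wsum /cubic mulr_sumr -sumrB.
  apply: eq_bigr => j _; rewrite /selfint /cubic !cmod_sqrC.
  set V := \sum_j Wj (~~ b) j t z; set v := Wj (~~ b) j t z; set u := Wj b j t z.
  have -> : \sum_i \sum_l E (~~ b) j i t z * conjc (Wj (~~ b) l t z) * u = (V - v) * conjc V * u.
    rewrite [in conjc V]/V (rmorph_sum (conjc (R := R))) [V - v](_ : _ = \sum_i E (~~ b) j i t z).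
      by rewrite mulr_suml mulr_suml; apply: eq_bigr => i _; rewrite mulr_sumr mulr_suml.
    rewrite /V (bigD1 j)//= [RHS](bigD1 j)//= /E eqxx add0r addrAC -/v subrr add0r.
    by apply: eq_bigr => i /negPf ->.
  have -> : \sum_i v * conjc (E (~~ b) j i t z) * u = v * conjc (V - v) * u.
    rewrite -mulr_suml -mulr_sumr -(rmorph_sum (conjc (R := R))) [V - v](_ : _ = \sum_i E (~~ b) j i t z)//.
    rewrite /V (bigD1 j)//= [RHS](bigD1 j)//= /E eqxx add0r addrAC -/v subrr add0r.
    by apply: eq_bigr => i /negPf ->.
  rewrite rmorphB; ring.
apply: Sm_sum => j; apply: SmD; apply: Sm_sum => i; last first.
  apply: (@Sm_ext _ _ _ _ (fun t z => conjc (E (~~ b) j i t z * conjc (Wj b j t z)) * Wj (~~ b) j t z)).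
    by move=> t z; rewrite conjM conjcK; ring.
  by apply: SmM => //; apply: SmJ; exact: pair.
(* A decaying pair needs exactly one conjugate, and only [Wj (~~ b) l] carries one. It is paired
   with [E] when [l = j], and with [Wj b j] otherwise. *)
apply: Sm_sum => l; case: (eqVneq l j) => [->|lj].
  exact: (SmM k0 A0' (pair _ _ _ _) (Wsm _ _ _)).
apply: (@Sm_ext _ _ _ _ (fun t z => conjc (Wj (~~ b) l t z * conjc (Wj b j t z)) * E (~~ b) j i t z)).
  by move=> t z; rewrite conjM conjcK; ring.
by apply: SmM => //; apply: SmJ; exact: Wsep.
Qed.

(** Linearity over the list of waves; the derivative witness in [Wsm] is identified with the
    equation by uniqueness. *)
Lemma Wsum_tD b : tD k (Wsum b) (fun t z => - irot b * Pi_proj (selfsum b t) z).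
Proof.
rewrite /Wsum /selfsum; elim: (index_enum _) => [|j s IH].
  apply: (@tD_ext _ _ (fun=> fun=> 0) _ (fun=> fun=> 0)); last exact: tD_cst.
    by move=> t z; rewrite big_nil.
  move=> t z; rewrite (_ : (fun w => _) = fun=> 0) ?Pi0 ?mulr0//.
  by apply/funext => w; rewrite big_nil.
have sS : Sm k 0 0 (fun t z => \sum_(i <- s) selfint b i t z).
  by apply: Sm_sum => i; exact: selfint_Sm.
have [_ [g dg _]] := Wsm b j 1.
have gE t z : g t z = - irot b * Pi_proj (selfint b j t) z.
  exact: (cder_unique (tD_cder z dg) (Wder b j z)).
apply: tD_ext (tDD dg IH) => t z; first by rewrite big_cons.
rewrite gE -mulrDr; congr (_ * _).
have [B1 [C1 [_ h1]]] := Sm_Cl (selfint_Sm b j 0); have [B2 [C2 [_ h2]]] := Sm_Cl sS.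
rewrite -(PiD z k0 (h1 t) (h2 t)); congr (Pi_proj _ z).
by apply/funext => w; rewrite big_cons.
Qed.

Lemma Wsum_Fock b : Fock (Wsum b).
Proof.
move=> t z; rewrite /Wsum; elim: (index_enum _) => [|j s IH].
  rewrite big_nil (_ : (fun w => _) = fun=> 0) ?Pi0//.
  by apply/funext => w; rewrite big_nil.
have sS : Sm k 0 0 (fun t z => \sum_(i <- s) Wj b i t z) by exact: Sm_sum.
have [B1 [C1 [_ h1]]] := Sm_Cl (Wsm b j 0); have [B2 [C2 [_ h2]]] := Sm_Cl sS.
rewrite big_cons -IH -[in RHS](WF b j) -(PiD z k0 (h1 t) (h2 t)); congr (Pi_proj _ z).
by apply/funext => w; rewrite big_cons.
Qed.

(** Each wave lies under a Gaussian that is only translated in time, so the bounds are uniform. The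
    mass is at most the supremum times an [L^1] norm. *)
Lemma Wsum_bounded : exists2 M, 0 < M & exists m0, forall b t,
  (forall z, cmod (Wsum b t z) <= M) /\ mass (Wsum b t) <= m0.
Proof.
pose C b j := sval (cid2 (Wdecay b j)).
have C0 b j : 0 <= C b j by rewrite /C; case: cid2.
have CW b j t : exists v, forall z, cmod (Wj b j t z) <= C b j * expR (- (4^-1 * cmod (z - v) ^+ 2)).
  by rewrite /C; case: cid2 => D D0 h /=; exact: h.
pose S := \sum_b \sum_j C b j.
have S0 : 0 <= S by apply: sumr_ge0 => b _; exact: sumr_ge0.
have Sb b : \sum_j C b j <= S.
  by rewrite /S (bigD1 b)//= lerDl; apply: sumr_ge0 => c _; exact: sumr_ge0.
have W1 b t z : cmod (Wsum b t z) <= S.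
  apply: le_trans (cmod_sum _ _ _) _; apply: le_trans (Sb b); apply: ler_sum => j _.
  have [v h] := CW b j t; apply: le_trans (h z) _; rewrite ler_piMr// -expR0 ler_expR oppr_le0.
  by apply: mulr_ge0; rewrite ?sqr_ge0.
exists (S + 1); first by rewrite ltr_wpDl.
exists (S * (S * (pi / 4^-1))) => b t; split=> [z|]; first by apply: (le_trans (W1 b t z)); rewrite lerDl.
pose v j := sval (cid (CW b j t)).
have vW j z : cmod (Wj b j t z) <= C b j * expR (- (4^-1 * cmod (z - v j) ^+ 2)).
  by rewrite /v; case: cid.
pose g (p : P) := \sum_j C b j * expR (- (4^-1 * cmod (toC p - v j) ^+ 2)).
have q0 : 0 < 4^-1 :> R by rewrite invr_gt0.
have [ig eg] : rint leb2 g /\ \int[leb2]_p g p = (\sum_j C b j) * (pi / 4^-1).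
  rewrite /g; elim: (index_enum _) => [|j s [is_ es]].
    have -> : (fun p : P => \sum_(j <- [::]) C b j * expR (- (4^-1 * cmod (toC p - v j) ^+ 2))) =
       fun p => 0 * expR (- (1 * cmod (toC p - 0) ^+ 2)).
      by apply/funext => p; rewrite big_nil mul0r.
    have [i1 e1] := @gauss2 R 1 0 ltr01.
    by split; [exact: rintZ|rewrite RintegralZl// big_nil !mul0r].
  have [ij ej] := gauss2 (v j) q0.
  have -> : (fun p : P => \sum_(j0 <- j :: s) C b j0 * expR (- (4^-1 * cmod (toC p - v j0) ^+ 2))) =
     fun p => C b j * expR (- (4^-1 * cmod (toC p - v j) ^+ 2)) +
       \sum_(j <- s) C b j * expR (- (4^-1 * cmod (toC p - v j) ^+ 2)).
    by apply/funext => p; rewrite big_cons.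
  split; first by apply: rintD => //; exact: rintZ.
  rewrite RintegralD//; last exact: rintZ.
  by rewrite RintegralZl// ej es big_cons (mulrDl (C b j)).
have Wg p : cmod (Wsum b t (toC p)) <= g p.
  by apply: le_trans (cmod_sum _ _ _) _; apply: ler_sum => j _; exact: vW.
have [B [D [_ h]]] := Sm_Cl (Wsum_Sm b 0).
apply: (@le_trans _ _ (\int[leb2]_p (S * g p))); last first.
  rewrite RintegralZl// eg ler_wpM2l// ler_wpM2r//.
  by apply: divr_ge0; [exact: pi_ge0|exact: ltW].
apply: Rintegral_le; [exact: rint_mass k0 _ _ (h t)|exact: rintZ|].
by move=> p; rewrite expr2; apply: ler_pM; rewrite ?cmod_ge0.
Qed.

Section TruncatedFlow.
Variable M : R.
Hypothesis M0 : 0 < M.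
Hypothesis WM : forall b t z, cmod (Wsum b t z) <= M.

(** The truncation acts on the total [Wsum + r], not on [r] alone: the total then solves a truncated
    system that conserves mass. *)
Definition truncated_source (r : bool -> tfun) b : tfun := fun t z =>
  cubic (trunc M (Wsum (~~ b) t z + r (~~ b) t z)) (trunc M (Wsum b t z + r b t z)) -
  selfsum b t z.

Lemma Wsum_jmeas b : jmeas (Wsum b).
Proof. by apply: cmeas_sum => j; exact: Wmeas. Qed.

Lemma selfsum_jmeas b : jmeas (selfsum b).
Proof. by apply: cmeas_sum => j; apply: cmeas_cubic; exact: Wmeas. Qed.

Lemma truncated_source_jmeas r : (forall b, jmeas (r b)) ->
  forall b, jmeas (truncated_source r b).
Proof.
move=> mr b; apply: cmeasB; last exact: selfsum_jmeas.
by apply: cmeas_cubic; apply: cmeas_trunc; apply: cmeasD; [exact: Wsum_jmeas|exact: mr|exact: Wsum_jmeas|exact: mr].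
Qed.

Lemma truncated_source0 b t z : truncated_source (fun _ _ _ => 0) b t z = source b t z.
Proof. by rewrite /truncated_source !addr0 !(trunc_id M0). Qed.

Lemma truncated_source_lip om r r' C : 0 <= C ->
  (forall b, obd k om C (fun t z => r b t z - r' b t z)) ->
  forall b, obd k om (6 * M ^+ 2 * C)
    (fun t z => truncated_source r b t z - truncated_source r' b t z).
Proof.
move=> C0 h b t z; rewrite /truncated_source [X in cmod X](_ : _ =
  cubic (trunc M (Wsum (~~ b) t z + r (~~ b) t z)) (trunc M (Wsum b t z + r b t z)) -
  cubic (trunc M (Wsum (~~ b) t z + r' (~~ b) t z)) (trunc M (Wsum b t z + r' b t z))); last by ring.
apply: le_trans (trunc_cubic_lip M0 _ _ _ _) _.
have e c : Wsum c t z + r c t z - (Wsum c t z + r' c t z) = r c t z - r' c t z by ring.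
rewrite !e.
rewrite [leRHS](_ : _ = 4 * M ^+ 2 * (C * om t * wt k z) + 2 * M ^+ 2 * (C * om t * wt k z)); last by ring.
by apply: lerD; apply: ler_wpM2l; rewrite ?h//; apply: mulr_ge0; rewrite ?sqr_ge0.
Qed.

Lemma truncated_flow : exists r : bool -> tfun, [/\ forall b, Cl k A (r b),
  forall b, tD k (r b) (fun t z => - irot b * Pi_proj (truncated_source r b t) z) &
  forall b, Cl k A (truncated_source r b)].
Proof.
have [B [C [B0 C0 hS]]] : exists B C, [/\ 0 <= B, 0 <= C &
    forall b t, wbd k (C * expR (B * `|t|) * rho A t) (source b t)].
  have [B1 [C1 [B10 h1]]] := Sm_Cl (source_Sm true 0).
  have [B2 [C2 [B20 h2]]] := Sm_Cl (source_Sm false 0).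
  have C10 := Cl_C_ge0 h1; have C20 := Cl_C_ge0 h2.
  have le12 t (D D' E E' : R) : 0 <= D -> 0 <= D' -> 0 <= E' ->
      D * expR (E * `|t|) * rho A t <= (D + D') * expR ((E + E') * `|t|) * rho A t.
    move=> D0 D0' E0'; rewrite ler_wpM2r ?rho_ge0//; apply: ler_pM; rewrite ?expR_ge0 ?lerDl//.
    by rewrite ler_expR mulrDl lerDl mulr_ge0.
  exists (B1 + B2), (C1 + C2); split; [exact: addr_ge0|exact: addr_ge0|].
  case=> t; first by apply: wbd_le (h1 t); exact: le12.
  by apply: wbd_le (h2 t); rewrite (addrC B1) (addrC C1); exact: le12.
pose ell := 6 * M ^+ 2.
have ell0 : 0 <= ell by apply: mulr_ge0; rewrite ?sqr_ge0.
(* Large enough to exceed the growth rate of the source and to make the Picard map contract; the [1]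
   makes it positive. *)
pose L := B + 4 * Cpi k * ell + 1.
have Cp := Cpi_gt0 k.
have Ce : 0 <= 4 * Cpi k * ell.
  by apply: mulr_ge0 => //; apply: mulr_ge0 => //; exact: ltW.
have L0 : 0 < L by rewrite /L; move: Ce B0; lra.
have BL : B <= L by rewrite /L; move: Ce B0; lra.
have small : 4 * Cpi k * ell <= L by rewrite /L; move: Ce B0; lra.
pose om := decay_weight A B L.
have om0 t : 0 <= om t by exact: decay_weight_ge0.
have omd t s : t <= s -> om s <= om t * expR (- (L * (s - t))) by exact: decay_weight_decay.
pose c0 := expR (A * (2 * (B + L) / A) ^+ 2 / 4).
have c00 : 0 <= c0 by exact: expR_ge0.
pose s0 := C * c0.
have s00 : 0 <= s0 by exact: mulr_ge0.
have H0 b : obd k om s0 (truncated_source (fun _ _ _ => 0) b).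
  move=> t z; rewrite truncated_source0; apply: le_trans (proj2 (hS b t) z) _.
  rewrite ler_wpM2r ?wt_ge0// /s0 -[leLHS]mulrA -[leRHS]mulrA ler_wpM2l//.
  exact: le_decay_weight.
have rot1 b : cmod (irot b) <= 1 by rewrite cmod_rot.
have [r [mr br er]] := Picard k0 L0 om0 omd s00 ell0 rot1 truncated_source_jmeas H0
  (fun r r' C => @truncated_source_lip om r r' C) small.
set D := 8 * Cpi k * s0 / L in br.
have D0 : 0 <= D.
  by apply: divr_ge0 (ltW L0); apply: mulr_ge0 => //; apply: mulr_ge0 => //; exact: ltW.
have mH := truncated_source_jmeas mr.
pose D1 := s0 + ell * D.
have D10 : 0 <= D1 by apply: addr_ge0 => //; exact: mulr_ge0.
have bH b : obd k om D1 (truncated_source r b).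
  move=> t z; rewrite -[X in cmod X](subrK (truncated_source (fun _ _ _ => 0) b t z)).
  apply: le_trans (cmodD _ _) _; rewrite /D1 [s0 + _]addrC mulrDl mulrDl; apply: lerD; last exact: H0.
  apply: (@truncated_source_lip om r (fun _ _ _ => 0) D D0) => b' t' z'.
  by rewrite subr0; exact: br.
have obd_Cl E f : 0 <= E -> jmeas f -> obd k om E f -> Cl k A f.
  move=> E0 mf bf; exists (L + A * (2 * (B + L) / A) / 2), (E * c0); split.
    apply: addr_ge0; first exact: ltW.
    apply: divr_ge0 => //; apply: mulr_ge0; first exact: ltW.
    apply: divr_ge0; last exact: ltW.
    by apply: mulr_ge0 => //; apply: addr_ge0 => //; exact: ltW.
  move=> t; apply: wbd_le (obd_wbd t mf bf); rewrite -[leRHS]mulrA -[leRHS]mulrA ler_wpM2l//.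
  exact: decay_weight_rho.
exists r; split => b; [exact: obd_Cl (br b)| |exact: obd_Cl (bH b)].
have lipW c T : exists2 E, 0 <= E & forall t h z, `|t| <= T -> `|h| <= 1 ->
    cmod (Wsum c (t + h) z - Wsum c t z) <= E * `|h| * wt k z.
  by apply: (tD_lip _ (Wsum_tD c)); apply: ClZ; apply: ClPi => //; exact: Sm_Cl (selfsum_Sm c 0).
have lipN T : exists2 E, 0 <= E & forall t h z, `|t| <= T -> `|h| <= 1 ->
    cmod (selfsum b (t + h) z - selfsum b t z) <= E * `|h| * wt k z.
  have [_ [g dg cg]] := selfsum_Sm b 1.
  exact: (tD_lip cg dg).
have lipr c T : exists2 E, 0 <= E & forall t h z, `|t| <= T -> `|h| <= 1 ->
    cmod (r c (t + h) z - r c t z) <= E * `|h| * wt k z.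
  have [E E0 hE] := tint_lip k0 L0 om0 omd D10 (mH c) (bH c) T.
  by exists E => // t h z tT h1; rewrite !er -mulrBr cmodM cmod_rot mul1r; exact: hE.
(* The truncation is merely Lipschitz, which is the regularity that [tint_tD] asks for; higher
   derivatives must wait until it is known to be inactive. *)
have lipH T : exists2 E, 0 <= E & forall t h z, `|t| <= T -> `|h| <= 1 ->
    cmod (truncated_source r b (t + h) z - truncated_source r b t z) <= E * `|h| * wt k z.
  have [E1 E10 h1] := lipW (~~ b) T; have [E2 E20 h2] := lipW b T.
  have [E3 E30 h3] := lipr (~~ b) T; have [E4 E40 h4] := lipr b T; have [E5 E50 h5] := lipN T.
  have M20 := sqr_ge0 M.
  exists (4 * M ^+ 2 * (E1 + E3) + 2 * M ^+ 2 * (E2 + E4) + E5).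
    by apply: addr_ge0 => //; apply: addr_ge0; apply: mulr_ge0;
       rewrite ?addr_ge0//; exact: mulr_ge0.
  move=> t h z tT hh; rewrite /truncated_source; set a := cubic _ _; set a' := cubic _ _.
  rewrite (_ : _ - _ - _ = a - a' - (selfsum b (t + h) z - selfsum b t z)); last by ring.
  apply: le_trans (cmodB _ _) _; rewrite !mulrDl; apply: lerD; last exact: h5.
  apply: le_trans (trunc_cubic_lip M0 _ _ _ _) _.
  have dif (x y x' y' : R[i]) (e e' : R) : cmod (x - x') <= e -> cmod (y - y') <= e' ->
      cmod (x + y - (x' + y')) <= e + e'.
    move=> hx hy; rewrite (_ : _ - _ = (x - x') + (y - y')); last by ring.
    by apply: le_trans (cmodD _ _) _; exact: lerD.
  have q1 := dif _ _ _ _ _ _ (h1 t h z tT hh) (h3 t h z tT hh).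
  have q2 := dif _ _ _ _ _ _ (h2 t h z tT hh) (h4 t h z tT hh).
  rewrite [leRHS](_ : _ = 4 * M ^+ 2 * (E1 * `|h| * wt k z + E3 * `|h| * wt k z) +
     2 * M ^+ 2 * (E2 * `|h| * wt k z + E4 * `|h| * wt k z)); last by ring.
  by apply: lerD; apply: ler_wpM2l => //; exact: mulr_ge0.
apply: tD_ext (tDZ (irot b) (tint_tD k0 L0 omd D10 (mH b) (bH b) lipH)) => t z.
  by rewrite er.
by rewrite mulrN mulNr.
Qed.

End TruncatedFlow.
(* Mass conservation bounds the truncated flow by the mass of the waves, hence
   pointwise in the Fock space, so a high truncation is never active. *)
Lemma separated_flow : exists r : bool -> tfun, [/\ forall b m, Sm k A m (r b),
  forall b, Fock (r b) & forall b, tD k (fun t z => Wsum b t z + r b t z)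
    (fun t z => - irot b * Pi_proj
       (fun w => cubic (Wsum (~~ b) t w + r (~~ b) t w) (Wsum b t w + r b t w)) z)].
Proof.
have A0' := ltW A0.
have [M1 M10 [m0 hM]] := Wsum_bounded.
have m00 : 0 <= m0.
  apply: le_trans (proj2 (hM true 0)); apply: Rintegral_ge0 => p _; exact: sqr_ge0.
have pi0 : 0 <= pi^-1 :> R by rewrite invr_ge0 pi_ge0.
(* [M1] bounds the waves, and [pi^-1 + 2 * m0] will bound the total through [Fock_le_mass]. *)
pose M := M1 + (pi^-1 + 2 * m0).
have M0 : 0 < M by rewrite /M ltr_pwDl// addr_ge0// mulr_ge0.
have WM b t z : cmod (Wsum b t z) <= M.
  by apply: le_trans (proj1 (hM b t) z) _; rewrite /M lerDl addr_ge0// mulr_ge0.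
have [r [cr dr cH]] := truncated_flow M0 WM.
have cr0 b := Cl_weaken A0' (cr b); have cH0 b := Cl_weaken A0' (cH b).
have cdr b : Cl k 0 (fun t z => - irot b * Pi_proj (truncated_source M r b t) z).
  exact/ClZ/ClPi.
(* [r - Pi_proj r] has zero time derivative, the right side being already projected, and it vanishes
   as [t] tends to [+oo]. *)
have Fr b : Fock (r b).
  move=> t z.
  have d2 := tDPi k0 (cr0 b) (cdr b) (dr b).
  have dq : cder (fun t => r b t z + -1 * Pi_proj (r b t) z) (fun=> 0).
    apply: cder_eq (cderD (tD_cder z (dr b)) (cderZ (-1) (tD_cder z d2))) _ => s.
    have [B [C [_ h]]] := cH0 b.
    rewrite (PiZ _ _ k0 (Pi_bound k0 (h s))) (Pi_idem _ k0 (h s)); ring.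
  have [C C0 hC] := Cl_vanish A0 (cr b).
  apply/esym/subr0_eq/cmod_eq0/le_anti; rewrite cmod_ge0 andbT.
  apply: (@le_geometric0 _ _ (C + Cpi k * C)) => n'.
  have := cder_const dq t n'%:R; rewrite !mulN1r => ->.
  apply: le_trans (cmodB _ _) _; rewrite mulrDl -mulrA; apply: lerD.
    apply: le_trans (proj2 (hC n') z) _; rewrite ler_piMr ?wt_le1 ?mulr_ge0 ?exprn_ge0//.
  apply: le_trans (proj2 (Pi_bound k0 (hC n')) z) _; rewrite ler_piMr ?wt_le1//.
  by apply: mulr_ge0; rewrite ?mulr_ge0 ?exprn_ge0 ?(ltW (Cpi_gt0 k)).
pose u b : tfun := fun t z => Wsum b t z + r b t z.
pose T b : tfun := fun t z => cubic (trunc M (u (~~ b) t z)) (trunc M (u b t z)).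
have TE b t z : selfsum b t z + truncated_source M r b t z = T b t z.
  by rewrite /truncated_source addrC subrK.
have cW b := Sm_Cl (Wsum_Sm b 0); have cN b := Sm_Cl (selfsum_Sm b 0).
have cu b : Cl k 0 (u b) by exact: ClD.
have cT b : Cl k 0 (T b).
  have -> : T b = fun t z => selfsum b t z + truncated_source M r b t z.
    by apply/funext => t; apply/funext => z; rewrite TE.
  exact: ClD.
have du b : tD k (u b) (fun t z => - irot b * Pi_proj (T b t) z).
  apply: tD_ext (tDD (Wsum_tD b) (dr b)) => // t z; rewrite -mulrDr.
  have [B1 [C1 [_ h1]]] := cN b; have [B2 [C2 [_ h2]]] := cH0 b.
  rewrite -(PiD z k0 (h1 t) (h2 t)); congr (_ * Pi_proj _ z).
  by apply/funext => w; rewrite TE.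
have Fu b : Fock (u b).
  move=> t z; have [B1 [C1 [_ h1]]] := cW b; have [B2 [C2 [_ h2]]] := cr0 b.
  by rewrite /u (PiD z k0 (h1 t) (h2 t)) Fr Wsum_Fock.
have uM b t z : cmod (u b t z) <= M.
  have [B [C [_ h]]] := cu b.
  apply: le_trans (Fock_le_mass k0 (h t) (Fu b t z)) _.
  (* The mass at [t] equals that at a late integer time, where [massD_le] bounds it by twice the
     mass of the waves plus a vanishing term. *)
  suff : mass (u b t) <= 2 * m0 by rewrite /M; move: M10; lra.
  rewrite -subr_le0; have [D D0 hD] := Cl_vanish A0 (cr b).
  set I := \int[leb2]_p wt k (toC p).
  have I0 : 0 <= I by apply: Rintegral_ge0 => p _; exact: wt_ge0.
  apply: (@le_geometric0 _ _ (2 * (D ^+ 2 * I))) => n'.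
  have re0 : complex.Re (- irot b) = 0 by rewrite cReN Re_rot oppr0.
  rewrite (mass_conservation k0 (cu b) (cT b) (Fu b) (du b) re0 _ t n'%:R); last first.
    move=> s w; exact: trunc_cubic_real.
  have [B1 [C1 [_ h1]]] := cW b.
  have le1 := massD_le k0 (h1 n'%:R) (hD n').
  have le2 := mass_le k0 (hD n'); have le3 := proj2 (hM b n'%:R).
  have le4 : (D * 2^-1 ^+ n') ^+ 2 * I <= D ^+ 2 * I * 2^-1 ^+ n'.
    rewrite exprMn mulrAC ler_wpM2l//; first by rewrite mulr_ge0 ?sqr_ge0.
    by rewrite expr2 ler_piMr ?exprn_ge0// exprn_ile1//; lra.
  by move: le1 le2 le3 le4; rewrite /u -/I; lra.
have Tu b t z : T b t z = cubic (u (~~ b) t z) (u b t z) by rewrite /T !(trunc_id M0).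
exists r; split => //; last first.
  by move=> b; apply: tD_ext (du b) => // t z; congr (_ * Pi_proj _ z); apply/funext => w.
(* Bootstrap: with the truncation inactive the right side is polynomial in the unknowns and their
   conjugates, so [m] derivatives of [r] yield one more through the equation. *)
move=> b m; elim: m b => [|m IH] b /=; first exact: cr.
split; first exact: cr.
exists (fun t z => - irot b * Pi_proj (truncated_source M r b t) z); first exact: dr.
apply: SmZ; apply: SmPi => //.
apply: Sm_ext (SmD (source_Sm b m) (Sm_cubicD k0 A0' (Wsum_Sm (~~ b) m) (Wsum_Sm b m)
  (IH (~~ b)) (IH b))) => t z.
have -> : truncated_source M r b t z = cubic (u (~~ b) t z) (u b t z) - selfsum b t z.
  exact: (congr1 (fun x => x - selfsum b t z) (Tu b t z)).
by rewrite /source /u; ring.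
Qed.

End SeparatedWaves.

(** * Gaussian decay in the weighted norm and assembly of the result *)

Section GaussianRemainder.
Context (R : realType) (k kappa A : R).
Hypotheses (k0 : 0 < k) (kk : kappa < k).

(** The gap [d = (1/4 - c) A] leaves a Gaussian that absorbs the growth:
    [B t - d t^2 <= B^2 / (4 d)]. *)
Lemma Xnorm_gauss_decay f c : 0 < A -> c < 4^-1 -> Cl k A f ->
  exists2 C, 0 <= C & forall t, 0 <= t ->
    (Xnorm kappa (f t) <= (C * expR (- (c * A * t ^+ 2)))%:E)%E.
Proof.
move=> A0 c4 [B [C [B0 bf]]]; have C0 := Cl_C_ge0 bf.
pose d := (4^-1 - c) * A.
have d0 : 0 < d by rewrite mulr_gt0 ?subr_gt0.
exists (C * cL2 (k - kappa) * expR (B ^+ 2 / (4 * d))).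
  by rewrite !mulr_ge0 ?expR_ge0// sqrtr_ge0.
move=> t t0; apply: le_trans (Xnorm_le kk (bf t)) _; rewrite lee_fin.
rewrite /rho max_l// ger0_norm//.
have -> : C * expR (B * t) * expR (- (A * t ^+ 2 / 4)) * cL2 (k - kappa) =
  C * cL2 (k - kappa) * expR (B * t - A * t ^+ 2 / 4) by rewrite expRD; ring.
rewrite -[leRHS]mulrA -expRD ler_wpM2l ?mulr_ge0 ?sqrtr_ge0// ler_expR.
have -> : B * t - A * t ^+ 2 / 4 = B * t - d * t ^+ 2 - c * A * t ^+ 2 by rewrite /d; field.
rewrite lerD2r ler_pdivlMr ?mulr_gt0//; have := sqr_ge0 (B - 2 * d * t); lra.
Qed.

End GaussianRemainder.

Lemma Xnorm0 (R : realType) (kappa : R) : (Xnorm kappa (fun=> 0%R) <= 0)%E.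
Proof.
have b : wbd (kappa + 1) 0 (fun=> 0 : R[i]).
  by split=> [|z]; [exact: cmeas_cst|rewrite cmod0 mul0r].
have kk : kappa < kappa + 1 by rewrite ltrDl.
by have := Xnorm_le kk b; rewrite mul0r.
Qed.

Lemma dtn_0 (R : realType) m : dtn m (fun _ _ => 0 : R[i]) = fun _ _ => 0.
Proof.
elim: m => [|m IH]; first exact: dtn0.
by rewrite (dtnS _ (tD_cst 1 (fun=> 0))).
Qed.

(** Every term of the minimum is a positive real because the speeds differ, and the value [+oo]
    excludes any pair of distinct indices. *)
Lemma alpha_sharpP (R : realType) n (alpha : 'I_n -> R[i]) :
  (forall i j, i != j -> alpha i != alpha j) ->
  (alpha_sharp alpha = +oo%E /\ forall i j : 'I_n, i = j) \/
  exists a, [/\ 0 < a, alpha_sharp alpha = a%:E &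
    forall i j, i != j -> a <= cmod (alpha i - alpha j)].
Proof.
move=> ne.
have le i j : i != j -> (alpha_sharp alpha <= (cmod (alpha i - alpha j))%:E)%E.
  move=> ij; exact: (@bigmin_le_cond _ _ _ _ (i, j)).
have : alpha_sharp alpha = +oo%E \/ exists2 a, 0 < a & alpha_sharp alpha = a%:E.
  rewrite /alpha_sharp; elim/big_ind: _ => [|x y hx hy|[i j] /= ij]; first by left.
    by rewrite /mine; case: ifP.
  right; exists (cmod (alpha i - alpha j)) => //.
  rewrite lt_neqAle cmod_ge0 andbT eq_sym; apply/eqP => /cmod_eq0 /subr0_eq e.
  by have := ne i j ij; rewrite e eqxx.
case=> [e|[a a0 e]]; [left|right].
  by split => // i j; apply/eqP/negPn/negP => /le; rewrite e.
by exists a; split => // i j /le; rewrite e lee_fin.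
Qed.

Theorem theorem1p3 (R : realType) (n : nat) (n_ge1 : (1 <= n)%N)
  (K a b theta : 'I_n -> R) (gamma : 'I_n -> R[i])
  (lambda mu : 'I_n -> R) (alpha : 'I_n -> R[i])
  (K_gt0 : forall j, 0 < K j)
  (lambdaE : forall j, lambda j = K j ^+ 2 / (32 * pi) *
     (7 + 2 * Num.sqrt 3 *
        complex.Im (gamma j * cexp (- (iC R * (theta j)%:C)))))
  (muE : forall j, mu j = K j ^+ 2 / (32 * pi) *
     (- 7 + 2 * Num.sqrt 3 *
        complex.Im (gamma j * cexp (- (iC R * (theta j)%:C)))))
  (alphaE : forall j, alpha j =
     (Num.sqrt 3 / (32 * pi) * K j ^+ 2)%:C * cexp (- (iC R * (theta j)%:C)))
  (alpha_neq : forall j l, j != l -> alpha j != alpha l) :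
  forall kappa : R, 0 < kappa ->
  exists u v r1 r2 : R -> R[i] -> R[i],
    [/\ smooth_in_X kappa u /\ smooth_in_X kappa v,
        coupled_LLL u v,
        forall t z, u t z =
          \sum_(j < n) travelling_wave (lambda j) (alpha j)
             (profile 1 (K j) (a j) (theta j) (gamma j)) t z + r1 t z,
        forall t z, v t z =
          \sum_(j < n) travelling_wave (mu j) (alpha j)
             (profile (-1) (K j) (b j) (theta j) (gamma j)) t z + r2 t z
      & forall (c : R) (m : nat), c < 4^-1 ->
        exists2 C : R, 0 < C & forall t : R, 0 <= t ->
          (Xnorm kappa (dtn m r1 t) + Xnorm kappa (dtn m r2 t) <=
           C%:E * expeR (- (c%:E * alpha_sharp alpha ^+ 2 * (t ^+ 2)%:E)))%E].
Proof.
(* The extra unit of weight converts pointwise bounds into norms of weight [kappa]. *)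
move=> kappa kappa0; pose k := kappa + 1.
have k0 : 0 < k by rewrite addr_gt0.
have kk : kappa < k by rewrite ltrDl.
pose W c j := soliton (K j) (theta j) (gamma j) (alpha j) (sgn R c)
  (if c then a j else b j) (if c then lambda j else mu j).
have Ww c j : wave (alpha j) (gamma j) (if c then lambda j else mu j) (W c j).
  exact: soliton_wave.
have Wsm c j m : Sm k 0 m (W c j) by exact: wave_Sm (Ww c j).
have WF c j : Fock (W c j) by exact: soliton_Fock.
have Wmeas c j : jmeas (W c j) by exact: wave_jmeas (Ww c j).
have Wder c j z : cder (fun t => W c j t z)
    (fun t => - irot R c * Pi_proj (selfint W c j t) z).
  have sN : sgn R (~~ c) = - sgn R c by case: c; rewrite /= ?opprK.
  rewrite /selfint {2}/W sN; apply: soliton_cder => //.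
    by case: c {sN}; rewrite /sgn ?sqrrN expr1n.
  by case: c {sN}; rewrite /sgn ?mulrN mulr1 ?lambdaE ?muE.
have Wdecay c j : exists2 C, 0 <= C & forall t, exists v, forall z,
    cmod (W c j t z) <= C * expR (- (4^-1 * cmod (z - v) ^+ 2)).
  have [C C0 h] := soliton_decay (K j) (theta j) (gamma j) (alpha j) (sgn R c)
    (if c then a j else b j) (if c then lambda j else mu j).
  exists C => // t; exists (conjc (gamma j) - alpha j * t%:C) => z.
  have -> : z - (conjc (gamma j) - alpha j * t%:C) = z + alpha j * t%:C - conjc (gamma j) by ring.
  exact: h.
(* Whether [alpha_sharp] is finite matters only for producing the remainder, so both cases are
   reduced to that. *)
suff [r [sr Fr dr decay]] : exists r : bool -> R -> R[i] -> R[i], [/\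
    forall c m, Sm k 0 m (r c), forall c, Fock (r c),
    forall c, tD k (fun t z => Wsum W c t z + r c t z) (fun t z => - irot R c * Pi_proj
      (fun w => cubic (Wsum W (~~ c) t w + r (~~ c) t w) (Wsum W c t w + r c t w)) z) &
    forall q c m, c < 4^-1 -> exists2 C, 0 <= C & forall t, 0 <= t ->
      (Xnorm kappa (dtn m (r q) t) <=
       C%:E * expeR (- (c%:E * alpha_sharp alpha ^+ 2 * (t ^+ 2)%:E)))%E].
  pose u q t z := Wsum W q t z + r q t z.
  have su q : smooth_in_X kappa (u q).
    apply: Sm_smooth_in_X kk _ _ => // [m|t z].
      by apply: SmD => //; exact: Wsum_Sm.
    have [B1 [C1 [_ h1]]] := Sm_Cl (Wsum_Sm Wsm q 0).
    have [B2 [C2 [_ h2]]] := Sm_Cl (sr q 0).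
    by rewrite (PiD z k0 (h1 t) (h2 t)) Fr (Wsum_Fock k0 Wsm WF).
  have eu q t z : iC R * dtn 1 (u q) t z =
      (sgn R q)%:C * Pi_proj (fun w => cubic (u (~~ q) t w) (u q t w)) z.
    by rewrite (dtnS 0 (dr q)) dtn0 mulrA iC_rot.
  exists (u true), (u false), (r true), (r false); split => //.
    by move=> t z; rewrite !eu /sgn mul1r; split => //; rewrite (rmorphN1 (real_complex R)) mulN1r.
  move=> c m c4; have [C1 C10 h1] := decay true c m c4; have [C2 C20 h2] := decay false c m c4.
  exists (C1 + C2 + 1) => [|t t0]; first by rewrite ltr_wpDl ?addr_ge0.
  apply: (@le_trans _ _ ((C1%:E + C2%:E) * expeR (- (c%:E * alpha_sharp alpha ^+ 2 * (t ^+ 2)%:E)))%E).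
    by rewrite ge0_muleDl ?lee_fin// leeD ?h1 ?h2.
  by rewrite lee_wpmul2r ?expeR_ge0// -EFinD lee_fin lerDl.
have [[ainf all_eq]|[al [al0 ale sep]]] := alpha_sharpP alpha_neq.
  (* A lone wave is an exact solution: the remainder is zero, and its norm lies below the right side
     whatever value the exponential takes. *)
  exists (fun _ _ _ => 0); split.
  - by move=> c m; exact: Sm0.
  - by move=> c t z; exact: Pi0.
  - move=> c; apply: tD_ext (Wsum_tD k0 Wsm Wder c) => t z; first by rewrite addr0.
    congr (_ * Pi_proj _ z); apply/funext => w; rewrite !addr0 /selfsum /Wsum.
    have S1 (F : 'I_n -> R[i]) : \sum_j F j = F (Ordinal n_ge1).
      by rewrite (big_pred1 (Ordinal n_ge1)) => // j; rewrite (all_eq j (Ordinal n_ge1)) /= eqxx.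
    by rewrite !S1.
  - move=> _ c m _; exists 1 => // t _; rewrite dtn_0; apply: le_trans (Xnorm0 kappa) _.
    by rewrite mul1e expeR_ge0.
(* The rate is [A = al ^+ 2], so that [rho A] carries the exponent [alpha_sharp^2 t^2 / 4]. *)
have A0 : 0 < al ^+ 2 by rewrite exprn_gt0.
have Wsep c c' i j m : i != j -> Sm k (al ^+ 2) m (fun t z => W c i t z * conjc (W c' j t z)).
  move=> ij; apply: (interaction_Sm k0 (ltW A0) _ m (Ww c i) (Ww c' j)).
  by rewrite ler_sqr ?nnegrE ?cmod_ge0 ?(ltW al0)// sep.
have [r [sr Fr dr]] := separated_flow k0 A0 Wsm WF Wmeas Wder Wdecay Wsep.
exists r; split => // [c m|q c m c4]; first exact: Sm_weaken (ltW A0) (sr c m).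
have [cr _] := Sm_dtn (sr q m.+1) (ltnSn m).
have [C C0 h] := Xnorm_gauss_decay kk A0 c4 cr.
by exists C => // t t0; rewrite ale -EFin_expe -!EFinM /=; exact: h.
Qed.
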